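(* Let $\alpha\in(0,1/e)$, $\beta\in(0,1)$ and $\delta,R,R'>0$. For all $i\in\{1,\dots,p\}$ and $j\in\{1,\dots,q\}$ define $$\lambda_i^*=\mu_j^*=n^{-2/(4\delta+p+q)}.$$ If $n>(\log(1/\alpha))^{1+(p+q)/(4\delta)}$, then $(\lambda^*,\mu^* )$ satisfies $$\max\Big\{\prod_{i=1}^p\lambda^*_i,\prod_{j=1}^q\mu^*_j\Big\}<1\quad\text{and}\quad n\sqrt{\lambda^*_1\cdots\lambda^*_p\mu^*_1\cdots\mu^*_q}>\log\Big(\frac1\alpha\Big)>1,$$ and the uniform separation rate of the test $\Delta^{\lambda^*,\mu^*}_\alpha$ over the Sobolev ball $\mathcal{S}^\delta_{p+q}(R,R')$ satisfies $$\rho(\Delta^{\lambda^*,\mu^*}_\alpha,\mathcal{S}^\delta_{p+q}(R,R'),\beta)\le C(p,q,\alpha,\beta,\delta,R,R')\,n^{-2\delta/(4\delta+p+q)},$$ where $C(\cdot)$ is a positive constant depending only on its arguments.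
   Context: Setting. $p,q\ge1$ are fixed integers. $f$ denotes a probability density with respect to Lebesgue measure on $\mathbb{R}^p\times\mathbb{R}^q$, with marginal densities $f_1$ on $\mathbb{R}^p$ and $f_2$ on $\mathbb{R}^q$, and $(f_1\otimes f_2)(x,y)=f_1(x)f_2(y)$. One observes an i.i.d. sample $(X_i,Y_i)_{1\le i\le n}$, $n\ge4$, with density $f$; $P_f$ is the law of this sample and $P_{f_1\otimes f_2}$ the law of an i.i.d. $n$-sample with density $f_1\otimes f_2$. $\|\cdot\|_2$ is the $\mathbb{L}_2(\mathbb{R}^{p+q})$ norm. Test. For $\lambda\in(0,\infty)^p$, $\mu\in(0,\infty)^q$ put $\varphi_\lambda(x)=\prod_{i=1}^p\frac{1}{\sqrt{2\pi}\lambda_i}e^{-x_i^2/(2\lambda_i^2)}$, $\phi_\mu(y)=\prod_{j=1}^q\frac{1}{\sqrt{2\pi}\mu_j}e^{-y_j^2/(2\mu_j^2)}$, $k_\lambda(x,x')=\varphi_\lambda(x-x')$, $l_\mu(y,y')=\phi_\mu(y-y')$. With $\mathbf{i}^n_r$ the set of $r$-tuples of pairwise distinct elements of $\{1,\dots,n\}$, $$\widehat{\mathrm{HSIC}}_{\lambda,\mu}=\frac{\sum_{(i,j)\in\mathbf{i}^n_2}k_\lambda(X_i,X_j)l_\mu(Y_i,Y_j)}{n(n-1)}+\frac{\sum_{(i,j,r,s)\in\mathbf{i}^n_4}k_\lambda(X_i,X_j)l_\mu(Y_r,Y_s)}{n(n-1)(n-2)(n-3)}-2\,\frac{\sum_{(i,j,r)\in\mathbf{i}^n_3}k_\lambda(X_i,X_j)l_\mu(Y_j,Y_r)}{n(n-1)(n-2)}.$$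 Let $q^{\lambda,\mu}_{1-\alpha}$ be the $(1-\alpha)$-quantile of $\widehat{\mathrm{HSIC}}_{\lambda,\mu}$ under $P_{f_1\otimes f_2}$, and $\Delta^{\lambda,\mu}_\alpha=1$ if $\widehat{\mathrm{HSIC}}_{\lambda,\mu}>q^{\lambda,\mu}_{1-\alpha}$, $0$ otherwise. When $P_f(\Delta^{\lambda,\mu}_\alpha=0)$ is considered, the quantile is the one associated with the marginals $f_1,f_2$ of that same $f$. Sobolev ball and separation rate. $\mathcal{S}^\delta_d(R)$ is the set of real-valued $s\in\mathbb{L}_1(\mathbb{R}^d)\cap\mathbb{L}_2(\mathbb{R}^d)$ with $\int_{\mathbb{R}^d}\|u\|^{2\delta}|\hat s(u)|^2du\le(2\pi)^dR^2$, where $\|\cdot\|$ is the Euclidean norm and $\hat s(u)=\int s(x)e^{i\langle x,u\rangle}dx$. Then $$\rho(\Delta^{\lambda,\mu}_\alpha,\mathcal{S}^\delta_{p+q}(R,R'),\beta)=\inf\Big\{\rho>0:\ \sup_{f\in\mathcal{F}_\rho}P_f(\Delta^{\lambda,\mu}_\alpha=0)\le\beta\Big\},$$ where $\mathcal{F}_\rho$ is the set of densities $f$ with $f-f_1\otimes f_2\in\mathcal{S}^\delta_{p+q}(R)$, $\max\{\|f\|_\infty,\|f_1\|_\infty,\|f_2\|_\infty\}\le R'$ and $\|f-f_1\otimes f_2\|_2>\rho$. *)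

(* Defs.v *)
From HB Require Import structures.
From mathcomp Require Import all_boot all_order all_algebra.
From mathcomp Require Import all_classical all_reals all_analysis.
From mathcomp Require Import measurable_realfun complex.

Set Implicit Arguments.
Unset Strict Implicit.
Unset Printing Implicit Defensive.
Import Order.TTheory GRing.Theory Num.Theory.
Import numFieldNormedType.Exports.

Local Open Scope classical_set_scope.
Local Open Scope ring_scope.

Section prod_measure.
Local Open Scope ereal_scope.
Context d1 d2 (T1 : measurableType d1) (T2 : measurableType d2) (R : realType).
Variable m1 : {sigma_finite_measure set T1 -> \bar R}.
Variable m2 : {sigma_finite_measure set T2 -> \bar R}.

(* An alias of [m1 \x m2]: the sigma-finiteness instance of the library on
   [m1 \x m2] is only inferred when [m1] and [m2] are subprobabilities. *)
Definition prod_measure : set (T1 * T2) -> \bar R := m1 \x m2.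

HB.instance Definition _ := Measure.on prod_measure.

Let prod_measure_sigma_finite : sigma_finite setT prod_measure.
Proof.
have /sigma_finiteP[F [TF ndF Foo]] := sigma_finiteT m1.
have /sigma_finiteP[G [TG ndG Goo]] := sigma_finiteT m2.
exists (fun n => F n `*` G n).
  rewrite -setXTT TF TG predeqE => -[x y]; split.
    move=> [/= [n _ Fnx] [k _ Gky]]; exists (maxn n k) => //; split.
    - by move: x Fnx; exact/subsetPset/ndF/leq_maxl.
    - by move: y Gky; exact/subsetPset/ndG/leq_maxr.
  by move=> [n _ []/= ? ?]; split; exists n.
move=> k; have [? ?] := Foo k; have [? ?] := Goo k.
split; first exact: measurableX.
by rewrite /prod_measure product_measure1E// lte_mul_pinfty// ge0_fin_numE.
Qed.

HB.instance Definition _ := Measure_isSigmaFinite.Build _ _ _ prod_measure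
  prod_measure_sigma_finite.

End prod_measure.

Section tuple_cons.
Context d (T : measurableType d).

Definition tuple_cons n (z : T * n.-tuple T) : n.+1.-tuple T :=
  [tuple of z.1 :: z.2].

Lemma measurable_tuple_cons n : measurable_fun setT (@tuple_cons n).
Proof. exact: measurable_cons measurable_fst measurable_snd. Qed.

Lemma measurable_tuple_uncons n :
  measurable_fun setT (fun t : n.+1.-tuple T => (thead t, [tuple of behead t])).
Proof.
apply/measurable_fun_pairP; split; first exact: measurable_tnth.
exact: measurable_behead.
Qed.

End tuple_cons.

Section tuple_step.
Local Open Scope ereal_scope.
Context d (T : measurableType d) (R : realType) (n : nat).
Variable m1 : {sigma_finite_measure set T -> \bar R}.
Variable m2 : {sigma_finite_measure set (n.-tuple T) -> \bar R}.

Definition tuple_step : set (n.+1.-tuple T) -> \bar R :=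
  fun A => prod_measure m1 m2 (@tuple_cons d T n @^-1` A).

Let mpre (A : set (n.+1.-tuple T)) : measurable A ->
  measurable (@tuple_cons d T n @^-1` A).
Proof. by move=> mA; rewrite -[X in measurable X]setTI; exact: measurable_tuple_cons. Qed.

Let step0 : tuple_step set0 = 0.
Proof. by rewrite /tuple_step preimage_set0 measure0. Qed.

Let step_ge0 A : 0 <= tuple_step A.
Proof. exact: measure_ge0. Qed.

Let step_sigma_additive : semi_sigma_additive tuple_step.
Proof.
move=> F mF tF mUF; rewrite /tuple_step preimage_bigcup.
apply: measure_semi_sigma_additive.
- by move=> k; exact: mpre.
- apply/trivIsetP => /= i j _ _ ij; rewrite -preimage_setI.
  by move/trivIsetP : tF => /(_ _ _ _ _ ij) ->//; rewrite preimage_set0.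
- by rewrite -preimage_bigcup; exact: mpre.
Qed.

HB.instance Definition _ := isMeasure.Build _ _ _
  tuple_step step0 step_ge0 step_sigma_additive.

Let step_sigma_finite : sigma_finite setT tuple_step.
Proof.
have [F FT Foo] := sigma_finiteT (prod_measure m1 m2).
pose u (t : n.+1.-tuple T) := (thead t, [tuple of behead t]).
have uK : cancel (@tuple_cons d T n) u.
  move=> [x t]; rewrite /u; congr pair; apply: val_inj => //=.
exists (fun k => u @^-1` F k).
  by rewrite -preimage_bigcup -FT preimage_setT.
move=> k; have [mF Fk] := Foo k; split.
  by rewrite -[X in measurable X]setTI; exact: measurable_tuple_uncons.
by rewrite /tuple_step -comp_preimage (_ : u \o _ = id)//; apply/funext.
Qed.

HB.instance Definition _ := Measure_isSigmaFinite.Build _ _ _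
  tuple_step step_sigma_finite.

End tuple_step.

(* The n-fold product measure of [m], on n-tuples. *)
Fixpoint tuple_measure d (T : measurableType d) (R : realType)
    (m : {sigma_finite_measure set T -> \bar R}) (n : nat) :
    {sigma_finite_measure set (n.-tuple T) -> \bar R} :=
  match n with
  | 0 => dirac [tuple]
  | n'.+1 => tuple_step m (tuple_measure m n')
  end.

Section lebesgue.
Context (R : realType).

(* The library equips [R] with its Borel sigma-algebra under a display that
   differs from the one carried by [lebesgue_measure]; [lebR] is that same
   measure, on [R] with its default Borel structure. *)
Definition lebR : set R -> \bar R := @lebesgue_measure R.

Let lebR0 : lebR set0 = 0%E. Proof. exact: measure0. Qed.

Let lebR_ge0 A : (0 <= lebR A)%E. Proof. exact: measure_ge0. Qed.

Let lebR_sigma_additive : semi_sigma_additive lebR.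
Proof. exact: (@measure_semi_sigma_additive _ _ _ (@lebesgue_measure R)). Qed.

HB.instance Definition _ := isMeasure.Build _ R _ lebR
  lebR0 lebR_ge0 lebR_sigma_additive.

Let lebR_sigma_finite : sigma_finite setT lebR.
Proof. exact: (@sigma_finiteT _ _ _ (@lebesgue_measure R)). Qed.

HB.instance Definition _ := Measure_isSigmaFinite.Build _ R _ lebR
  lebR_sigma_finite.

(* $R^d$ is [d.-tuple R], and $R^{p+q}$ is identified with
   [p.-tuple R * q.-tuple R]. *)
Definition leb (d : nat) : {sigma_finite_measure set (d.-tuple R) -> \bar R} :=
  tuple_measure lebR d.

Definition leb2 (p q : nat) :
    {sigma_finite_measure set (p.-tuple R * q.-tuple R)%type -> \bar R} :=
  prod_measure (leb p) (leb q).

End lebesgue.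

Record density d (T : measurableType d) (R : realType)
    (m : {measure set T -> \bar R}) := Density {
  pdf :> T -> R;
  pdf_measurable : measurable_fun setT pdf;
  pdf_ge0 : forall x, 0 <= pdf x;
  pdf_int1 : (\int[m]_x (pdf x)%:E = 1)%E }.

Section law.
Local Open Scope ereal_scope.
Context d (T : measurableType d) (R : realType).
Variables (m : {measure set T -> \bar R}) (f : density m).

Definition law : set T -> \bar R := fun A => \int[m]_(x in A) (f x)%:E.

Let law0 : law set0 = 0. Proof. exact: integral_set0. Qed.

Let law_ge0 A : 0 <= law A.
Proof. by apply: integral_ge0 => x _; rewrite lee_fin pdf_ge0. Qed.

Let law_sigma_additive : semi_sigma_additive law.
Proof.
move=> F mF tF mUF; rewrite /law ge0_integral_bigcup//; last 2 first.
- apply: measurable_funTS.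
  by apply/measurable_EFinP; exact: pdf_measurable.
- by move=> x _; rewrite lee_fin pdf_ge0.
- apply: is_cvg_ereal_nneg_natsum_cond => n _ _.
  by apply: integral_ge0 => x _; rewrite lee_fin pdf_ge0.
Qed.

HB.instance Definition _ := isMeasure.Build _ _ _ law
  law0 law_ge0 law_sigma_additive.

Let lawT : law setT = 1. Proof. exact: pdf_int1. Qed.

HB.instance Definition _ := Measure_isProbability.Build _ _ _ law lawT.

End law.

Section marginals.
Context d1 d2 (T1 : measurableType d1) (T2 : measurableType d2) (R : realType).
Variables (m1 : {sigma_finite_measure set T1 -> \bar R}).
Variables (m2 : {sigma_finite_measure set T2 -> \bar R}).

Section marginal.
Variable f : density (prod_measure m1 m2).

Definition marg1_fun (x : T1) : R := \int[m2]_y f (x, y).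
Definition marg2_fun (y : T2) : R := \int[m1]_x f (x, y).

Let mf : measurable_fun setT (fun z : T1 * T2 => (f z)%:E).
Proof. by apply/measurable_EFinP; exact: pdf_measurable. Qed.

Let f0 (z : T1 * T2) : (0 <= (f z)%:E)%E.
Proof. by rewrite lee_fin pdf_ge0. Qed.

Lemma marg1_measurable : measurable_fun setT marg1_fun.
Proof.
apply: (measurableT_comp (@fine_measurable R setT measurableT)).
exact: (measurable_fun_fubini_tonelli_F _ mf f0).
Qed.

Lemma marg2_measurable : measurable_fun setT marg2_fun.
Proof.
apply: (measurableT_comp (@fine_measurable R setT measurableT)).
exact: (measurable_fun_fubini_tonelli_G _ mf f0).
Qed.

Lemma marg1_ge0 x : 0 <= marg1_fun x.
Proof. by apply: Rintegral_ge0 => y _; rewrite pdf_ge0. Qed.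

Lemma marg2_ge0 y : 0 <= marg2_fun y.
Proof. by apply: Rintegral_ge0 => x _; rewrite pdf_ge0. Qed.

Let fine_int1 d (T : measurableType d) (m : {measure set T -> \bar R})
    (F : T -> \bar R) : measurable_fun setT F -> (forall x, 0 <= F x)%E ->
  (\int[m]_x F x = 1)%E -> (\int[m]_x (fine (F x))%:E = 1)%E.
Proof.
move=> mF F0 F1; rewrite -[RHS]F1.
have mfF : measurable_fun setT (fun x => (fine (F x))%:E).
  by apply/measurable_EFinP/(measurableT_comp (@fine_measurable R setT measurableT)).
apply: ge0_ae_eq_integral => //.
  by move=> x _; rewrite lee_fin fine_ge0.
have /integrable_ae : m.-integrable setT F.
  apply/integrableP; split=> //.
  rewrite (eq_integral F) ?F1 ?ltry// => x _; exact: gee0_abs.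
move=> /(_ measurableT); apply: filterS => x /= /[apply]; exact: fineK.
Qed.

Lemma marg1_int1 : (\int[m1]_x (marg1_fun x)%:E = 1)%E.
Proof.
apply: (fine_int1 (F := fubini_F m2 (fun z => (f z)%:E))).
- exact: measurable_fun_fubini_tonelli_F.
- by move=> x; exact: integral_ge0.
- by rewrite -(fubini_tonelli1 _ mf f0) -[RHS](pdf_int1 f).
Qed.

Lemma marg2_int1 : (\int[m2]_y (marg2_fun y)%:E = 1)%E.
Proof.
apply: (fine_int1 (F := fubini_G m1 (fun z => (f z)%:E))).
- exact: measurable_fun_fubini_tonelli_G.
- by move=> x; exact: integral_ge0.
- by rewrite -(fubini_tonelli2 _ mf f0) -[RHS](pdf_int1 f).
Qed.

Definition marg1 : density m1 := Density marg1_measurable marg1_ge0 marg1_int1.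
Definition marg2 : density m2 := Density marg2_measurable marg2_ge0 marg2_int1.

End marginal.

Section tensor.
Variables (g : density m1) (h : density m2).

Definition tensor_fun (z : T1 * T2) : R := g z.1 * h z.2.

Lemma tensor_measurable : measurable_fun setT tensor_fun.
Proof.
apply: measurable_funM.
- exact: (measurableT_comp (pdf_measurable g) measurable_fst).
- exact: (measurableT_comp (pdf_measurable h) measurable_snd).
Qed.

Lemma tensor_ge0 z : 0 <= tensor_fun z.
Proof. by rewrite mulr_ge0 ?pdf_ge0. Qed.

Lemma tensor_int1 : (\int[prod_measure m1 m2]_z (tensor_fun z)%:E = 1)%E.
Proof.
rewrite [LHS](fubini_tonelli1 (m1 := m1) (m2 := m2)); last 2 first.
- by apply/measurable_EFinP; exact: tensor_measurable.
- by move=> z; rewrite lee_fin tensor_ge0.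
rewrite -[RHS](pdf_int1 g); apply: eq_integral => x _.
rewrite /fubini_F /tensor_fun /=.
under eq_integral do rewrite EFinM.
rewrite ge0_integralZl ?pdf_int1 ?mule1// ?lee_fin ?pdf_ge0//.
- by apply/measurable_EFinP; exact: pdf_measurable.
- by move=> y _; rewrite lee_fin pdf_ge0.
Qed.

Definition tensor : density (prod_measure m1 m2) :=
  Density tensor_measurable tensor_ge0 tensor_int1.

End tensor.
End marginals.

Section hsic.
Context (R : realType) (p q : nat).

Definition phi d (lam : 'I_d -> R) (x : 'I_d -> R) : R :=
  \prod_(i < d) ((Num.sqrt (2 * pi) * lam i)^-1
                 * expR (- x i ^+ 2 / (2 * lam i ^+ 2))).

Definition gauss_kernel d (lam : 'I_d -> R) (x x' : d.-tuple R) : R :=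
  phi lam (fun i => tnth x i - tnth x' i).

Context (n : nat) (lam : 'I_p -> R) (mu : 'I_q -> R).

Definition HSIC (z : n.-tuple (p.-tuple R * q.-tuple R)) : R :=
  let X i := (tnth z i).1 in
  let Y i := (tnth z i).2 in
  let k := gauss_kernel lam in
  let l := gauss_kernel mu in
  let N : R := n%:R in
  (\sum_(i < n) \sum_(j < n | uniq [:: i; j]) k (X i) (X j) * l (Y i) (Y j))
    / (N * (N - 1))
  + (\sum_(i < n) \sum_(j < n) \sum_(r < n) \sum_(s < n | uniq [:: i; j; r; s])
       k (X i) (X j) * l (Y r) (Y s))
    / (N * (N - 1) * (N - 2) * (N - 3))
  - 2 * ((\sum_(i < n) \sum_(j < n) \sum_(r < n | uniq [:: i; j; r])
            k (X i) (X j) * l (Y j) (Y r))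
         / (N * (N - 1) * (N - 2))).

End hsic.

Definition quantile d (T : measurableType d) (R : realType)
    (P : {measure set T -> \bar R}) (X : T -> R) (u : R) : R :=
  inf [set t : R | (u%:E <= P [set w | (X w <= t)%R])%E].

Section test.
Context (R : realType) (p q : nat).

Notation E := (p.-tuple R * q.-tuple R)%type.

Definition sample_law (f : density (leb2 R p q)) (n : nat) :
    {sigma_finite_measure set (n.-tuple E) -> \bar R} :=
  tuple_measure (law f) n.

Definition indep (f : density (leb2 R p q)) : density (leb2 R p q) :=
  tensor (marg1 f) (marg2 f).

(* The test is allowed to depend on the density [f] of the observations, as its
   critical value is a quantile under the product of the marginals of [f]. *)
Definition HSIC_test n (alpha : R) (lam : 'I_p -> R) (mu : 'I_q -> R)
    (f : density (leb2 R p q)) (z : n.-tuple E) : nat :=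
  (quantile (sample_law (indep f) n) (@HSIC R p q n lam mu) (1 - alpha)
   < HSIC lam mu z)%R.

End test.

Section sobolev.
Context (R : realType) (p q : nat).

Notation E := (p.-tuple R * q.-tuple R)%type.

Definition inner (x u : E) : R :=
  \sum_(i < p) tnth x.1 i * tnth u.1 i + \sum_(j < q) tnth x.2 j * tnth u.2 j.

Definition enorm (u : E) : R := Num.sqrt (inner u u).

Definition fourier (s : E -> R) (u : E) : R[i] :=
  Complex (\int[leb2 R p q]_x (s x * cos (inner x u)))
          (\int[leb2 R p q]_x (s x * sin (inner x u))).

Definition sobolev_ball (delta r : R) : set (E -> R) :=
  [set s | [/\ s \in Lfun (leb2 R p q) 1, s \in Lfun (leb2 R p q) 2%:E &
    (\int[leb2 R p q]_u
       (enorm u `^ (2 * delta) * ComplexField.Normc.normc (fourier s u) ^+ 2)%:E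
     <= ((2 * pi) ^+ (p + q) * r ^+ 2)%:E)%E]].

Definition dependence (f : density (leb2 R p q)) (z : E) : R :=
  f z - indep f z.

(* The norms of the densities are essential suprema. *)
Definition alternatives (delta r r' rho : R) : set (density (leb2 R p q)) :=
  [set f : density (leb2 R p q) |
    [/\ sobolev_ball delta r (dependence f),
        [/\ ('N[leb2 R p q]_+oo[EFin \o f] <= r'%:E)%E,
            ('N[leb R p]_+oo[EFin \o marg1 f] <= r'%:E)%E &
            ('N[leb R q]_+oo[EFin \o marg2 f] <= r'%:E)%E] &
        (rho%:E < 'N[leb2 R p q]_(2%:E)[EFin \o (dependence f)])%E]].

(* The infimum is +oo when no [rho] qualifies. *)
Definition separation_rate n
    (Delta : density (leb2 R p q) -> n.-tuple E -> nat)
    (delta r r' beta : R) : \bar R :=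
  ereal_inf [set rho%:E | rho in [set rho : R | 0 < rho /\
    (ereal_sup [set sample_law f n [set z | Delta f z = 0%N]
               | f in alternatives delta r r' rho] <= beta%:E)%E]].

End sobolev.

(* Main.v *)
Require Import Defs.
From HB Require Import structures.
From mathcomp Require Import all_boot all_order all_algebra.
From mathcomp Require Import all_classical all_reals all_analysis.
From mathcomp Require Import measurable_realfun ess_sup_inf complex ring lra.

(** Write d = p + q, let h be the common value of the bandwidths, G the product
Gaussian kernel of bandwidth h on R^p x R^q, psi = f - f1 (x) f2, and Q the
double integral of psi(z) psi(z') G(z, z'). Put S = n h^(d/2).

HSIC is a U-statistic of order four with mean Q ([HSIC_usum],
[mean_hsic]), and when the densities are bounded by M its variance is at most
a constant, depending on M alone, times Q / n + 1 / S^2 ([HSIC_variance]). For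
the density f1 (x) f2 the function psi vanishes, hence so does Q, and
Chebyshev's inequality bounds the critical value by a multiple of 1 / S
([quantile_HSIC_le]). Under f, as soon as Q >= K / S with K large enough in
terms of alpha, beta and M, Chebyshev's inequality bounds the probability of a
type II error by beta ([type2_error_le]).

It remains to see that Q is large when the L2 norm of psi is. In Fourier
variables, up to the factor (2 pi)^(-d), Q is the integral of |psi^(u)|^2
against exp(- h^2 |u|^2 / 2). Frequencies with h |u| <= 1 keep a factor at
least exp(- 1/2), and for the others |psi^|^2 <= (h |u|)^(2 delta) |psi^|^2;
therefore ([norm2_le_quad])
  |psi|_2^2 <= e^(1/2) Q + h^(2 delta) r^2.
The bandwidth h = n^(-2 / (4 delta + d)) is the one for which h^(2 delta) is
1 / S; both equal n^(- 4 delta / (4 delta + d)). If |psi|_2 exceeds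
C n^(-2 delta / (4 delta + d)) with C^2 = r^2 + e^(1/2) K, then Q > K / S.

Two points carry the rest.

The variance. Expand the square of the centred U-statistic over pairs of
4-tuples of indices ([usum_variance]). Pairs sharing no index are
uncorrelated; a pair sharing exactly one contributes the variance of the Hajek
projection of the kernel; a pair sharing two or more is bounded by the second
moment. The Hajek projection is built from the convolution G * psi and from its
averages over one of the two components ([hajek_hsic_kernel]), so its variance
is at most a multiple of the squared L2 norm of G * psi, which by the semigroup
property of Gaussian kernels is Q at bandwidth sqrt 2 h, hence at most Q
([norm2_smooth_le]). The second moment is at most the peak of G times a
constant ([second_moment_hsic_kernel]).

The Fourier side. The Gaussian kernel is the Fourier transform of a Gaussian,
and Fubini's theorem turns this into the expression of Q above
([quad_fourier]) for psi integrable. The L2 norm of psi is the limit of Q when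
the bandwidth tends to 0 ([quad_cvg]), since Gaussian kernels form an
approximate identity in L1 and psi is bounded. *)

Set Implicit Arguments.
Unset Strict Implicit.
Unset Printing Implicit Defensive.
Import Order.TTheory GRing.Theory Num.Theory.
Import numFieldNormedType.Exports.
Local Open Scope classical_set_scope.
Local Open Scope ring_scope.

(** * Real-valued Fubini theorems and bounded measurable functions *)

Lemma integrable_measurable d (T : measurableType d) (R : realType)
    (m : {measure set T -> \bar R}) (f : T -> R) :
  m.-integrable setT (EFin \o f) -> measurable_fun setT f.
Proof. by move=> /integrableP[/measurable_EFinP]. Qed.

Section real_fubini.
Context d1 d2 (T1 : measurableType d1) (T2 : measurableType d2) (R : realType).
Variable m1 : {sigma_finite_measure set T1 -> \bar R}.
Variable m2 : {sigma_finite_measure set T2 -> \bar R}.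
Implicit Type F : T1 * T2 -> R.

(** Measurability holds without integrability: the integral of a function is the
difference of those of its positive and negative parts, each covered by
Tonelli's theorem. *)
Lemma measurable_integral1 (f : T1 * T2 -> \bar R) : measurable_fun setT f ->
  measurable_fun setT (fun x => \int[m2]_y f (x, y))%E.
Proof.
move=> mf; rewrite [X in measurable_fun _ X](_ : _ =
  fun x => ((\int[m2]_y (f^\+ (x, y))) - (\int[m2]_y (f^\- (x, y))))%E).
  apply: emeasurable_funB.
    apply: (measurable_fun_fubini_tonelli_F (f^\+)%E) => //.
    exact: measurable_funepos.
  apply: (measurable_fun_fubini_tonelli_F (f^\-)%E) => //.
  exact: measurable_funeneg.
apply/funext => x; rewrite [LHS]integralE.
under eq_integral do rewrite funepos_comp/=.
by under [X in (_ - X = _)%E]eq_integral do rewrite funeneg_comp/=.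
Qed.

Lemma measurable_integral2 (f : T1 * T2 -> \bar R) : measurable_fun setT f ->
  measurable_fun setT (fun y => \int[m1]_x f (x, y))%E.
Proof.
move=> mf; rewrite [X in measurable_fun _ X](_ : _ =
  fun y => ((\int[m1]_x (f^\+ (x, y))) - (\int[m1]_x (f^\- (x, y))))%E).
  apply: emeasurable_funB.
    apply: (measurable_fun_fubini_tonelli_G (f^\+)%E) => //.
    exact: measurable_funepos.
  apply: (measurable_fun_fubini_tonelli_G (f^\-)%E) => //.
  exact: measurable_funeneg.
apply/funext => y; rewrite [LHS]integralE.
under eq_integral do rewrite funepos_comp/=.
by under [X in (_ - X = _)%E]eq_integral do rewrite funeneg_comp/=.
Qed.

Lemma measurable_Rintegral1 F : measurable_fun setT F ->
  measurable_fun setT (fun x => \int[m2]_y F (x, y)).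
Proof.
move=> mF; apply: (measurableT_comp (@fine_measurable R setT measurableT)).
by apply: (@measurable_integral1 (EFin \o F)); exact/measurable_EFinP.
Qed.

Lemma measurable_Rintegral2 F : measurable_fun setT F ->
  measurable_fun setT (fun y => \int[m1]_x F (x, y)).
Proof.
move=> mF; apply: (measurableT_comp (@fine_measurable R setT measurableT)).
by apply: (@measurable_integral2 (EFin \o F)); exact/measurable_EFinP.
Qed.

Lemma Rintegral_prod1 F :
  (prod_measure m1 m2).-integrable setT (EFin \o F) ->
  \int[prod_measure m1 m2]_z F z = \int[m1]_x \int[m2]_y F (x, y).
Proof.
move=> iF; rewrite /Rintegral; congr fine.
rewrite -(integral12_prod_meas1 iF); apply: ae_eq_integral => //.
- exact: (measurable_fubini_F iF).
- apply/measurable_EFinP; apply: measurable_Rintegral1.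
  exact: integrable_measurable iF.
- have := ae_integrable1 iF; apply: filterS => x ix _.
  by rewrite fineK//; exact: integrable_fin_num.
Qed.

Lemma Rintegral_prod2 F :
  (prod_measure m1 m2).-integrable setT (EFin \o F) ->
  \int[prod_measure m1 m2]_z F z = \int[m2]_y \int[m1]_x F (x, y).
Proof.
move=> iF; rewrite /Rintegral; congr fine.
rewrite -(integral21_prod_meas1 iF); apply: ae_eq_integral => //.
- exact: (measurable_fubini_G iF).
- apply/measurable_EFinP; apply: measurable_Rintegral2.
  exact: integrable_measurable iF.
- have := ae_integrable2 iF; apply: filterS => x ix _.
  by rewrite fineK//; exact: integrable_fin_num.
Qed.

Lemma Rintegral_swap F :
  (prod_measure m1 m2).-integrable setT (EFin \o F) ->
  \int[m1]_x \int[m2]_y F (x, y) = \int[m2]_y \int[m1]_x F (x, y).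
Proof. by move=> iF; rewrite -Rintegral_prod1// Rintegral_prod2. Qed.

Lemma integrable_Rintegral1 F :
  (prod_measure m1 m2).-integrable setT (EFin \o F) ->
  m1.-integrable setT (EFin \o (fun x => \int[m2]_y F (x, y))).
Proof.
move=> iF; have mF : measurable_fun setT F.
  exact: integrable_measurable iF.
apply/integrableP; split.
  by apply/measurable_EFinP; exact: measurable_Rintegral1.
have /integrableP[_] := integrable_fubini_F iF.
apply: le_lt_trans; rewrite le_eqVlt; apply/orP; left; apply/eqP.
apply: ae_eq_integral => //.
- apply: measurableT_comp => //.
  by apply/measurable_EFinP; exact: measurable_Rintegral1.
- apply: measurableT_comp => //; exact: (measurable_fubini_F iF).
- have := ae_integrable1 iF; apply: filterS => x ix _.
  congr (abse _); rewrite /comp /Rintegral fineK//; exact: integrable_fin_num.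
Qed.

End real_fubini.

Lemma integrable_EFin_lty d (T : measurableType d) (R : realType)
    (m : {measure set T -> \bar R}) (f : T -> R) :
  measurable_fun setT f -> (\int[m]_x `|f x|%:E < +oo)%E ->
  m.-integrable setT (EFin \o f).
Proof. by move=> mf foo; apply/integrableP; split => //; exact/measurable_EFinP. Qed.

(** The class in which the moments of HSIC are computed: it is closed under
ring operations and under partial integration, and its members are integrable
for every probability measure, so that linearity and Fubini hold without side
conditions on integrability. *)
Definition bmeas d (T : measurableType d) (R : realType) (f : T -> R) :=
  measurable_fun setT f /\ exists M, forall x, `|f x| <= M.

Section bmeas_closure.
Context d (T : measurableType d) (R : realType).
Implicit Types f g : T -> R.

Lemma bmeas_cst (c : R) : bmeas (fun _ : T => c).
Proof. by split; [exact: measurable_cst|exists `|c|]. Qed.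

Lemma bmeasD f g : bmeas f -> bmeas g -> bmeas (fun x => f x + g x).
Proof.
move=> [mf [M fM]] [mg [N gN]]; split; first exact: measurable_funD.
by exists (M + N) => x; rewrite (le_trans (ler_normD _ _))// lerD.
Qed.

Lemma bmeasN f : bmeas f -> bmeas (fun x => - f x).
Proof.
move=> [mf [M fM]]; split; first exact: measurable_oppr mf || exact: measurableT_comp.
by exists M => x; rewrite normrN.
Qed.

Lemma bmeasB f g : bmeas f -> bmeas g -> bmeas (fun x => f x - g x).
Proof. by move=> ? ?; apply: bmeasD => //; exact: bmeasN. Qed.

Lemma bmeasM f g : bmeas f -> bmeas g -> bmeas (fun x => f x * g x).
Proof.
move=> [mf [M fM]] [mg [N gN]]; split; first exact: measurable_funM.
by exists (M * N) => x; rewrite normrM ler_pM.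
Qed.

Lemma bmeasX f n : bmeas f -> bmeas (fun x => f x ^+ n).
Proof.
move=> bf; elim: n => [|n ih]; first exact: bmeas_cst.
by under eq_fun do rewrite exprS; exact: bmeasM.
Qed.

Lemma bmeas_sum (I : Type) (s : seq I) (P : pred I) (F : I -> T -> R) :
  (forall i, bmeas (F i)) -> bmeas (fun x => \sum_(i <- s | P i) F i x).
Proof.
move=> bF; elim: s => [|i s ih].
  by under eq_fun do rewrite big_nil; exact: bmeas_cst.
under eq_fun do rewrite big_cons; case: (P i) => //; exact: bmeasD.
Qed.

Lemma bmeas_comp d' (T' : measurableType d') (u : T' -> T) f :
  measurable_fun setT u -> bmeas f -> bmeas (fun x => f (u x)).
Proof.
move=> mu [mf [M fM]]; split; first exact: measurableT_comp mf mu.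
by exists M.
Qed.

Variable m : {measure set T -> \bar R}.
Hypothesis m1 : m setT = 1%E.

Lemma bmeas_integrable f : bmeas f -> m.-integrable setT (EFin \o f).
Proof.
move=> [mf [M fM]]; apply: measurable_bounded_integrable => //.
  by rewrite m1 ltry.
exists M; split; first exact: num_real.
by move=> x Mx y _ /=; rewrite (le_trans (fM y))// ltW.
Qed.

Lemma bRintegralD f g : bmeas f -> bmeas g ->
  \int[m]_x (f x + g x) = \int[m]_x f x + \int[m]_x g x.
Proof. by move=> ? ?; apply: RintegralD => //; exact: bmeas_integrable. Qed.

Lemma bRintegralB f g : bmeas f -> bmeas g ->
  \int[m]_x (f x - g x) = \int[m]_x f x - \int[m]_x g x.
Proof. by move=> ? ?; apply: RintegralB => //; exact: bmeas_integrable. Qed.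

Lemma bRintegralZl f c : bmeas f ->
  \int[m]_x (c * f x) = c * \int[m]_x f x.
Proof. by move=> ?; apply: RintegralZl => //; exact: bmeas_integrable. Qed.

Lemma bRintegralZr f c : bmeas f ->
  \int[m]_x (f x * c) = (\int[m]_x f x) * c.
Proof. by move=> ?; apply: RintegralZr => //; exact: bmeas_integrable. Qed.

Lemma bRintegral_cst c : \int[m]_x (fun _ : T => c) x = c.
Proof. by rewrite Rintegral_cst// m1/= mulr1. Qed.

Lemma bRintegral_sum (I : Type) (s : seq I) (P : pred I) (F : I -> T -> R) :
  (forall i, bmeas (F i)) ->
  \int[m]_x (\sum_(i <- s | P i) F i x) = \sum_(i <- s | P i) \int[m]_x F i x.
Proof.
move=> bF; elim: s => [|i s ih].
  under eq_Rintegral do rewrite big_nil.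
  by rewrite big_nil -[RHS](bRintegral_cst 0).
under eq_Rintegral do rewrite big_cons; rewrite big_cons; case: (P i) => //.
by rewrite bRintegralD ?ih//; exact: bmeas_sum.
Qed.

Lemma le_bRintegral f g : bmeas f -> bmeas g -> (forall x, f x <= g x) ->
  \int[m]_x f x <= \int[m]_x g x.
Proof. by move=> ? ? fg; apply: le_Rintegral => //; exact: bmeas_integrable. Qed.

(** The difference of the two sides is the integral of [(f - a) ^+ 2], with [a]
the mean of [f]. *)
Lemma sqr_bRintegral_le f : bmeas f ->
  (\int[m]_x f x) ^+ 2 <= \int[m]_x (f x ^+ 2).
Proof.
move=> bf; set a := \int[m]_x f x; rewrite -subr_ge0.
have : 0 <= \int[m]_x ((f x - a) ^+ 2).
  by apply: Rintegral_ge0 => x _; exact: sqr_ge0.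
rewrite [X in 0 <= X](_ : _ = \int[m]_x (f x ^+ 2 - 2 * a * f x + a ^+ 2)); last first.
  by apply: eq_Rintegral => x _; ring.
rewrite bRintegralD; [|apply: bmeasB; [exact: bmeasX|apply: bmeasM => //; exact: bmeas_cst]|exact: bmeas_cst].
rewrite bRintegralB; [|exact: bmeasX|apply: bmeasM => //; exact: bmeas_cst].
rewrite bRintegralZl// (bRintegral_cst (a ^+ 2)) -/a.
by rewrite (_ : _ + a ^+ 2 = \int[m]_x (f x ^+ 2) - a ^+ 2)//; ring.
Qed.

End bmeas_closure.

Section bmeas_prod.
Context d1 d2 (T1 : measurableType d1) (T2 : measurableType d2) (R : realType).
Variable m1 : {sigma_finite_measure set T1 -> \bar R}.
Variable m2 : {sigma_finite_measure set T2 -> \bar R}.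
Hypothesis m1T : m1 setT = 1%E.
Hypothesis m2T : m2 setT = 1%E.
Implicit Type F : T1 * T2 -> R.

Lemma prod_measureT : prod_measure m1 m2 setT = 1%E.
Proof.
by rewrite -setXTT /prod_measure product_measure1E// [X in (X * _)%E]m1T mul1e.
Qed.

Lemma bmeas_Rintegral1 F : bmeas F -> bmeas (fun x => \int[m2]_y F (x, y)).
Proof.
move=> [mF [M FM]]; split; first exact: measurable_Rintegral1.
exists M => x.
have bF : bmeas (fun y => F (x, y)).
  by split; [exact: measurableT_comp mF _|exists M].
apply: le_trans (le_normr_Rintegral _ _) _ => //; first exact: bmeas_integrable.
rewrite -[leRHS](bRintegral_cst m2T M); apply: le_bRintegral => //.
- by case: bF => mG [N GN]; split; [exact: measurableT_comp|exists N => y; rewrite normr_id].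
- exact: bmeas_cst.
Qed.

Lemma bmeas_Rintegral2 F : bmeas F -> bmeas (fun y => \int[m1]_x F (x, y)).
Proof.
move=> [mF [M FM]]; split; first exact: measurable_Rintegral2.
exists M => y.
have bF : bmeas (fun x => F (x, y)).
  by split; [exact: measurableT_comp mF _|exists M].
apply: le_trans (le_normr_Rintegral _ _) _ => //; first exact: bmeas_integrable.
rewrite -[leRHS](bRintegral_cst m1T M); apply: le_bRintegral => //.
- by case: bF => mG [N GN]; split; [exact: measurableT_comp|exists N => x; rewrite normr_id].
- exact: bmeas_cst.
Qed.

Lemma bRintegral_swap F : bmeas F ->
  \int[m1]_x \int[m2]_y F (x, y) = \int[m2]_y \int[m1]_x F (x, y).
Proof.
by move=> bF; apply: Rintegral_swap; apply: bmeas_integrable => //; exact: prod_measureT.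
Qed.

End bmeas_prod.

(** * Integration over tuples *)

Section tuple_integral.
Context d (T : measurableType d) (R : realType).
Variable m : {sigma_finite_measure set T -> \bar R}.

Lemma ge0_integral_tuple_step n (F : n.+1.-tuple T -> \bar R) :
  measurable_fun setT F -> (forall t, 0 <= F t)%E ->
  (\int[tuple_measure m n.+1]_t F t =
   \int[prod_measure m (tuple_measure m n)]_z F (tuple_cons z))%E.
Proof.
move=> mF F0.
transitivity (\int[pushforward (prod_measure m (tuple_measure m n)) (@tuple_cons _ T n)]_t F t)%E.
  by [].

by rewrite ge0_integral_pushforward//; exact: measurable_tuple_cons.
Qed.

Lemma integral_tuple_step n (F : n.+1.-tuple T -> \bar R) :
  measurable_fun setT F ->
  (\int[tuple_measure m n.+1]_t F t =
   \int[prod_measure m (tuple_measure m n)]_z F (tuple_cons z))%E.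
Proof.
move=> mF; rewrite integralE [RHS]integralE; congr (_ - _)%E.
  rewrite ge0_integral_tuple_step//; last exact: measurable_funepos.
  by rewrite (funepos_comp F (@tuple_cons _ T n)).
rewrite ge0_integral_tuple_step//; last exact: measurable_funeneg.
by rewrite (funeneg_comp F (@tuple_cons _ T n)).
Qed.

Lemma integrable_tuple_cons n (F : n.+1.-tuple T -> \bar R) :
  (tuple_measure m n.+1).-integrable setT F ->
  (prod_measure m (tuple_measure m n)).-integrable setT (F \o @tuple_cons _ T n).
Proof.
move=> iF; have /integrableP[mF Foo] := iF; apply/integrableP; split => //.
  by apply: measurableT_comp => //; exact: measurable_tuple_cons.
by move: Foo; rewrite ge0_integral_tuple_step//; exact: measurableT_comp.
Qed.

Lemma Rintegral_tupleS n (F : n.+1.-tuple T -> R) :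
  (tuple_measure m n.+1).-integrable setT (EFin \o F) ->
  \int[tuple_measure m n.+1]_t F t =
  \int[m]_x \int[tuple_measure m n]_t F (tuple_cons (x, t)).
Proof.
move=> iF; transitivity (\int[prod_measure m (tuple_measure m n)]_z F (tuple_cons z)).
  rewrite /Rintegral (integral_tuple_step (F := EFin \o F))//.
  exact: measurable_int iF.
by rewrite Rintegral_prod1//; exact: integrable_tuple_cons iF.
Qed.

Lemma Rintegral_tuple0 (F : 0.-tuple T -> R) : measurable_fun setT F ->
  \int[tuple_measure m 0]_t F t = F [tuple].
Proof.
move=> mF; rewrite /Rintegral /= integral_dirac//.
  by rewrite diracT mul1e.
exact/measurable_EFinP.
Qed.

Hypothesis mT : m setT = 1%E.

Lemma tuple_measureT n : tuple_measure m n setT = 1%E.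
Proof.
elim: n => [|n ih]; first by rewrite /= diracT.
by rewrite /= /tuple_step preimage_setT; exact: prod_measureT.
Qed.

Lemma bRintegral_tupleS n (F : n.+1.-tuple T -> R) : bmeas F ->
  \int[tuple_measure m n.+1]_t F t =
  \int[m]_x \int[tuple_measure m n]_t F (tuple_cons (x, t)).
Proof.
move=> bF; apply: Rintegral_tupleS; apply: bmeas_integrable => //.
exact: tuple_measureT.
Qed.

Lemma bmeas_tuple_cons n (F : n.+1.-tuple T -> R) (x : T) :
  bmeas F -> bmeas (fun t : n.-tuple T => F (tuple_cons (x, t))).
Proof.
move=> bF; apply: (bmeas_comp (u := fun t : n.-tuple T => tuple_cons (x, t))) bF.
exact: measurableT_comp (@measurable_tuple_cons _ T n) _.
Qed.

Lemma bmeas_Rintegral_tuple n (F : n.+1.-tuple T -> R) :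
  bmeas F -> bmeas (fun x => \int[tuple_measure m n]_t F (tuple_cons (x, t))).
Proof.
move=> bF; apply: (bmeas_Rintegral1 (tuple_measureT n) (F := fun z => F (tuple_cons z))).
exact: bmeas_comp (@measurable_tuple_cons _ T n) bF.
Qed.

Lemma measurable_cat a b :
  measurable_fun setT (fun z : a.-tuple T * b.-tuple T => [tuple of z.1 ++ z.2]).
Proof.
apply/measurable_fun_tnthP => i; rewrite /comp/=.
have [ia|ia] := ltnP i a.
  rewrite (_ : (fun _ => _) = fun z => tnth z.1 (Ordinal ia)).
    exact: measurableT_comp (measurable_tnth _) _.
  apply/funext => -[u v]; have x0 := tnth u (Ordinal ia).
  by rewrite !(tnth_nth x0) /= nth_cat size_tuple ia.
have ib : (i - a < b)%N by rewrite ltn_subLR.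
rewrite (_ : (fun _ => _) = fun z => tnth z.2 (Ordinal ib)).
  exact: measurableT_comp (measurable_tnth _) _.
apply/funext => -[u v]; have x0 := tnth v (Ordinal ib).
by rewrite !(tnth_nth x0) /= nth_cat size_tuple ltnNge ia.
Qed.

(** The first [a] and the last [b] entries of an i.i.d. sample are independent. *)
Lemma bRintegral_tuple_cat a b (F : (a + b).-tuple T -> R) : bmeas F ->
  \int[tuple_measure m (a + b)]_t F t =
  \int[tuple_measure m a]_u \int[tuple_measure m b]_v F [tuple of u ++ v].
Proof.
elim: a F => [|a ih] F bF.
  rewrite Rintegral_tuple0.
    by apply: eq_Rintegral => v _; congr F; exact: val_inj.
  apply: (measurable_Rintegral1 (tuple_measure m b) (F := fun z : 0.-tuple T * b.-tuple T => F [tuple of z.1 ++ z.2])).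
  by apply: (measurableT_comp (f := F)); [case: bF|exact: measurable_cat].
rewrite [LHS](bRintegral_tupleS (n := a + b))// bRintegral_tupleS; last first.
  apply: (bmeas_Rintegral1 (tuple_measureT b) (F := fun z : a.+1.-tuple T * b.-tuple T => F [tuple of z.1 ++ z.2])).
  by apply: (bmeas_comp (f := F)) => //; exact: measurable_cat.
apply: eq_Rintegral => x _; rewrite ih; last exact: bmeas_tuple_cons.
apply: eq_Rintegral => u _; apply: eq_Rintegral => v _; congr F; exact: val_inj.
Qed.

End tuple_integral.

(** * Subtuples of an i.i.d. sample *)

Section reindex.
Context d (T : measurableType d) (R : realType).

Definition tuple_rect n (A : 'I_n -> set T) : set (n.-tuple T) :=
  [set t | forall i, A i (tnth t i)].

Lemma measurable_tuple_rect n (A : 'I_n -> set T) :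
  (forall i, measurable (A i)) -> measurable (tuple_rect A).
Proof.
move=> mA; rewrite [tuple_rect A](_ : _ = \bigcap_(i in [set: 'I_n]) (@tnth n T ^~ i @^-1` A i)).
  apply: fin_bigcap_measurable => // i _.
  by rewrite -[X in measurable X]setTI; exact: measurable_tnth.
by apply/seteqP; split => [t At i _|t At i]; exact: At.
Qed.

(** Products of measurable sets generate the sigma-algebra of tuples; as they
are stable under intersection, they determine a finite measure. *)
Lemma measurable_tuple_generated n : @measurable _ (n.-tuple T) =
  <<s [set B | exists2 A, (forall i, measurable (A i)) & B = @tuple_rect n A] >>.
Proof.
apply/seteqP; split; last first.
  apply: smallest_sub; first exact: sigma_algebra_measurable.
  by move=> _ [A mA ->]; exact: measurable_tuple_rect.
apply: smallest_sub; first exact: smallest_sigma_algebra.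
rewrite -bigcup_seq => B /= [i _ [A mA <-]].
apply: sub_sigma_algebra; exists (fun j => if j == i then A else setT).
  by move=> j; case: ifP.
rewrite setTI; apply/seteqP; split => [t At j|t /(_ i)].
  by case: eqVneq => [->|].
by rewrite eqxx.
Qed.

Variable m : {sigma_finite_measure set T -> \bar R}.
Hypothesis mT : m setT = 1%E.

Lemma tuple_measure_rect n (A : 'I_n -> set T) : (forall i, measurable (A i)) ->
  tuple_measure m n (tuple_rect A) = (\prod_(i < n) m (A i))%E.
Proof.
elim: n A => [|n ih] A mA.
  rewrite big_ord0 /= diracE mem_set// => -[]//.
rewrite big_ord_recl -ih//= /tuple_step.
rewrite (_ : _ @^-1` _ = A ord0 `*` tuple_rect (fun i => A (lift ord0 i))).
  by rewrite /prod_measure product_measure1E//; exact: measurable_tuple_rect.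
apply/seteqP; split => [[x t] /= At|[x t] /= [Ax At] i].
  split => [|i]; first exact: (At ord0).
  by have := At (lift ord0 i); rewrite tnthS.
by case: (unliftP ord0 i) => [j ->|->]; rewrite ?tnthS//; exact: At.
Qed.

Definition subtuple n k (s : k.-tuple 'I_n) (z : n.-tuple T) : k.-tuple T :=
  [tuple of map (tnth z) s].

Lemma measurable_subtuple n k (s : k.-tuple 'I_n) :
  measurable_fun setT (subtuple s).
Proof.
apply/measurable_fun_tnthP => i.
rewrite (_ : _ \o _ = (@tnth n T)^~ (tnth s i)); first exact: measurable_tnth.
by apply/funext => z /=; rewrite tnth_map.
Qed.

(** Entries of an i.i.d. sample at distinct positions again form an i.i.d.
sample. Both measures agree on products of measurable sets: the factors at the
positions that [s] misses are the whole space, of mass 1. *)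
Lemma tuple_measure_subtuple n k (s : k.-tuple 'I_n) : uniq s ->
  forall A, measurable A ->
  tuple_measure m n (subtuple s @^-1` A) = tuple_measure m k A.
Proof.
move=> us; pose f : {mfun _ >-> _} := HB.pack (@subtuple n k s)
  (isMeasurableFun.Build _ _ _ _ _ (@measurable_subtuple n k s)).
move=> A mA; rewrite -[LHS]/(pushforward (tuple_measure m n) f A).
pose G := [set B | exists2 A, (forall i, measurable (A i)) & B = @tuple_rect k A].
have GT : G setT by exists (fun _ => setT) => //; exact/esym/seteqP.
apply: (measure_unique G (fun _ => setT)) => //.
- exact: measurable_tuple_generated.
- move=> _ _ [B mB ->] [C mC ->]; exists (fun i => B i `&` C i).
    by move=> i; exact: measurableI.
  apply/seteqP; split => [t [tB tC] i|t tBC]; first by split; [exact: tB|exact: tC].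
  by split => i; case: (tBC i).
- by rewrite bigcup_const.
- move=> _ [B mB ->].
  transitivity (\prod_(i < k) m (B i))%E; last exact/esym/tuple_measure_rect.
  (* The factor of the set at position [j] of the large tuple. *)
  pose C (j : 'I_n) := if [pick i | tnth s i == j] is Some i then B i else setT.
  have CE i : C (tnth s i) = B i.
    rewrite /C; case: pickP => [i' /eqP/tuple_uniqP -> //|/(_ i)].
    by rewrite eqxx.
  transitivity (tuple_measure m n (tuple_rect C)).
    rewrite /= /pushforward; congr (tuple_measure m n _).
    apply/seteqP; split => [z /= Bz j|z Cz i /=].
      rewrite /C; case: pickP => [i /eqP <-|//].
      by have := Bz i; rewrite /= tnth_map.
    by rewrite /= tnth_map -CE; exact: Cz.
  rewrite tuple_measure_rect; last by move=> j; rewrite /C; case: pickP.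
  rewrite (bigID (mem s))/= [X in (_ * X)%E]big1 ?mule1; last first.
      move=> j js; rewrite /C; case: pickP => [i /eqP ij|_]; last exact: mT.
      by rewrite -ij mem_tnth in js.
  rewrite -big_uniq//= big_tuple; apply: eq_bigr => i _.
  by rewrite CE.
- move=> _; apply: (@le_lt_trans _ _ (tuple_measure m n setT)) => //.
  by rewrite tuple_measureT// ltry.
Qed.

Lemma Rintegral_subtuple n k (s : k.-tuple 'I_n) (F : k.-tuple T -> R) :
  uniq s -> measurable_fun setT F ->
  \int[tuple_measure m n]_z F (subtuple s z) = \int[tuple_measure m k]_t F t.
Proof.
move=> us mF; rewrite /Rintegral; congr fine.
have ge0 (g : k.-tuple T -> \bar R) : measurable_fun setT g -> (forall t, 0 <= g t)%E ->
    (\int[tuple_measure m n]_z g (subtuple s z) = \int[tuple_measure m k]_t g t)%E.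
  move=> mg g0; transitivity (\int[pushforward (tuple_measure m n) (subtuple s)]_t g t)%E.
    by rewrite ge0_integral_pushforward//; exact: measurable_subtuple.
  pose f : {mfun _ >-> _} := HB.pack (@subtuple n k s)
    (isMeasurableFun.Build _ _ _ _ _ (@measurable_subtuple n k s)).
  apply: (@eq_measure_integral _ _ _ _ _ (pushforward (tuple_measure m n) f)) => A mA _.
  exact: tuple_measure_subtuple.
have mE : measurable_fun setT (EFin \o F) by exact/measurable_EFinP.
rewrite integralE [RHS]integralE; congr (_ - _)%E.
  rewrite -ge0//; last exact: measurable_funepos.
  by rewrite (funepos_comp (EFin \o F) (subtuple s)).
rewrite -ge0//; last exact: measurable_funeneg.
by rewrite (funeneg_comp (EFin \o F) (subtuple s)).
Qed.

Lemma bmeas_subtuple n k (s : k.-tuple 'I_n) (F : k.-tuple T -> R) :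
  bmeas F -> bmeas (fun z => F (subtuple s z)).
Proof. by apply: bmeas_comp; exact: measurable_subtuple. Qed.

End reindex.

(** * Variance of a U-statistic of order four *)

Section index_sums.

Lemma sum_tuple_cons (V : nmodType) (I : finType) k (F : k.+1.-tuple I -> V) :
  \sum_(t : k.+1.-tuple I) F t = \sum_i \sum_(t : k.-tuple I) F [tuple of i :: t].
Proof.
rewrite pair_big /= (reindex (fun z : I * k.-tuple I => [tuple of z.1 :: z.2]))//=.
exists (fun t => (thead t, [tuple of behead t])) => [[i t] _|t _] /=.
  by congr pair; apply: val_inj.
by rewrite -tuple_eta.
Qed.

Variables (n : nat) (a : pred 'I_n).

Let c := (\sum_(i < n) a i)%N.

Lemma sum_count_tupleS k :
  (\sum_(t : k.+1.-tuple 'I_n) count a t =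
   c * n ^ k + n * \sum_(t : k.-tuple 'I_n) count a t)%N.
Proof.
rewrite sum_tuple_cons /=; under eq_bigr do rewrite big_split/=.
rewrite big_split/= sum_nat_const card_ord; congr addn.
under eq_bigr do rewrite sum_nat_const card_tuple card_ord mulnC.
by rewrite -big_distrl.
Qed.

(** With [b] the membership of the first entry,
['C(b + k, 2) = 'C(k, 2) + b * k]. *)
Lemma sum_bin_count_tupleS k :
  (\sum_(t : k.+1.-tuple 'I_n) 'C(count a t, 2) =
   n * \sum_(t : k.-tuple 'I_n) 'C(count a t, 2) +
   c * \sum_(t : k.-tuple 'I_n) count a t)%N.
Proof.
rewrite sum_tuple_cons /=.
have binD (b : bool) k' : 'C(b + k', 2) = ('C(k', 2) + b * k')%N.
  by case: b => /=; rewrite ?add0n ?mul0n ?addn0// add1n mul1n binS bin1.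
under eq_bigr do under eq_bigr do rewrite binD.
under eq_bigr do rewrite big_split/= -big_distrr/=.
by rewrite big_split/= sum_nat_const card_ord -big_distrl.
Qed.

Lemma sum_count_tuple4 :
  (\sum_(t : 4.-tuple 'I_n) count a t = 4 * c * n ^ 3)%N.
Proof.
rewrite !sum_count_tupleS big1; last by move=> t _; rewrite tuple0.
by rewrite !expnS expn0; ring.
Qed.

Lemma sum_bin_count_tuple4 :
  (\sum_(t : 4.-tuple 'I_n) 'C(count a t, 2) = 6 * c ^ 2 * n ^ 2)%N.
Proof.
rewrite !sum_bin_count_tupleS !sum_count_tupleS.
rewrite !big1; try by move=> t _; rewrite tuple0.
by rewrite !expnS expn0; ring.
Qed.

End index_sums.

Section covariance.
Context d (T : measurableType d) (R : realType).
Variable m : {sigma_finite_measure set T -> \bar R}.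
Hypothesis mT : m setT = 1%E.

(** Functions of disjoint blocks of the sample are independent. *)
Lemma Rintegral_subtuple_indep n a b (F : a.-tuple T -> R) (G : b.-tuple T -> R)
    (s : a.-tuple 'I_n) (t : b.-tuple 'I_n) :
  bmeas F -> bmeas G -> uniq (s ++ t) ->
  \int[tuple_measure m n]_z (F (subtuple s z) * G (subtuple t z)) =
  \int[tuple_measure m a]_u F u * \int[tuple_measure m b]_v G v.
Proof.
move=> bF bG ust.
pose l : a.-tuple 'I_(a + b) := [tuple lshift b i | i < a].
pose r : b.-tuple 'I_(a + b) := [tuple rshift a i | i < b].
have lE k (x : k.-tuple T) (y : (a + b).-tuple 'I_k) (u : a.-tuple 'I_k) (v : b.-tuple 'I_k) : y = [tuple of u ++ v] ->
    subtuple l (subtuple y x) = subtuple u x.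
  move=> ->; apply: eq_from_tnth => i.
  by rewrite !tnth_map tnth_ord_tuple tnth_lshift.
have rE k (x : k.-tuple T) (y : (a + b).-tuple 'I_k) (u : a.-tuple 'I_k) (v : b.-tuple 'I_k) : y = [tuple of u ++ v] ->
    subtuple r (subtuple y x) = subtuple v x.
  move=> ->; apply: eq_from_tnth => i.
  by rewrite !tnth_map tnth_ord_tuple tnth_rshift.
pose H (x : (a + b).-tuple T) := F (subtuple l x) * G (subtuple r x).
have bH : bmeas H by apply: bmeasM; exact: bmeas_subtuple.
transitivity (\int[tuple_measure m n]_z H (subtuple [tuple of s ++ t] z)).
  by apply: eq_Rintegral => z _; rewrite /H (lE _ z _ s t)// (rE _ z _ s t).
rewrite Rintegral_subtuple//; last by case: bH.
rewrite bRintegral_tuple_cat//.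
rewrite -bRintegralZr//; last exact: tuple_measureT.
apply: eq_Rintegral => u _; rewrite -bRintegralZl//; last exact: tuple_measureT.
apply: eq_Rintegral => v _; rewrite /H; congr (F _ * G _); apply: eq_from_tnth => i.
  by rewrite !tnth_map tnth_ord_tuple tnth_lshift.
by rewrite !tnth_map tnth_ord_tuple tnth_rshift.
Qed.

(** Two blocks sharing the single position [i] are independent conditionally on
the observation at [i]. *)
Lemma Rintegral_subtuple_share n a b (F : a.+1.-tuple T -> R) (G : b.+1.-tuple T -> R)
    (i : 'I_n) (s : a.-tuple 'I_n) (t : b.-tuple 'I_n) :
  bmeas F -> bmeas G -> uniq (i :: s ++ t) ->
  \int[tuple_measure m n]_z
    (F (subtuple [tuple of i :: s] z) * G (subtuple [tuple of i :: t] z)) =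
  \int[m]_x (\int[tuple_measure m a]_u F (tuple_cons (x, u)) *
             \int[tuple_measure m b]_v G (tuple_cons (x, v))).
Proof.
move=> bF bG ust.
pose l : a.+1.-tuple 'I_(a + b).+1 := [tuple of ord0 :: [tuple lift ord0 (lshift b i) | i < a]].
pose r : b.+1.-tuple 'I_(a + b).+1 := [tuple of ord0 :: [tuple lift ord0 (rshift a i) | i < b]].
have lE (S : Type) (x : S) (u : a.-tuple S) (v : b.-tuple S) j :
    tnth [tuple of x :: [tuple of u ++ v]] (tnth l j) = tnth [tuple of x :: u] j.
  case: (unliftP ord0 j) => [j' ->|->//].
  by rewrite !tnthS tnth_map tnth_ord_tuple tnthS tnth_lshift.
have rE (S : Type) (x : S) (u : a.-tuple S) (v : b.-tuple S) j :
    tnth [tuple of x :: [tuple of u ++ v]] (tnth r j) = tnth [tuple of x :: v] j.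
  case: (unliftP ord0 j) => [j' ->|->//].
  by rewrite !tnthS tnth_map tnth_ord_tuple tnthS tnth_rshift.
pose H (x : (a + b).+1.-tuple T) := F (subtuple l x) * G (subtuple r x).
have bH : bmeas H by apply: bmeasM; exact: bmeas_subtuple.
transitivity (\int[tuple_measure m n]_z H (subtuple [tuple of i :: [tuple of s ++ t]] z)).
  by apply: eq_Rintegral => z _; congr (F _ * G _); apply: eq_from_tnth => j;
    rewrite !tnth_map ?lE ?rE.
rewrite Rintegral_subtuple//; last by case: bH.
rewrite bRintegral_tupleS//; apply: eq_Rintegral => x _.
rewrite bRintegral_tuple_cat//; last exact: bmeas_tuple_cons.
rewrite -bRintegralZr//; [|exact: tuple_measureT|exact: bmeas_tuple_cons].
apply: eq_Rintegral => u _.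
rewrite -bRintegralZl//; [|exact: tuple_measureT|exact: bmeas_tuple_cons].
apply: eq_Rintegral => v _; rewrite /H; congr (F _ * G _); apply: eq_from_tnth => j.
  by rewrite tnth_map lE.
by rewrite tnth_map rE.
Qed.

End covariance.

Section ustat.
Context d (T : measurableType d) (R : realType).
Variable m : {sigma_finite_measure set T -> \bar R}.
Hypothesis mT : m setT = 1%E.
Variable h : 4.-tuple T -> R.
Hypothesis bh : bmeas h.
Hypothesis h_rot : forall t : 4.-tuple T, h [tuple of rot 1 t] = h t.

Let theta := \int[tuple_measure m 4]_t h t.
(** The Hajek projection of the U-statistic with kernel [h]. The kernel is only
assumed invariant under rotations of its arguments, which is enough to bring any
given index to the first place. *)
Definition hajek (x : T) := \int[tuple_measure m 3]_u h (tuple_cons (x, u)).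

Let V1 := \int[m]_x (hajek x ^+ 2) - theta ^+ 2.
Let V2 := \int[tuple_measure m 4]_t (h t ^+ 2).

Lemma bmeas_hajek : bmeas hajek.
Proof. exact: bmeas_Rintegral_tuple. Qed.

Lemma Rintegral_hajek : \int[m]_x hajek x = theta.
Proof. by rewrite /theta bRintegral_tupleS. Qed.

Lemma h_rotn i (t : 4.-tuple T) : h [tuple of rot i t] = h t.
Proof.
elim: i => [|i ih]; first by congr h; apply: val_inj; rewrite /= rot0.
have [i4|i4] := ltnP i 4.
  rewrite -ih -(h_rot [tuple of rot i t]); congr h; apply: val_inj => /=.
  by rewrite rotS ?size_tuple.
by congr h; apply: val_inj; rewrite /= rot_oversize ?size_tuple// ltnW.
Qed.

Lemma subtuple_rot_to n (s : 4.-tuple 'I_n) i : i \in s ->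
  exists2 u : 3.-tuple 'I_n, perm_eq s (i :: u) &
    forall z : n.-tuple T, h (subtuple s z) = h (subtuple [tuple of i :: u] z).
Proof.
move=> /rot_to[k u kE].
have su : size u == 3 by rewrite -eqSS -[X in X == _]/(size (i :: u)) -kE size_rot size_tuple.
exists (Tuple su) => /=; first by rewrite -kE perm_sym perm_rot.
move=> z; rewrite -(h_rotn k); congr h; apply: val_inj => /=.
by rewrite -map_rot kE.
Qed.

(** With [c] the number of shared indices, the covariance is zero for [c = 0],
equal to the variance [V1] of the Hajek projection for [c = 1], and at most the
second moment [V2] otherwise. The weights [c] and ['C(c, 2)] dominate these
cases and are easy to sum over all tuples. *)
Lemma cov_le n (s s' : 4.-tuple 'I_n) : uniq s -> uniq s' ->
  \int[tuple_measure m n]_z (h (subtuple s z) * h (subtuple s' z)) - theta ^+ 2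
  <= (count (mem s) s')%:R * V1 + 'C(count (mem s) s', 2)%:R * V2.
Proof.
move=> us us'.
have mh : measurable_fun setT h by case: bh.
have V10 : 0 <= V1.
  by rewrite subr_ge0 -Rintegral_hajek; apply: sqr_bRintegral_le => //; exact: bmeas_hajek.
have V20 : 0 <= V2 by apply: Rintegral_ge0 => t _; exact: sqr_ge0.
have [k0|] := posnP (count (mem s) s').
  rewrite k0 mul0r bin_small// mul0r addr0 subr_le0 Rintegral_subtuple_indep//.
  by rewrite cat_uniq us us' andbT/= has_count k0.
rewrite leq_eqVlt => /predU1P[k1|k2].
  have /hasP[i is' /= i_s] : has (mem s) s' by rewrite has_count -k1.
  have [u su uE] := subtuple_rot_to i_s.
  have [v sv vE] := subtuple_rot_to is'.
  rewrite -k1 mul1r bin_small// mul0r addr0 lerD2r.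
  rewrite [X in X <= _](_ : _ = \int[tuple_measure m n]_z
    (h (subtuple [tuple of i :: u] z) * h (subtuple [tuple of i :: v] z))); last first.
    by apply: eq_Rintegral => z _; rewrite uE vE.
  rewrite Rintegral_subtuple_share//.
  move: us us'; rewrite (perm_uniq su) (perm_uniq sv) /= => /andP[iu uu] /andP[iv uv].
  rewrite mem_cat negb_or iu iv cat_uniq uu uv /= andbT -all_predC.
  move: k1; rewrite (permP sv) /= i_s add1n => -[/esym/eqP].
  rewrite -leqn0 leqNgt -has_count => /hasPn nv.
  by apply/allP => j /nv /=; rewrite (perm_mem su) inE negb_or => /andP[].
have h2 : \int[tuple_measure m n]_z (h (subtuple s z) * h (subtuple s' z)) <= V2.
  have bs (w : 4.-tuple 'I_n) : bmeas (fun z : n.-tuple T => h (subtuple w z)) by exact: bmeas_subtuple.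
  have V2E (w : 4.-tuple 'I_n) : uniq w -> \int[tuple_measure m n]_z (h (subtuple w z) ^+ 2) = V2.
    move=> uw; rewrite (Rintegral_subtuple mT (F := fun t => h t ^+ 2))//.
    by case: (bmeasX 2 bh).
  apply: (@le_trans _ _ (\int[tuple_measure m n]_z
    (2^-1 * (h (subtuple s z) ^+ 2 + h (subtuple s' z) ^+ 2)))).
    apply: le_bRintegral => //.
    - exact: tuple_measureT.
    - exact: bmeasM.
    - by apply: bmeasM; [exact: bmeas_cst|apply: bmeasD; exact: bmeasX].
    - move=> z; have := sqr_ge0 (h (subtuple s z) - h (subtuple s' z)); nra.
  rewrite bRintegralZl//; [|exact: tuple_measureT|by apply: bmeasD; exact: bmeasX].
  rewrite bRintegralD//; [|exact: tuple_measureT|exact: bmeasX|exact: bmeasX].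
  by rewrite !V2E//; lra.
have c1 : 1 <= 'C(count (mem s) s', 2)%:R :> R by rewrite ler1n bin_gt0.
have := sqr_ge0 theta.
have : 0 <= (count (mem s) s')%:R * V1 by rewrite mulr_ge0.
have : V2 <= 'C(count (mem s) s', 2)%:R * V2 by rewrite ler_peMl.
by lra.
Qed.

Definition usum n (z : n.-tuple T) :=
  \sum_(s : 4.-tuple 'I_n | uniq s) h (subtuple s z).

Lemma bmeas_usum n : bmeas (@usum n).
Proof. by apply: bmeas_sum => s; exact: bmeas_subtuple. Qed.

(** The factors come from summing the weights of [cov_le] over [s'], for fixed
[s]: the number of shared indices sums to [16 n^3] and the number of shared
pairs to [6 * 4^2 n^2]; there are at most [n^4] choices of [s]. *)
Lemma usum_variance n :
  \int[tuple_measure m n]_z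
    ((usum z - #|[pred s : 4.-tuple 'I_n | uniq s]|%:R * theta) ^+ 2)
  <= 16 * n%:R ^+ 7 * V1 + 96 * n%:R ^+ 6 * V2.
Proof.
have PT := tuple_measureT mT n.
have bs (w : 4.-tuple 'I_n) : bmeas (fun z : n.-tuple T => h (subtuple w z)) by exact: bmeas_subtuple.
have mh : measurable_fun setT h by case: bh.
pose D (s : 4.-tuple 'I_n) (z : n.-tuple T) := h (subtuple s z) - theta.
have bD s : bmeas (D s) by apply: bmeasB => //; exact: bmeas_cst.
rewrite [X in X <= _](_ : _ = \int[tuple_measure m n]_z
   (\sum_(s : 4.-tuple 'I_n | uniq s) \sum_(s' : 4.-tuple 'I_n | uniq s') D s z * D s' z)); last first.
  apply: eq_Rintegral => z _.
  rewrite -big_distrlr/= -expr2; congr (_ ^+ 2).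
  rewrite /D sumrB; congr (_ - _).
  by rewrite sumr_const mulr_natl.
rewrite bRintegral_sum//; last by move=> s; apply: bmeas_sum => s'; exact: bmeasM.
pose B (s s' : 4.-tuple 'I_n) : R := (count (mem s) s')%:R * V1 + 'C(count (mem s) s', 2)%:R * V2.
apply: (@le_trans _ _ (\sum_(s : 4.-tuple 'I_n | uniq s) \sum_(s' : 4.-tuple 'I_n) B s s')).
  apply: ler_sum => s us; rewrite bRintegral_sum//; last by move=> s'; exact: bmeasM.
  rewrite [leRHS](bigID (fun s' => uniq (val s')))/=.
  apply: ler_wpDr.
    apply: sumr_ge0 => s' _; apply: addr_ge0; apply: mulr_ge0 => //.
      by rewrite subr_ge0 -Rintegral_hajek; apply: sqr_bRintegral_le => //; exact: bmeas_hajek.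
    by apply: Rintegral_ge0 => t _; exact: sqr_ge0.
  apply: ler_sum => s' us'; apply: le_trans (cov_le us us').
  rewrite [X in X <= _](_ : _ = \int[tuple_measure m n]_z
     ((h (subtuple s z) * h (subtuple s' z) - theta * h (subtuple s z))
      - (theta * h (subtuple s' z) - theta ^+ 2))); last first.
    by apply: eq_Rintegral => z _; rewrite /D; ring.
  have hE (w : 4.-tuple 'I_n) : uniq w -> \int[tuple_measure m n]_z h (subtuple w z) = theta.
    by move=> uw; rewrite Rintegral_subtuple.
  have bth (w : 4.-tuple 'I_n) : bmeas (fun z : n.-tuple T => theta * h (subtuple w z)).
    by apply: bmeasM => //; exact: bmeas_cst.
  rewrite bRintegralB//; [|by apply: bmeasB => //; exact: bmeasM|by apply: bmeasB => //; exact: bmeas_cst].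
  rewrite bRintegralB//; last exact: bmeasM.
  rewrite bRintegralB//; last exact: bmeas_cst.
  rewrite (bRintegral_cst PT (theta ^+ 2)) !bRintegralZl// !hE//.
  by rewrite le_eqVlt; apply/orP; left; apply/eqP; ring.
have BE (s : 4.-tuple 'I_n) : uniq s -> \sum_(s' : 4.-tuple 'I_n) B s s' =
    (16 * n ^ 3)%N%:R * V1 + (96 * n ^ 2)%N%:R * V2.
  move=> us; rewrite /B big_split/= -!big_distrl/= -!natr_sum.
  have -> : (\sum_(t : 4.-tuple 'I_n) count (mem s) t = 16 * n ^ 3)%N.
    rewrite sum_count_tuple4; congr (_ * _)%N.
    by rewrite -big_mkcond/= -big_uniq//= big_tuple sum1_card card_ord.
  have -> // : (\sum_(t : 4.-tuple 'I_n) 'C(count (mem s) t, 2) = 96 * n ^ 2)%N.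
  rewrite sum_bin_count_tuple4; congr (_ * _)%N.
  by rewrite -big_mkcond/= -big_uniq//= big_tuple sum1_card card_ord.
rewrite (eq_bigr _ BE) sumr_const -[X in X <= _]mulr_natl.
have n4 : (#|[pred s : 4.-tuple 'I_n | uniq s]|)%:R <= n%:R ^+ 4 :> R.
  rewrite -natrX ler_nat; apply: leq_trans (max_card _) _.
  by rewrite card_tuple card_ord.
apply: le_trans (ler_wpM2r _ n4) _.
  apply: addr_ge0; apply: mulr_ge0 => //.
    by rewrite subr_ge0 -Rintegral_hajek; apply: sqr_bRintegral_le => //; exact: bmeas_hajek.
  by apply: Rintegral_ge0 => t _; exact: sqr_ge0.
rewrite !natrM le_eqVlt; apply/orP; left; apply/eqP; ring.
Qed.

End ustat.

(** * HSIC as a U-statistic *)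

Lemma sum_tuple4 (V : nmodType) (I : finType) (F : 4.-tuple I -> V) :
  \sum_(t : 4.-tuple I) F t =
  \sum_i \sum_j \sum_r \sum_l F [tuple i; j; r; l].
Proof.
rewrite sum_tuple_cons; apply: eq_bigr => i _.
rewrite sum_tuple_cons; apply: eq_bigr => j _.
rewrite sum_tuple_cons; apply: eq_bigr => r _.
rewrite sum_tuple_cons; apply: eq_bigr => l _.
rewrite (big_pred1 [tuple]); last by move=> t; apply/esym/eqP; exact: tuple0.
by congr F; exact: val_inj.
Qed.

Section quad.
Context (T : Type) (R : realType).
Implicit Types (k l : T -> T -> R) (t : 4.-tuple T).

(** Rotating the arguments changes the sign of the alternating sum, so that the
product of two alternating sums is invariant under rotations. *)
Definition alt4 k t : R :=
  k (tnth t 0) (tnth t 1) - k (tnth t 1) (tnth t 2)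
  + k (tnth t 2) (tnth t 3) - k (tnth t 3) (tnth t 0).

Definition hsic_kernel k l t : R := 4^-1 * (alt4 k t * alt4 l t).

Lemma tuple4P t : exists a b c e, t = [tuple a; b; c; e].
Proof.
case: t => -[|a[|b[|c[|e[|//]]]]] s4 //.
by exists a, b, c, e; exact: val_inj.
Qed.

Lemma alt4E k a b c e : alt4 k [tuple a; b; c; e] = k a b - k b c + k c e - k e a.
Proof. by []. Qed.

Lemma alt4_rot k t : alt4 k [tuple of rot 1 t] = - alt4 k t.
Proof.
have [a [b [c [e ->]]]] := tuple4P t.
by rewrite (_ : [tuple of rot 1 _] = [tuple b; c; e; a])//; [rewrite !alt4E; ring|exact: val_inj].
Qed.

Lemma hsic_kernel_rot k l t : hsic_kernel k l [tuple of rot 1 t] = hsic_kernel k l t.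
Proof. by rewrite /hsic_kernel !alt4_rot mulrNN. Qed.

End quad.

Section quad_sum.
Context (R : realType) (n : nat).
Implicit Type F : 4.-tuple 'I_n -> R.
Local Notation S F := (\sum_(s : 4.-tuple 'I_n | uniq s) F s).

Lemma sum_uniq_rot F : S (fun s : 4.-tuple 'I_n => F [tuple of rot 1 s]) = S F.
Proof.
rewrite [RHS](reindex (fun s : 4.-tuple 'I_n => [tuple of rot 1 s]))/=.
  by apply: eq_bigl => s; rewrite rot_uniq.
exists (fun s : 4.-tuple 'I_n => [tuple of rotr 1 s]) => s _; apply: val_inj => /=.
  by rewrite rotK.
by rewrite rotrK.
Qed.

Lemma sum_uniq_swap F : S (fun s : 4.-tuple 'I_n => F [tuple of rot 2 (rev s)]) = S F.
Proof.
rewrite [RHS](reindex (fun s : 4.-tuple 'I_n => [tuple of rot 2 (rev s)]))/=.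
  by apply: eq_bigl => s; rewrite rot_uniq rev_uniq.
exists (fun s : 4.-tuple 'I_n => [tuple of rev (rotr 2 s)]) => s _; apply: val_inj => /=.
  by rewrite rotK revK.
by rewrite revK rotrK.
Qed.

Lemma sum_uniq4 F :
  S F = \sum_i \sum_j \sum_r \sum_(l | uniq [:: i; j; r; l]) F [tuple i; j; r; l].
Proof.
rewrite big_mkcond sum_tuple4; apply: eq_bigr => i _; apply: eq_bigr => j _.
by apply: eq_bigr => r _; rewrite [RHS]big_mkcond.
Qed.

Lemma sum_uniq_rcons (u : seq 'I_n) (c : R) :
  \sum_(l : 'I_n | uniq (rcons u l)) c =
  if uniq u then (n%:R - (size u)%:R) * c else 0.
Proof.
under eq_bigl do rewrite rcons_uniq andbC.
case: ifPn => uu; last by rewrite big_pred0.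
under eq_bigl do rewrite /=.
rewrite sumr_const -[LHS]mulr_natl -natrB; last first.
  by have := max_card (mem u); rewrite card_ord (card_uniqP uu).
congr (_%:R * _); have /(congr1 (subn^~ (size u))) := cardC (mem u).
rewrite card_ord (card_uniqP uu) addKn => <-.
by apply: eq_card => x; rewrite !inE.
Qed.

Lemma card_uniq_tuple4 :
  #|[pred s : 4.-tuple 'I_n | uniq s]|%:R =
    n%:R * (n%:R - 1) * (n%:R - 2) * (n%:R - 3) :> R.
Proof.
have := sum_uniq4 (fun _ : 4.-tuple 'I_n => 1 : R); rewrite sumr_const => ->.
transitivity (\sum_(i < n) \sum_(j < n | uniq [:: i; j]) ((n%:R - 2) * (n%:R - 3) : R)).
  apply: eq_bigr => i _; rewrite [RHS]big_mkcond/=; apply: eq_bigr => j _.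
  rewrite (eq_bigr (fun r => if uniq [:: i; j; r] then (n%:R - 3) else 0)); last first.
    by move=> l _; have := sum_uniq_rcons [:: i; j; l] (1 : R); rewrite mulr1 => /= <-.
  rewrite -big_mkcond/=.
  by have := sum_uniq_rcons [:: i; j] (n%:R - 3 : R) => /= ->.
rewrite (eq_bigr (fun=> (n%:R - 1) * ((n%:R - 2) * (n%:R - 3)))); last first.
  by move=> i _; have := sum_uniq_rcons [:: i] ((n%:R - 2) * (n%:R - 3) : R) => /= ->.
rewrite sumr_const card_ord -[LHS]mulr_natl; ring.
Qed.

Variables a b : 'I_n -> 'I_n -> R.
Hypotheses (aC : forall i j, a i j = a j i) (bC : forall i j, b i j = b j i).

(** By rotation invariance, each of the four terms of the first alternating sum
contributes the same as [a i j] alone. Against the second alternating sum this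
leaves the products on two, three and four distinct indices that define HSIC; the
factors [n - 2] and [n - 3] count the indices that do not occur in the product. *)
Lemma sum_hsic_kernel :
  S (hsic_kernel a b) =
  (n%:R - 2) * (n%:R - 3) * (\sum_i \sum_(j | uniq [:: i; j]) a i j * b i j)
  + (\sum_i \sum_j \sum_r \sum_(l | uniq [:: i; j; r; l]) a i j * b r l)
  - 2 * ((n%:R - 3) * \sum_i \sum_j \sum_(r | uniq [:: i; j; r]) a i j * b j r).
Proof.
pose A (s : 4.-tuple 'I_n) := a (tnth s 0) (tnth s 1).
pose L := @alt4 _ R b.
pose r (s : 4.-tuple 'I_n) : 4.-tuple 'I_n := [tuple of rot 1 s].
have Lr s : L (r s) = - L s by rewrite /L alt4_rot.
have rE (G : 4.-tuple 'I_n -> R) : S (fun s : 4.-tuple 'I_n => G (r s) * L s) = - S (fun s : 4.-tuple 'I_n => G s * L s).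
  rewrite -(sum_uniq_rot (fun s => G s * L s)) -sumrN; apply: eq_bigr => s _.
  by rewrite -/(r s) Lr mulrN opprK.
have SAL : S (hsic_kernel a b) = S (fun s : 4.-tuple 'I_n => A s * L s).
  rewrite /hsic_kernel -big_distrr/=.
  rewrite (eq_bigr (fun s => (A s * L s - A (r s) * L s) +
      (A (r (r s)) * L s - A (r (r (r s))) * L s))); last first.
    move=> s _; have [x [y [v [w ->]]]] := tuple4P s.
    have -> : r [tuple x; y; v; w] = [tuple y; v; w; x] by exact: val_inj.
    have -> : r [tuple y; v; w; x] = [tuple v; w; x; y] by exact: val_inj.
    have -> : r [tuple v; w; x; y] = [tuple w; x; y; v] by exact: val_inj.
    by rewrite alt4E -/L /A /tnth/=; ring.
  rewrite big_split/= !sumrB.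
  rewrite (rE A) (rE (fun s => A (r (r s)))) (rE (fun s => A (r s))) (rE A).
  by field.
rewrite SAL.
(* Exchanging the first two indices with each other, and the last two, turns the
pair (3, 0) into (1, 2). *)
have swap : S (fun s : 4.-tuple 'I_n => A s * b (tnth s 3) (tnth s 0)) = S (fun s : 4.-tuple 'I_n => A s * b (tnth s 1) (tnth s 2)).
  rewrite -(sum_uniq_swap (fun s => A s * b (tnth s 1) (tnth s 2))).
  apply: eq_bigr => s _; have [x [y [v [w ->]]]] := tuple4P s.
  have -> : [tuple of rot 2 (rev [tuple x; y; v; w])] = [tuple y; x; w; v] by exact: val_inj.
  by rewrite /A /tnth/= aC bC.
rewrite (eq_bigr (fun s => A s * b (tnth s 0) (tnth s 1) + A s * b (tnth s 2) (tnth s 3)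
   - (A s * b (tnth s 1) (tnth s 2) + A s * b (tnth s 3) (tnth s 0)))); last first.
  by move=> s _; rewrite /L /alt4; ring.
rewrite sumrB !big_split/= swap -mulr2n -[X in _ - X]mulr_natl; congr (_ + _ - _ * _).
- rewrite sum_uniq4 big_distrr/=; apply: eq_bigr => i _.
  rewrite big_distrr/= [RHS]big_mkcond/=; apply: eq_bigr => j _.
  rewrite (eq_bigr (fun r => if uniq [:: i; j; r] then (n%:R - 3) * (a i j * b i j) else 0)); last first.
    move=> l _; have := sum_uniq_rcons [:: i; j; l] (a i j * b i j).
    by move=> /= <-.
  rewrite -big_mkcond/=; have := sum_uniq_rcons [:: i; j] ((n%:R - 3) * (a i j * b i j)).
  by move=> /= ->; case: ifP => // _; rewrite mulrA.
- by rewrite sum_uniq4.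
- rewrite sum_uniq4 big_distrr/=; apply: eq_bigr => i _.
  rewrite big_distrr/=; apply: eq_bigr => j _.
  rewrite big_distrr/= [RHS]big_mkcond/=; apply: eq_bigr => l _.
  by have := sum_uniq_rcons [:: i; j; l] (a i j * b j l) => /= <-.
Qed.

End quad_sum.

Section hsic_usum.
Context (R : realType) (p q : nat).
Notation E := (p.-tuple R * q.-tuple R)%type.
Variables (lam : 'I_p -> R) (mu : 'I_q -> R).

Definition kern1 (z z' : E) : R := gauss_kernel lam z.1 z'.1.
Definition kern2 (z z' : E) : R := gauss_kernel mu z.2 z'.2.

Lemma gauss_kernelC d (v : 'I_d -> R) x y : gauss_kernel v x y = gauss_kernel v y x.
Proof.
rewrite /gauss_kernel /phi; apply: eq_bigr => i _.
by rewrite -(opprB (tnth y i) (tnth x i)) sqrrN.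
Qed.

Lemma HSIC_usum n (z : n.-tuple E) : (4 <= n)%N ->
  HSIC lam mu z = usum (hsic_kernel kern1 kern2) z
    / #|[pred s : 4.-tuple 'I_n | uniq s]|%:R.
Proof.
move=> n4.
pose a (i j : 'I_n) := kern1 (tnth z i) (tnth z j).
pose b (i j : 'I_n) := kern2 (tnth z i) (tnth z j).
have -> : usum (hsic_kernel kern1 kern2) z =
    \sum_(s : 4.-tuple 'I_n | uniq s) hsic_kernel a b s.
  apply: eq_bigr => s _; rewrite /hsic_kernel /alt4 /subtuple.
  by rewrite !tnth_map.
rewrite sum_hsic_kernel; [|by move=> i j; exact: gauss_kernelC..].
rewrite card_uniq_tuple4.
rewrite /HSIC -/a.
have N k : (k < 4)%N -> n%:R - k%:R != 0 :> R.
  by move=> k4; rewrite subr_eq0 eqr_nat gtn_eqF// (leq_trans k4).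
have := N 1%N isT; have := N 2%N isT; have := N 3%N isT; have := N 0%N isT.
rewrite subr0 => N0 N3 N2 N1.
rewrite /a /b /kern1 /kern2; field.
by rewrite N0 N1 N2 N3.
Qed.

End hsic_usum.

(** * Mean, Hajek projection and second moment of the HSIC kernel *)

Section small_tuples.
Context d (T : measurableType d) (R : realType).
Variable m : {sigma_finite_measure set T -> \bar R}.
Hypothesis mT : m setT = 1%E.

Lemma Rintegral_tuple3 (F : 3.-tuple T -> R) : bmeas F ->
  \int[tuple_measure m 3]_t F t = \int[m]_y \int[m]_v \int[m]_w F [tuple y; v; w].
Proof.
move=> bF; rewrite bRintegral_tupleS//; apply: eq_Rintegral => y _.
have b1 := bmeas_tuple_cons y bF.
rewrite bRintegral_tupleS//; apply: eq_Rintegral => v _.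
have b2 := bmeas_tuple_cons v b1.
rewrite bRintegral_tupleS//; apply: eq_Rintegral => w _.
have b3 := bmeas_tuple_cons w b2.
rewrite Rintegral_tuple0; last by case: b3.
by congr F; exact: val_inj.
Qed.

Lemma Rintegral_tuple_perm k (s : k.-tuple 'I_k) (F : k.-tuple T -> R) :
  uniq s -> bmeas F ->
  \int[tuple_measure m k]_t F (subtuple s t) = \int[tuple_measure m k]_t F t.
Proof. by move=> us [mF _]; exact: Rintegral_subtuple. Qed.

End small_tuples.

Section projection.
Context d (T : measurableType d) (R : realType).
Variable m : {sigma_finite_measure set T -> \bar R}.
Hypothesis mT : m setT = 1%E.
Variables k l : T -> T -> R.
Hypotheses (kC : forall x y, k x y = k y x) (lC : forall x y, l x y = l y x).
Hypotheses (bk : bmeas (fun z : T * T => k z.1 z.2)).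
Hypotheses (bl : bmeas (fun z : T * T => l z.1 z.2)).

Lemma bmeas_kernel (e : T -> T -> R) d' (T' : measurableType d') (u v : T' -> T) :
  bmeas (fun z : T * T => e z.1 z.2) ->
  measurable_fun setT u -> measurable_fun setT v ->
  bmeas (fun t => e (u t) (v t)).
Proof.
move=> be mu mv.
apply: (bmeas_comp (u := fun t => (u t, v t)) (f := fun z : T * T => e z.1 z.2)) => //.
exact/measurable_fun_pairP.
Qed.

Let mtnth n (i : 'I_n) : measurable_fun setT (fun t : n.-tuple T => tnth t i).
Proof. exact: measurable_tnth. Qed.

Let mcst d' (T' : measurableType d') (x : T) : measurable_fun setT (fun _ : T' => x).
Proof. exact: measurable_cst. Qed.

Let mid : measurable_fun setT (fun x : T => x).
Proof. exact: measurable_id. Qed.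

Let bmk1 d' (T' : measurableType d') (u v : T' -> T) :
  measurable_fun setT u -> measurable_fun setT v -> bmeas (fun t => k (u t) (v t)).
Proof. exact: bmeas_kernel bk. Qed.

Let bmk2 d' (T' : measurableType d') (u v : T' -> T) :
  measurable_fun setT u -> measurable_fun setT v -> bmeas (fun t => l (u t) (v t)).
Proof. exact: bmeas_kernel bl. Qed.

Ltac ms := solve [exact: mtnth|exact: mcst|exact: mid|exact: measurable_fst|exact: measurable_snd
  |exact: (measurableT_comp measurable_fst measurable_snd)
  |exact: (measurableT_comp measurable_snd measurable_snd)].
Ltac bmk := first [apply: bmk1; ms|apply: bmk2; ms].
Ltac bm := repeat first [bmk | exact: bmeas_cst | assumption | apply: bmeasB | apply: bmeasD
  | apply: bmeasM | apply: bmeasX | apply: bmeasN].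

Definition mean_kernel (e : T -> T -> R) x := \int[m]_y e x y.

Local Notation a := (mean_kernel k).
Local Notation b := (mean_kernel l).
Local Notation c := (mean_kernel (fun x y => k x y * l x y)).
Local Notation d1 := (mean_kernel (fun x y => k x y * b y)).
Local Notation d2 := (mean_kernel (fun x y => l x y * a y)).

Lemma bmeas_mean_kernel e : bmeas (fun z : T * T => e z.1 z.2) -> bmeas (mean_kernel e).
Proof. by move=> be; exact: (bmeas_Rintegral1 mT be). Qed.

Let ba : bmeas a. Proof. exact: bmeas_mean_kernel. Qed.
Let bb : bmeas b. Proof. exact: bmeas_mean_kernel. Qed.
Let bc : bmeas c. Proof. by apply: bmeas_mean_kernel; exact: bmeasM. Qed.
Let bsnd (f : T -> R) : bmeas f -> bmeas (fun z : T * T => f z.2).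
Proof. by apply: bmeas_comp; exact: measurable_snd. Qed.
Let bd1 : bmeas d1.
Proof. by apply: bmeas_mean_kernel; apply: bmeasM => //; exact: bsnd. Qed.
Let bd2 : bmeas d2.
Proof. by apply: bmeas_mean_kernel; apply: bmeasM => //; exact: bsnd. Qed.

Let A := \int[m]_x a x.
Let B := \int[m]_x b x.

Let int_d1 : \int[m]_x d1 x = \int[m]_x (a x * b x).
Proof.
rewrite /mean_kernel (bRintegral_swap mT mT (F := fun z => k z.1 z.2 * b z.2)); last first.
  by apply: bmeasM => //; exact: bsnd.
apply: eq_Rintegral => y _ /=; rewrite bRintegralZr//; last by bm.
by congr (_ * _); apply: eq_Rintegral => x _; rewrite kC.
Qed.

Let int_d2 : \int[m]_x d2 x = \int[m]_x (a x * b x).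
Proof.
rewrite /mean_kernel (bRintegral_swap mT mT (F := fun z => l z.1 z.2 * a z.2)); last first.
  by apply: bmeasM => //; exact: bsnd.
apply: eq_Rintegral => y _ /=; rewrite bRintegralZr//; last by bm.
by rewrite mulrC; congr (_ * _); apply: eq_Rintegral => x _; rewrite lC.
Qed.

Lemma bmeas_alt4 (e : T -> T -> R) : bmeas (fun z : T * T => e z.1 z.2) ->
  bmeas (alt4 e).
Proof.
by move=> be; apply: bmeasB; [apply: bmeasD; [apply: bmeasB|]|];
  apply: bmeas_kernel => //; ms.
Qed.

Lemma bmeas_hsic_kernel : bmeas (hsic_kernel k l).
Proof.
by apply: bmeasM; [exact: bmeas_cst|apply: bmeasM; exact: bmeas_alt4].
Qed.

Let bcons x (F : 4.-tuple T -> R) : bmeas F ->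
  bmeas (fun t : 3.-tuple T => F (tuple_cons (x, t))).
Proof. exact: bmeas_tuple_cons. Qed.

(** Reversing the last three arguments identifies the terms in [k01] and [k30],
and those in [k12] and [k23], which leaves half the integral of
[(k01 - k12) * alt4 l]; the latter is expanded. *)
Lemma hajek_hsic_kernel x : hajek m (hsic_kernel k l) x =
  2^-1 * ((c x - a x * b x) - (d1 x - a x * B) - (d2 x - A * b x)
    + (\int[m]_y c y - \int[m]_y (a y * b y))).
Proof.
pose X (t : 4.-tuple T) := (k (tnth t 0) (tnth t 1) - k (tnth t 1) (tnth t 2)) * alt4 l t.
have bX : bmeas X by apply: bmeasM; [bm|exact: bmeas_alt4].
have bXx := bcons x bX.
pose s : 3.-tuple 'I_3 := [tuple 2; 1; 0].
have us : uniq s by [].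
have -> : hajek m (hsic_kernel k l) x = 2^-1 * \int[tuple_measure m 3]_u X (tuple_cons (x, u)).
  rewrite /hajek (_ : \int[_]_u _ = \int[tuple_measure m 3]_u
    (4^-1 * (X (tuple_cons (x, u)) + X (tuple_cons (x, subtuple s u))))); last first.
    apply: eq_Rintegral => u _.
    case: u => -[|y[|v[|w[|//]]]] s3 //.
    rewrite (_ : subtuple _ _ = [tuple w; v; y]); last exact: val_inj.
    rewrite /X /hsic_kernel /alt4 /tnth /=.
    by rewrite (kC w v) (kC w x) (lC y x) (lC v y) (lC w v) (lC x w); ring.
  have bXs : bmeas (fun u : 3.-tuple T => X (tuple_cons (x, subtuple s u))).
    exact: (bmeas_subtuple s bXx).
  have T3 := tuple_measureT mT 3.
  rewrite bRintegralZl//; last exact: bmeasD.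
  rewrite bRintegralD// (Rintegral_tuple_perm mT us bXx).
  by field.
congr (_ * _).
rewrite Rintegral_tuple3//.
transitivity (\int[m]_y \int[m]_v
   ((k x y - k y v) * (l x y - l y v + b v - b x))).
  apply: eq_Rintegral => y _; apply: eq_Rintegral => v _.
  rewrite /X /alt4 /tnth/= bRintegralZl//; last by bm.
  congr (_ * _); rewrite (bRintegralB mT); [|by bm|by bm].
  rewrite (bRintegralD mT); [|by bm|by bm].
  rewrite (bRintegral_cst mT (l x y - l y v)); congr (_ + _ - _).
  by apply: eq_Rintegral => w _; rewrite lC.
transitivity (\int[m]_y
   (k x y * l x y - k x y * b x + k x y * B - k x y * b y - l x y * a y + a y * b x + c y - d1 y)).
  apply: eq_Rintegral => y _.
  rewrite (_ : \int[m]_v _ = \int[m]_v (k x y * (l x y - b x)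
     + k x y * (b v - l y v) - (l x y - b x) * k y v + k y v * l y v - k y v * b v)); last first.
    by apply: eq_Rintegral => v _; ring.
  rewrite (bRintegralB mT); [|by bm|by bm].
  rewrite (bRintegralD mT); [|by bm|by bm].
  rewrite (bRintegralB mT); [|by bm|by bm].
  rewrite (bRintegralD mT); [|by bm|by bm].
  rewrite (bRintegral_cst mT (k x y * (l x y - b x))).
  rewrite bRintegralZl//; last by bm.
  rewrite bRintegralB//; last by bm.
  rewrite bRintegralZl//; last by bm.
  by rewrite -/B -/(b y) -/(a y) -/(c y) -/(d1 y); ring.
rewrite (bRintegralB mT); [|by bm|by bm].
rewrite (bRintegralD mT); [|by bm|by bm].
rewrite (bRintegralD mT); [|by bm|by bm].
rewrite (bRintegralB mT); [|by bm|by bm].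
rewrite (bRintegralB mT); [|by bm|by bm].
rewrite (bRintegralD mT); [|by bm|by bm].
rewrite (bRintegralB mT); [|by bm|by bm].
rewrite !bRintegralZr//; try by bm.
rewrite int_d1 -/A -/(a x) -/(c x) -/(d1 x) -/(d2 x).
by move: (c x) (d1 x) (a x) (b x) (d2 x) A B => c_ d1_ a_ b_ d2_ A_ B_; ring.
Qed.

Lemma mean_hsic_kernel : \int[tuple_measure m 4]_t hsic_kernel k l t =
  \int[m]_x c x - 2 * \int[m]_x (a x * b x) + A * B.
Proof.
rewrite -(Rintegral_hajek mT); last exact: bmeas_hsic_kernel.
rewrite (_ : \int[m]_x _ = \int[m]_x (2^-1 * ((c x - a x * b x) - (d1 x - a x * B) - (d2 x - A * b x)
    + (\int[m]_y c y - \int[m]_y (a y * b y))))); last first.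
  by apply: eq_Rintegral => x _; exact: hajek_hsic_kernel.
rewrite bRintegralZl//; last by bm.
rewrite (bRintegralD mT); [|by bm|by bm].
rewrite (bRintegral_cst mT (\int[m]_y c y - \int[m]_y (a y * b y))).
rewrite (bRintegralB mT); [|by bm|by bm].
rewrite (bRintegralB mT); [|by bm|by bm].
rewrite (bRintegralB mT); [|by bm|by bm].
rewrite (bRintegralB mT); [|by bm|by bm].
rewrite (bRintegralB mT); [|by bm|by bm].
rewrite bRintegralZr// bRintegralZl// int_d1 int_d2 -/A -/B.
by field.
Qed.

(** The kernel [k * l] integrated against the difference between the law and the
product of its marginals, when [k] and [l] act on the two components. The next two
functions are its averages over one component. *)
Definition cross_kernel x := c x - a x * b x.
Definition cross_kernel1 x := d1 x - a x * B.
Definition cross_kernel2 x := d2 x - A * b x.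

(** The Hajek projection is a constant plus half the sum of the three functions
on the right, up to signs. The variance is at most the second moment about that
constant, and [(x - y - z)^2 / 4 <= x^2 + y^2 + z^2]. *)
Lemma hajek_variance_le :
  \int[m]_x (hajek m (hsic_kernel k l) x ^+ 2)
    - (\int[tuple_measure m 4]_t hsic_kernel k l t) ^+ 2
  <= \int[m]_x (cross_kernel x ^+ 2) + \int[m]_x (cross_kernel1 x ^+ 2)
     + \int[m]_x (cross_kernel2 x ^+ 2).
Proof.
have bg : bmeas cross_kernel by rewrite /cross_kernel; bm.
have bg1 : bmeas cross_kernel1 by rewrite /cross_kernel1; bm.
have bg2 : bmeas cross_kernel2 by rewrite /cross_kernel2; bm.
have bh := bmeas_hajek mT bmeas_hsic_kernel.
pose r := 2^-1 * (\int[m]_y c y - \int[m]_y (a y * b y)).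
set H := hajek m (hsic_kernel k l) in bh *.
rewrite -(Rintegral_hajek mT bmeas_hsic_kernel) -/H.
have : 0 <= (\int[m]_x H x - r) ^+ 2 := sqr_ge0 _.
suff : \int[m]_x ((H x - r) ^+ 2) <= \int[m]_x (cross_kernel x ^+ 2) + \int[m]_x (cross_kernel1 x ^+ 2)
     + \int[m]_x (cross_kernel2 x ^+ 2).
  have -> : \int[m]_x ((H x - r) ^+ 2) =
      \int[m]_x (H x ^+ 2) - 2 * r * \int[m]_x H x + r ^+ 2.
    rewrite (_ : \int[m]_x _ = \int[m]_x (H x ^+ 2 - 2 * r * H x + r ^+ 2)); last first.
      by apply: eq_Rintegral => x _; ring.
    rewrite (bRintegralD mT); [|by bm|by bm].
    rewrite (bRintegralB mT); [|by bm|by bm].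
    by rewrite bRintegralZl// (bRintegral_cst mT (r ^+ 2)).
  move: (\int[m]_x (H x ^+ 2)) (\int[m]_x H x) (\int[m]_x (cross_kernel x ^+ 2)).
  move: (\int[m]_x (cross_kernel1 x ^+ 2)) (\int[m]_x (cross_kernel2 x ^+ 2)) (r).
  by move=> s1 s2 r1 I y s; lra.
rewrite -bRintegralD//; [|by bm|by bm].
rewrite -bRintegralD//; [|by bm|by bm].
apply: le_bRintegral => //; [by bm|by bm|] => x.
rewrite /H hajek_hsic_kernel /r -/(cross_kernel x) -/(cross_kernel1 x) -/(cross_kernel2 x).
set g := cross_kernel x; set g1 := cross_kernel1 x; set g2 := cross_kernel2 x.
have := sqr_ge0 (g + g1); have := sqr_ge0 (g + g2); have := sqr_ge0 (g1 - g2).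
have := sqr_ge0 g; have := sqr_ge0 g1; have := sqr_ge0 g2.
set J := (_ - _ : R); nra.
Qed.

Variables (kap1 kap2 M : R).
Hypotheses (k0 : forall x y, 0 <= k x y <= kap1) (l0 : forall x y, 0 <= l x y <= kap2).
Hypotheses (aM : forall x, a x <= M) (bM : forall x, b x <= M) (cM : forall x, c x <= M).
Hypothesis (M0 : 0 <= M).

Definition sum4 (e : T -> T -> R) (t : 4.-tuple T) :=
  e (tnth t 0) (tnth t 1) + e (tnth t 1) (tnth t 2)
  + e (tnth t 2) (tnth t 3) + e (tnth t 3) (tnth t 0).

Let bsum4 (e : T -> T -> R) : bmeas (fun z : T * T => e z.1 z.2) -> bmeas (sum4 e).
Proof.
by move=> be; apply: bmeasD; [apply: bmeasD; [apply: bmeasD|]|];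
  apply: bmeas_kernel => //; ms.
Qed.

Let sqr_alt4 (e : T -> T -> R) kap t : (forall x y, 0 <= e x y <= kap) ->
  alt4 e t ^+ 2 <= 4 * kap * sum4 e t.
Proof.
move=> e0; rewrite /alt4 /sum4.
have /andP[] := e0 (tnth t 0) (tnth t 1); have /andP[] := e0 (tnth t 1) (tnth t 2).
have /andP[] := e0 (tnth t 2) (tnth t 3); have /andP[] := e0 (tnth t 3) (tnth t 0).
move: (e _ _) (e _ _) (e _ _) (e _ _) => y4 y3 y2 y1.
move=> p4 q4 p3 q3 p2 q2 p1 q1.
have s1 : y1 ^+ 2 <= kap * y1 by rewrite expr2 ler_wpM2r.
have s2 : y2 ^+ 2 <= kap * y2 by rewrite expr2 ler_wpM2r.
have s3 : y3 ^+ 2 <= kap * y3 by rewrite expr2 ler_wpM2r.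
have s4 : y4 ^+ 2 <= kap * y4 by rewrite expr2 ler_wpM2r.
have := sqr_ge0 (y1 + y2); have := sqr_ge0 (y1 - y3); have := sqr_ge0 (y1 + y4).
have := sqr_ge0 (y2 + y3); have := sqr_ge0 (y2 - y4); have := sqr_ge0 (y3 + y4).
nra.
Qed.

(** As [0 <= k <= kap1], the square of the alternating sum is at most [4 kap1]
times the plain sum. By rotation invariance one term of the first sum may be kept,
and the product with each of the four terms of the second integrates to at most
[M] or [M^2]. *)
Lemma second_moment_hsic_kernel :
  \int[tuple_measure m 4]_t (hsic_kernel k l t ^+ 2)
  <= 4 * kap1 * kap2 * (M + 3 * M ^+ 2).
Proof.
have T4 := tuple_measureT mT 4.
have bS : bmeas (fun t : 4.-tuple T => sum4 k t * sum4 l t) by apply: bmeasM; exact: bsum4.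
have kap10 : 0 <= kap1 by have /andP[/le_trans] := k0 point point; apply.
have kap20 : 0 <= kap2 by have /andP[/le_trans] := l0 point point; apply.
have kl_ge0 x y : 0 <= k x y by case/andP: (k0 x y).
have ll_ge0 x y : 0 <= l x y by case/andP: (l0 x y).
apply: (@le_trans _ _ (\int[tuple_measure m 4]_t (kap1 * kap2 * (sum4 k t * sum4 l t)))).
  apply: le_bRintegral => //.
  - exact: bmeasX bmeas_hsic_kernel.
  - by apply: bmeasM => //; exact: bmeas_cst.
  - move=> t; rewrite /hsic_kernel !exprMn.
    apply: (@le_trans _ _ (4^-1 ^+ 2 * ((4 * kap1 * sum4 k t) * (4 * kap2 * sum4 l t)))).
      apply: ler_wpM2l; first by rewrite sqr_ge0.
      by apply: ler_pM; [exact: sqr_ge0|exact: sqr_ge0|exact: sqr_alt4|exact: sqr_alt4].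
    by rewrite le_eqVlt; apply/orP; left; apply/eqP; field.
rewrite bRintegralZl//.
pose Y (t : 4.-tuple T) := k (tnth t 0) (tnth t 1) * sum4 l t.
have bY : bmeas Y by apply: bmeasM; [bm|exact: bsum4].
pose s : 4.-tuple 'I_4 := [tuple 1; 2; 3; 0].
have us : uniq s by [].
have bYs (F : 4.-tuple T -> R) : bmeas F -> bmeas (fun t : 4.-tuple T => F (subtuple s t)).
  by move=> bF; exact: (bmeas_subtuple s bF).
have -> : \int[tuple_measure m 4]_t (sum4 k t * sum4 l t) = 4 * \int[tuple_measure m 4]_t Y t.
  rewrite (_ : \int[_]_t _ = \int[tuple_measure m 4]_t
    (Y t + Y (subtuple s t) + Y (subtuple s (subtuple s t))
     + Y (subtuple s (subtuple s (subtuple s t))))); last first.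
    apply: eq_Rintegral => t _; have [x [y [v [w ->]]]] := tuple4P t.
    rewrite (_ : subtuple s [tuple x; y; v; w] = [tuple y; v; w; x]); last exact: val_inj.
    rewrite (_ : subtuple s [tuple y; v; w; x] = [tuple v; w; x; y]); last exact: val_inj.
    rewrite (_ : subtuple s [tuple v; w; x; y] = [tuple w; x; y; v]); last exact: val_inj.
    by rewrite /Y /sum4 /tnth/=; ring.
  have bY1 := bYs _ bY; have bY2 := bYs _ bY1; have bY3 := bYs _ bY2.
  rewrite bRintegralD//; last by apply: bmeasD => //; exact: bmeasD.
  rewrite bRintegralD//; last exact: bmeasD.
  rewrite bRintegralD//.
  rewrite (Rintegral_tuple_perm mT us bY2) (Rintegral_tuple_perm mT us bY1).
  by rewrite (Rintegral_tuple_perm mT us bY); ring.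
rewrite (_ : 4 * kap1 * kap2 * _ = kap1 * kap2 * (4 * (M + 3 * M ^+ 2))); last by ring.
do 2 (apply: ler_wpM2l; first by rewrite ?mulr_ge0).
rewrite bRintegral_tupleS//.
have bYx x := bcons x bY.
have a0 x : 0 <= a x by apply: Rintegral_ge0 => y _.
have b0 x : 0 <= b x by apply: Rintegral_ge0 => y _.
apply: (@le_trans _ _ (\int[m]_x (c x + 3 * M * a x))); last first.
  rewrite bRintegralD//; last by bm.
  rewrite bRintegralZl//; apply: lerD.
    by rewrite -[leRHS](bRintegral_cst mT M); apply: le_bRintegral => //; bm.
  rewrite (_ : 3 * M ^+ 2 = 3 * M * M); last by ring.
  apply: ler_wpM2l; first by rewrite mulr_ge0.
  by rewrite -[leRHS](bRintegral_cst mT M); apply: le_bRintegral => //; bm.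
apply: le_bRintegral => //; [exact: bmeas_Rintegral_tuple|by bm|] => x.
rewrite Rintegral_tuple3//.
have -> : c x + 3 * M * a x = \int[m]_y (k x y * l x y + 3 * M * k x y).
  by rewrite bRintegralD//; [rewrite bRintegralZl//; bm|bm|bm].
have BM : B <= M by rewrite -[leRHS](bRintegral_cst mT M); apply: le_bRintegral => //; bm.
rewrite (_ : \int[m]_y _ = \int[m]_y (k x y * (l x y + b y + B + b x))); last first.
  apply: eq_Rintegral => y _.
  transitivity (\int[m]_v (k x y * (l x y + l y v + b v + b x))).
    apply: eq_Rintegral => v _.
    rewrite /Y /sum4 /tnth/= bRintegralZl//; last by bm.
    congr (_ * _); rewrite (bRintegralD mT); [|by bm|by bm].
    rewrite (bRintegralD mT); [|by bm|by bm].
    rewrite (bRintegral_cst mT (l x y + l y v)); congr (_ + _).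
    by apply: eq_Rintegral => w _; rewrite lC.
  rewrite bRintegralZl//; last by bm.
  congr (_ * _); rewrite (bRintegralD mT); [|by bm|by bm].
  rewrite (bRintegralD mT); [|by bm|by bm].
  rewrite (bRintegralD mT); [|by bm|by bm].
  by rewrite (bRintegral_cst mT (l x y)) (bRintegral_cst mT (b x)).
apply: le_bRintegral => //; [by bm|by bm|] => y.
rewrite [3 * M * _]mulrC -mulrDr; apply: ler_wpM2l => //.
by have := bM x; have := bM y; lra.
Qed.

End projection.

(** * Gaussian densities on the line *)

Section gauss1.
Context (R : realType).
Local Notation leb1 := (@lebR R).

Let measurable_idR : measurable_fun setT (idfun : measurableTypeR R -> R).
Proof. by move=> _ A mA; rewrite setTI. Qed.

Let ge0_integral_lebR (f : R -> \bar R) : measurable_fun setT f ->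
  (forall x, 0 <= f x)%E ->
  (\int[leb1]_x f x = \int[@lebesgue_measure R]_x f x)%E.
Proof.
move=> mf f0.
transitivity (\int[pushforward (@lebesgue_measure R) (idfun : measurableTypeR R -> R)]_x f x)%E.
  by [].
by rewrite ge0_integral_pushforward//; exact: measurable_idR.
Qed.

(** [lebR] and [lebesgue_measure] take the same values on the same sets but live
on two different canonical structures of measurable space on [R]. *)
Lemma integral_lebR (f : R -> \bar R) : measurable_fun setT f ->
  (\int[leb1]_x f x = \int[@lebesgue_measure R]_x f x)%E.
Proof.
move=> mf; rewrite integralE [RHS]integralE; congr (_ - _)%E.
  by apply: ge0_integral_lebR => //; exact: measurable_funepos.
by apply: ge0_integral_lebR => //; exact: measurable_funeneg.
Qed.

Lemma Rintegral_lebR (f : R -> R) : measurable_fun setT f ->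
  \int[leb1]_x f x = \int[@lebesgue_measure R]_x f x.
Proof.
by move=> mf; congr fine; apply: integral_lebR; exact/measurable_EFinP.
Qed.

Lemma integrable_lebR (f : R -> \bar R) :
  leb1.-integrable setT f <-> (@lebesgue_measure R).-integrable setT f.
Proof.
split => /integrableP[mf foo]; apply/integrableP; split => //.
  by move: foo; rewrite integral_lebR//; exact: measurableT_comp.
by rewrite integral_lebR//; exact: measurableT_comp.
Qed.

Definition gauss (h x : R) : R := (Num.sqrt (2 * pi) * h)^-1 * expR (- x ^+ 2 / (2 * h ^+ 2)).

Lemma sqrt2pi_gt0 : 0 < Num.sqrt (2 * pi : R).
Proof. by rewrite sqrtr_gt0 mulr_gt0// pi_gt0. Qed.

Lemma gauss_normal (h m x : R) : 0 < h -> gauss h (x - m) = normal_pdf m h x.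
Proof.
move=> h0; rewrite normal_pdfE ?gt_eqF// /gauss /normal_peak /normal_fun.
congr (_^-1 * expR (_ / _)); last by rewrite mulr_natl.
rewrite (_ : h ^+ 2 * pi *+ 2 = h ^+ 2 * (2 * pi)); last by ring.
by rewrite [RHS]sqrtrM ?sqr_ge0// sqrtr_sqr gtr0_norm// mulrC.
Qed.

Lemma gaussN h x : gauss h (- x) = gauss h x.
Proof. by rewrite /gauss sqrrN. Qed.

Lemma gauss_gt0 h x : 0 < h -> 0 < gauss h x.
Proof.
by move=> h0; rewrite /gauss mulr_gt0 ?expR_gt0// invr_gt0 mulr_gt0// sqrt2pi_gt0.
Qed.

Lemma gauss_ub h x : 0 < h -> gauss h x <= (Num.sqrt (2 * pi) * h)^-1.
Proof.
move=> h0; rewrite /gauss ler_piMr//.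
  by rewrite invr_ge0 mulr_ge0 ?sqrtr_ge0// ltW.
by rewrite -[leRHS]expR0 ler_expR mulNr oppr_le0 divr_ge0 ?sqr_ge0// mulr_ge0 ?sqr_ge0.
Qed.

Lemma measurable_gauss h : measurable_fun setT (gauss h).
Proof.
apply: measurable_funM; first exact: measurable_cst.
apply: measurableT_comp; first exact: measurable_expR.
apply: measurable_funM; last exact: measurable_cst.
apply: measurableT_comp; first exact: oppr_measurable.
exact: measurable_funX.
Qed.

Lemma integral_gauss h y : 0 < h -> (\int[leb1]_x (gauss h (x - y))%:E = 1)%E.
Proof.
move=> h0; rewrite integral_lebR; last first.
  apply/measurable_EFinP; apply: measurableT_comp; first exact: measurable_gauss.
  by apply: measurable_funB; [exact: measurable_id|exact: measurable_cst].
by under eq_integral do rewrite gauss_normal//; exact: integral_normal_pdf.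
Qed.

End gauss1.

(** * Characteristic function of the Gaussian *)

Section charfun.
Context (R : realType).

Lemma is_derive_comp1 (f g : R -> R) (x df dg : R) :
  is_derive x 1 f df -> is_derive (f x) 1 g dg ->
  is_derive x 1 (fun y => g (f y)) (dg * df).
Proof.
by move=> df' dg'; exact: (is_derive1_comp (f := g) (g := f)).
Qed.

Variable s : R.
Hypothesis s0 : 0 < s.

Lemma is_derive_gauss (u : R) :
  is_derive u 1 (gauss s) (- u / s ^+ 2 * gauss s u).
Proof.
have H : is_derive u 1 (fun u : R => - u ^+ 2 / (2 * s ^+ 2)) (- u / s ^+ 2).
  rewrite (_ : (fun _ => _) = (fun u : R => (- (2 * s ^+ 2)^-1) * u ^+ 2)); last first.
    by apply/funext => v; ring.
  apply: is_derive_eq; rewrite /GRing.scale/=.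
  by field; rewrite gt_eqF.
have := is_derive_comp1 H (is_derive_expR _) => H2.
rewrite /gauss; apply: is_derive_eq.
by rewrite /GRing.scale/=; ring.
Qed.

Lemma is_derive_lin (t u : R) : is_derive u 1 (fun u : R => t * u) t.
Proof. by apply: is_derive_eq; rewrite /GRing.scale/= mulr1. Qed.

Lemma is_derive_sinM (t u : R) : is_derive u 1 (fun u : R => sin (t * u)) (cos (t * u) * t).
Proof. by apply: is_derive_comp1; exact: is_derive_lin. Qed.

Lemma is_derive_cosM (t u : R) : is_derive u 1 (fun u : R => cos (t * u)) (- sin (t * u) * t).
Proof. by apply: is_derive_comp1; exact: is_derive_lin. Qed.

Local Notation mu := (@lebesgue_measure R).

Lemma measurable_cosM (t : R) : measurable_fun setT (fun u : R => cos (t * u)).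
Proof.
apply: (measurableT_comp (f := cos)); first exact: continuous_measurable_fun (@continuous_cos R).
by apply: measurable_funM; [exact: measurable_cst|exact: measurable_id].
Qed.

Lemma measurable_sinM (t : R) : measurable_fun setT (fun u : R => sin (t * u)).
Proof.
apply: (measurableT_comp (f := sin)); first exact: continuous_measurable_fun (@continuous_sin R).
by apply: measurable_funM; [exact: measurable_cst|exact: measurable_id].
Qed.

Lemma integrable_gauss : mu.-integrable setT (EFin \o gauss s).
Proof.
apply: eq_integrable (integrable_normal_pdf 0 s) => // u _ /=.
by rewrite -gauss_normal// subr0.
Qed.

Lemma integrable_gaussM (w : R -> R) : measurable_fun setT w ->
  (forall u, `|w u| <= 1) -> mu.-integrable setT (EFin \o (fun u => gauss s u * w u)).
Proof.
move=> mw w1; apply: le_integrable integrable_gauss => //.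
  by apply/measurable_EFinP; apply: measurable_funM => //; exact: measurable_gauss.
move=> u _; rewrite /= lee_fin normrM (gtr0_norm (gauss_gt0 _ s0)).
by rewrite ler_piMr// ltW// gauss_gt0.
Qed.
End charfun.

Section charfun2.
Context (R : realType).
Variable s : R.
Hypothesis s0 : 0 < s.
Local Notation mu := (@lebesgue_measure R).

(** From [v <= s (1 + v^2 / (4 s^2)) <= s exp(v^2 / (4 s^2))]: a factor [|u|] is
absorbed by doubling the variance. It gives an integrable bound for the
derivative of the characteristic function, and the first absolute moment. *)
Lemma norm_id_gauss_le (u : R) :
  `|u| * gauss s u <= s * Num.sqrt 2 * gauss (Num.sqrt 2 * s) u.
Proof.
rewrite /gauss exprMn sqr_sqrtr//.
have -> : - u ^+ 2 / (2 * s ^+ 2) =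
    - (u ^+ 2 / (4 * s ^+ 2)) + - u ^+ 2 / (2 * (2 * s ^+ 2)).
  by field; rewrite gt_eqF.
rewrite expRD.
have -> : s * Num.sqrt 2 * ((Num.sqrt (2 * pi) * (Num.sqrt 2 * s))^-1
     * expR (- u ^+ 2 / (2 * (2 * s ^+ 2)))) =
    s * ((Num.sqrt (2 * pi) * s)^-1 * expR (- u ^+ 2 / (2 * (2 * s ^+ 2)))).
  have c0 := sqrt2pi_gt0 R; have r20 : 0 < Num.sqrt 2 :> R by rewrite sqrtr_gt0.
  by field; rewrite !gt_eqF.
rewrite [leLHS](_ : _ = (`|u| * expR (- (u ^+ 2 / (4 * s ^+ 2)))) *
  ((Num.sqrt (2 * pi) * s)^-1 * expR (- u ^+ 2 / (2 * (2 * s ^+ 2))))); last by ring.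
apply: ler_wpM2r.
  by rewrite mulr_ge0 ?expR_ge0// invr_ge0 mulr_ge0 ?sqrtr_ge0// ltW.
rewrite expRN ler_pdivrMr ?expR_gt0//.
apply: (@le_trans _ _ (s * (1 + u ^+ 2 / (4 * s ^+ 2)))); last first.
  by rewrite ler_pM2l// expR_ge1Dx.
rewrite -(real_normK (num_real u)).
set v := `|u|.
have -> : s * (1 + v ^+ 2 / (4 * s ^+ 2)) = (4 * s ^+ 2 + v ^+ 2) / (4 * s).
  by field; rewrite gt_eqF.
rewrite ler_pdivlMr ?mulr_gt0//.
by have := sqr_ge0 (2 * s - v); nra.
Qed.

Lemma integrable_norm_id_gauss : mu.-integrable setT (EFin \o (fun u => `|u| * gauss s u)).
Proof.
have r2 : 0 < Num.sqrt 2 * s by rewrite mulr_gt0// sqrtr_gt0.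
have := integrableZl measurableT (s * Num.sqrt 2) (integrable_gauss r2).
apply: le_integrable => //.
  apply/measurable_EFinP; apply: measurable_funM; last exact: measurable_gauss.
  by apply: measurableT_comp; [exact: normr_measurable|exact: measurable_id].
move=> u _; rewrite /= lee_fin normrM normr_id (gtr0_norm (gauss_gt0 _ s0)).
apply: le_trans (norm_id_gauss_le u) _.
exact: ler_norm.
Qed.

Let C (t : R) := \int[mu]_u (gauss s u * cos (t * u)).

Let is_derive_C (t : R) :
  is_derive t 1 C (- \int[mu]_u (u * gauss s u * sin (t * u))).
Proof.
pose f (t u : R) := gauss s u * cos (t * u).
have df (t' u : R) : is_derive t' 1 (f ^~ u) (- (u * gauss s u * sin (t' * u))).
  have := is_derive_cosM u t'.
  rewrite /f (_ : (fun t' => cos (u * t')) = (fun t' => cos (t' * u))); last first.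
    by apply/funext => v; rewrite mulrC.
  move=> H; apply: is_derive_eq; rewrite /GRing.scale/= [u * t']mulrC; ring.
have It : `]t - 1, t + 1[%classic t by rewrite /= in_itv/=; apply/andP; split; lra.
have intf t' : `]t - 1, t + 1[%classic t' -> mu.-integrable setT (EFin \o f t').
  move=> _; apply: integrable_gaussM => //; first exact: measurable_cosM.
  by move=> u; exact: cos_max.
have derf t' u : `]t - 1, t + 1[%classic t' -> setT u -> derivable (f ^~ u) t' 1.
  by move=> _ _; case: (df t' u).
have G0 u : 0 <= `|u| * gauss s u by rewrite mulr_ge0// ltW// gauss_gt0.
have Gub t' u : `]t - 1, t + 1[%classic t' -> setT u ->
    `|partial1of2 f t' u| <= `|u| * gauss s u.
  move=> _ _; rewrite partial1of2E; have [_ ->] := df t' u.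
  rewrite normrN normrM [`|u * _|]normrM (gtr0_norm (gauss_gt0 _ s0)) ler_piMr//.
  exact: sin_max.
split.
  exact: (derivable_under_integral measurableT It intf derf G0 integrable_norm_id_gauss Gub).
have := differentiation_under_integral measurableT It intf derf G0 integrable_norm_id_gauss Gub.
rewrite -derive1E => ->.
rewrite -mulN1r -RintegralZl//; last first.
  apply: le_integrable integrable_norm_id_gauss => //.
    apply/measurable_EFinP; apply: measurable_funM; last exact: measurable_sinM.
    by apply: measurable_funM; [exact: measurable_id|exact: measurable_gauss].
  move=> u _; rewrite /= lee_fin normrM [`|u * _|]normrM [`|(`|u| * _)|]normrM normr_id (gtr0_norm (gauss_gt0 _ s0)).
  by rewrite ler_piMr//; exact: sin_max.
apply: eq_Rintegral => u _; rewrite partial1of2E; have [_ ->] := df t u.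
by rewrite mulN1r.
Qed.

Let D (t u : R) := - (s ^+ 2)^-1 * (u * gauss s u * sin (t * u)) + t * (gauss s u * cos (t * u)).

Let integrable_uS t : mu.-integrable setT (EFin \o (fun u => u * gauss s u * sin (t * u))).
Proof.
apply: le_integrable integrable_norm_id_gauss => //.
  apply/measurable_EFinP; apply: measurable_funM; last exact: measurable_sinM.
  by apply: measurable_funM; [exact: measurable_id|exact: measurable_gauss].
move=> u _; rewrite /= lee_fin normrM [`|u * _|]normrM [`|(`|u| * _)|]normrM normr_id (gtr0_norm (gauss_gt0 _ s0)).
by rewrite ler_piMr//; [rewrite mulr_ge0// ltW// gauss_gt0|exact: sin_max].
Qed.

Let integrable_gC t : mu.-integrable setT (EFin \o (fun u => gauss s u * cos (t * u))).
Proof. by apply: integrable_gaussM => //; [exact: measurable_cosM|move=> u; exact: cos_max]. Qed.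

Let is_derive_gS (t u : R) : is_derive u 1 (fun u => gauss s u * sin (t * u)) (D t u).
Proof.
have H1 := is_derive_gauss s0 u; have H2 := is_derive_sinM t u.
apply: is_derive_eq; rewrite /GRing.scale/= /D.
by field; rewrite gt_eqF.
Qed.

Let integrable_D t : mu.-integrable setT (EFin \o D t).
Proof.
have := integrableD measurableT (integrableZl measurableT (- (s ^+ 2)^-1) (integrable_uS t))
  (integrableZl measurableT t (integrable_gC t)).
by apply: eq_integrable.
Qed.

Let continuous_D t : continuous (D t).
Proof.
have cg : continuous (gauss s).
  by move=> u; apply/differentiable_continuous/derivable1_diffP; case: (is_derive_gauss s0 u).
have cs : continuous (fun u : R => sin (t * u)).
  by move=> u; apply/differentiable_continuous/derivable1_diffP; case: (is_derive_sinM t u).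
have cc : continuous (fun u : R => cos (t * u)).
  by move=> u; apply/differentiable_continuous/derivable1_diffP; case: (is_derive_cosM t u).
move=> u; apply: cvgD; apply: cvgM; [exact: cvg_cst| |exact: cvg_cst|].
  by apply: cvgM; [apply: cvgM; [exact: cvg_id|exact: cg]|exact: cs].
by apply: cvgM; [exact: cg|exact: cc].
Qed.

Let gauss_cvg0 : gauss s (n.+1%:R) @[n --> \oo] --> 0.
Proof.
pose c := s * Num.sqrt 2 * (Num.sqrt (2 * pi) * (Num.sqrt 2 * s))^-1.
apply: (@squeeze_cvgr _ _ _ _ (fun _ => 0) (fun n : nat => c * n.+1%:R^-1)).
- apply: nearW => n; rewrite ltW ?gauss_gt0//=.
  rewrite ler_pdivlMr ?ltr0n// mulrC.
  have := norm_id_gauss_le n.+1%:R; rewrite ger0_norm//; move/le_trans; apply.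
  rewrite /c ler_wpM2l//; first by rewrite mulr_ge0 ?sqrtr_ge0// ltW.
  by apply: gauss_ub; rewrite mulr_gt0// sqrtr_gt0.
- exact: cvg_cst.
- rewrite -(mulr0 c); apply: cvgM; first exact: cvg_cst.
  exact: cvg_harmonic.
Qed.

Let Rintegral_D0 t : (\int[mu]_u (D t u)%:E = 0)%E.
Proof.
pose I (n : nat) := `[- n.+1%:R, n.+1%:R]%classic : set R.
pose F u := gauss s u * sin (t * u).
have FTC (n : nat) : (\int[mu]_(u in I n) (D t u)%:E = (F n.+1%:R - F (- n.+1%:R))%:E)%E.
  rewrite EFinB; apply: (@continuous_FTC2 _ (D t) F).
  - by rewrite -subr_gt0 opprK ltr_wpDr.
  - exact: continuous_subspaceT.
  - have cF : continuous F.
      by move=> u; apply/differentiable_continuous/derivable1_diffP; case: (is_derive_gS t u).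
    split.
    + by move=> u _; case: (is_derive_gS t u).
    + by apply: cvg_at_right_filter; exact: cF.
    + by apply: cvg_at_left_filter; exact: cF.
  - by move=> u _; rewrite derive1E; have [_ ->] := is_derive_gS t u.
have mI n : measurable (I n) by exact: measurable_itv.
have mD : measurable_fun setT (EFin \o D t) by exact: measurable_int (integrable_D t).
(* The integral over the line is the limit of those over [[- n - 1, n + 1]], which
are increments of [gauss s u * sin (t * u)]. *)
pose f_ n := (EFin \o D t) \_ (I n).
have mf_ n : measurable_fun setT (f_ n).
  by apply/(measurable_restrictT (EFin \o D t) (mI n)); exact: (measurable_funS measurableT _ mD).
have f_f : {ae mu, forall u, setT u -> f_ ^~ u @ \oo --> (EFin \o D t) u}.
  apply: aeW => u _; apply: (@cvg_near_cst _ _ _ _ _ _) => //.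
  exists (Num.trunc `|u|) => //= n /= un.
  have Inu : u \in I n.
    rewrite inE /I/= in_itv/= -ler_norml; apply: ltW.
    by apply: lt_le_trans (truncnS_gt _) _; rewrite ler_nat ltnS.
  by rewrite /f_ patchE Inu.
have f_g : {ae mu, forall u n, setT u -> `|f_ n u| <= (abse \o (EFin \o D t)) u}%E.
  by apply: aeW => u n _; rewrite /f_ patchE; case: ifP => _ //=; rewrite [leLHS](_ : _ = 0%E) ?abse_ge0//= normr0.
have [_ _ cv] := @dominated_convergence _ _ _ mu setT measurableT
  f_ (EFin \o D t) (abse \o (EFin \o D t)) mf_ mD f_f (integrable_abse (integrable_D t)) f_g.
have {}cv : (F n.+1%:R - F (- n.+1%:R))%:E @[n --> \oo] --> (\int[mu]_u (D t u)%:E)%E.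
  by under eq_fun do rewrite -FTC integral_mkcond.
apply: (cvg_unique _ cv) => //.
apply: cvg_EFin; first exact: nearW.
rewrite (_ : fine \o _ = (fun n : nat => gauss s n.+1%:R * (2 * sin (t * n.+1%:R)))); last first.
  by apply/funext => n; rewrite /= /F gaussN mulrN sinN; ring.
apply/norm_cvg0P.
apply: (@squeeze_cvgr _ _ _ _ (fun _ => 0) (fun n : nat => gauss s n.+1%:R * 2)).
- apply: nearW => n; rewrite normr_ge0/= normrM (gtr0_norm (gauss_gt0 _ s0)).
  rewrite ler_pM2l ?gauss_gt0// normrM ger0_norm// ler_piMr//; exact: sin_max.
- exact: cvg_cst.
- by rewrite -(mul0r 2); apply: cvgM => //; exact: cvg_cst.
Qed.

Let CE t : \int[mu]_u (u * gauss s u * sin (t * u)) = s ^+ 2 * t * C t.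
Proof.
have : \int[mu]_u (D t u) = 0 by rewrite /Rintegral Rintegral_D0.
rewrite /D RintegralD//; last 2 first.
- by have := integrableZl measurableT (- (s ^+ 2)^-1) (integrable_uS t); apply: eq_integrable.
- by have := integrableZl measurableT t (integrable_gC t); apply: eq_integrable.
rewrite (RintegralZl (- (s ^+ 2)^-1) measurableT (integrable_uS t)).
rewrite (RintegralZl t measurableT (integrable_gC t)).
rewrite -/(C t); move: (\int[mu]_u _) (C t) => x y /eqP; rewrite addr_eq0 => /eqP H.
have s2 : s ^+ 2 != 0 by rewrite gt_eqF// exprn_gt0.
move: H; rewrite mulNr => /oppr_inj/(congr1 ( *%R (s ^+ 2))).
by rewrite mulVKf// mulrA.
Qed.

(** The characteristic function satisfies the differential equation
[C' = - s^2 t C], obtained by differentiating under the integral sign and then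
integrating by parts. *)
Lemma charfun_gauss (t : R) : \int[mu]_u (gauss s u * cos (t * u)) = expR (- (s ^+ 2 * t ^+ 2 / 2)).
Proof.
pose H (t : R) := C t * expR (s ^+ 2 * t ^+ 2 / 2).
have dH (x : R) : is_derive x 1 H 0.
  have d1 := is_derive_C x.
  have d2 : is_derive x 1 (fun x : R => s ^+ 2 * x ^+ 2 / 2) (s ^+ 2 * x).
    rewrite (_ : (fun _ => _) = (fun x : R => (s ^+ 2 / 2) * x ^+ 2)); last first.
      by apply/funext => v; ring.
    by apply: is_derive_eq; rewrite /GRing.scale/=; field.
  have d3 := is_derive_comp1 d2 (is_derive_expR _).
  by apply: is_derive_eq; rewrite /GRing.scale/= CE; ring.
have := @is_derive_0_is_cst _ H t 0 dH.
have C0 : C 0 = 1.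
  rewrite /C.
  under eq_Rintegral do rewrite mul0r cos0 mulr1.
  rewrite /Rintegral; have -> : (\int[mu]_u (gauss s u)%:E = \int[mu]_u (normal_pdf 0 s u)%:E)%E.
    by apply: eq_integral => u _; rewrite -gauss_normal// subr0.
  by rewrite integral_normal_pdf.
rewrite [RHS]/H C0 expr0n/= mulr0 mul0r expR0 mulr1 /H => H1.
have e0 : expR (s ^+ 2 * t ^+ 2 / 2) != 0 by rewrite gt_eqF// expR_gt0.
by apply: (mulIf e0); rewrite -/(C t) H1 expRN mulVf.
Qed.

End charfun2.

(** * Approximate identities in L1 *)

Lemma cvge0P (R : realType) (u : nat -> \bar R) : (forall k, 0 <= u k)%E ->
  u @ \oo --> (0 : \bar R)%E <->
  (forall e : R, 0 < e -> \forall k \near \oo, (u k <= e%:E)%E).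
Proof.
move=> u0; split.
  move=> /fine_cvgP[uf /cvgrPdist_le u_0] e e0.
  near=> k; have ufk : u k \is a fin_num by near: k.
  rewrite -(fineK ufk) lee_fin; apply: le_trans (ler_norm _) _.
  by rewrite -normrN -sub0r; near: k; exact: u_0.
move=> ue; apply/fine_cvgP; split.
  near=> k; rewrite ge0_fin_numE//; apply: (@le_lt_trans _ _ (1%:E)%E).
    by near: k; exact: ue.
  exact: ltry.
apply/cvgrPdist_le => e e0; near=> k.
have uk : (u k <= e%:E)%E by near: k; exact: ue.
rewrite sub0r normrN ger0_norm ?fine_ge0//.
rewrite -lee_fin fineK// ge0_fin_numE//.
by apply: le_lt_trans uk _; exact: ltry.
Unshelve. all: by end_near. Qed.

Section L1norm.
Context d (T : measurableType d) (R : realType).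
Variable m : {measure set T -> \bar R}.
Implicit Types f g : T -> R.
Local Open Scope ereal_scope.

Definition norm1 f : \bar R := \int[m]_x `|f x|%:E.

Lemma norm1_ge0 f : 0 <= norm1 f.
Proof. by apply: integral_ge0 => x _; rewrite lee_fin. Qed.

Lemma measurable_normE f : measurable_fun setT f ->
  measurable_fun setT (fun x => `|f x|%:E).
Proof. by move=> mf; apply/measurable_EFinP; exact: measurableT_comp. Qed.

Lemma norm1D f g : measurable_fun setT f -> measurable_fun setT g ->
  norm1 (fun x => f x + g x)%R <= norm1 f + norm1 g.
Proof.
move=> mf mg; rewrite /norm1 -ge0_integralD//; try exact: measurable_normE.
  apply: ge0_le_integral => //.
  - by apply: measurable_normE; exact: measurable_funD.
  - by apply: emeasurable_funD; exact: measurable_normE.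
  - by move=> x _; rewrite -EFinD lee_fin ler_normD.
Qed.

Lemma norm1N f : norm1 (fun x => - f x)%R = norm1 f.
Proof. by apply: eq_integral => x _; rewrite normrN. Qed.

Lemma norm1B f g : measurable_fun setT f -> measurable_fun setT g ->
  norm1 (fun x => f x - g x)%R <= norm1 f + norm1 g.
Proof.
move=> mf mg; rewrite -(norm1N g); apply: norm1D => //.
exact: measurableT_comp.
Qed.

Lemma norm_Rintegral_le f : measurable_fun setT f ->
  `|Rintegral m setT f|%:E <= norm1 f.
Proof.
move=> mf; have [foo|] := ltP (norm1 f) +oo; last by rewrite leye_eq => /eqP ->; exact: leey.
have intf : m.-integrable setT (EFin \o f) by apply/integrableP; split => //; exact/measurable_EFinP.
by rewrite EFin_normr_Rintegral//; apply: le_abse_integral => //; exact/measurable_EFinP.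
Qed.

Lemma integrable_norm1 f : measurable_fun setT f ->
  m.-integrable setT (EFin \o f) <-> norm1 f < +oo.
Proof.
move=> mf; split => [/integrableP[]//|foo].
by apply/integrableP; split => //; exact/measurable_EFinP.
Qed.

End L1norm.

Section approximate_identity.
Context d (T : measurableType d) (R : realType).
Variable m : {sigma_finite_measure set T -> \bar R}.
Implicit Types (K : nat -> T -> T -> R) (F G : T -> R).

(** Only the columns are required to have integral 1: this is what makes the
kernel a contraction of L1. Boundedness makes convolution well defined on
integrable functions. *)
Definition markov_kernel K := forall k,
  [/\ measurable_fun setT (fun z : T * T => K k z.1 z.2),
      forall x y, 0 <= K k x y,
      exists B, forall x y, K k x y <= B &
      forall y, (\int[m]_x (K k x y)%:E = 1)%E].

Definition kconv K k F x := \int[m]_y (K k x y * F y).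

Definition approximates K F :=
  norm1 m (fun x => kconv K k F x - F x) @[k --> \oo] --> (0 : \bar R)%E.

Variable K : nat -> T -> T -> R.
Hypothesis mK : markov_kernel K.

Lemma measurable_kernelM k F : measurable_fun setT F ->
  measurable_fun setT (fun z : T * T => K k z.1 z.2 * F z.2).
Proof.
move=> mF; have [mk _ _ _] := mK k.
by apply: measurable_funM => //; exact: measurableT_comp mF measurable_snd.
Qed.

Lemma measurable_conv k F : measurable_fun setT F -> measurable_fun setT (kconv K k F).
Proof. by move=> mF; exact: (measurable_Rintegral1 m (measurable_kernelM k mF)). Qed.

Lemma measurable_kernel1 k x : measurable_fun setT (K k x).
Proof.
have [mk _ _ _] := mK k.
exact: (measurableT_comp mk (measurable_pair1 x)).
Qed.

Lemma integrable_kernelM k x F : m.-integrable setT (EFin \o F) ->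
  m.-integrable setT (EFin \o (fun y => K k x y * F y)).
Proof.
move=> iF; have mF := integrable_measurable iF.
have [mk K0 [B KB] _] := mK k.
have := integrableZl measurableT B iF; apply: le_integrable => //.
  by apply/measurable_EFinP; apply: measurable_funM => //; exact: measurable_kernel1.
move=> y _ /=; rewrite lee_fin !normrM ler_wpM2r//.
by rewrite (ger0_norm (K0 _ _)) (le_trans (KB x y))// ler_norm.
Qed.

Lemma norm1_conv k F : measurable_fun setT F -> (norm1 m (kconv K k F) <= norm1 m F)%E.
Proof.
move=> mF; have [mk K0 _ K1] := mK k.
have mkF := measurable_kernelM k mF.
apply: (@le_trans _ _ (\int[m]_x \int[m]_y `|K k x y * F y|%:E)%E).
  apply: ge0_le_integral => //.
  - by apply: measurable_normE; exact: measurable_conv.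
  - apply: (measurable_fun_fubini_tonelli_F (fun z : T * T => `|K k z.1 z.2 * F z.2|%:E)) => //.
    exact: (measurable_normE (f := fun z : T * T => K k z.1 z.2 * F z.2)).
  - move=> x _; apply: norm_Rintegral_le.
    by apply: measurable_funM => //; exact: measurable_kernel1.
rewrite (fubini_tonelli (m1 := m) (m2 := m) (fun z : T * T => `|K k z.1 z.2 * F z.2|%:E))//; last first.
  exact: (measurable_normE (f := fun z : T * T => K k z.1 z.2 * F z.2)).
rewrite le_eqVlt; apply/orP; left; apply/eqP; apply: eq_integral => y _.
rewrite (_ : \int[m]_x _ = \int[m]_x ((K k x y)%:E * `|F y|%:E))%E; last first.
  by apply: eq_integral => x _; rewrite normrM (ger0_norm (K0 _ _)) EFinM.
rewrite ge0_integralZr//; [by rewrite K1 mul1e|..].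
- by apply/measurable_EFinP; exact: (measurableT_comp mk (measurable_pair2 y)).
- by move=> x _; rewrite lee_fin.
Qed.

Lemma convB k F G x : m.-integrable setT (EFin \o F) -> m.-integrable setT (EFin \o G) ->
  kconv K k (fun y => F y - G y) x = kconv K k F x - kconv K k G x.
Proof.
move=> iF iG; rewrite /kconv -RintegralB//; try exact: integrable_kernelM.
by apply: eq_Rintegral => y _; rewrite mulrBr.
Qed.

Lemma norm1_convB k F G : m.-integrable setT (EFin \o F) -> m.-integrable setT (EFin \o G) ->
  (norm1 m (fun x => kconv K k F x - F x)%R <=
   norm1 m (fun x => kconv K k G x - G x)%R + 2%:E * norm1 m (fun x => F x - G x)%R)%E.
Proof.
move=> iF iG.
have mF := integrable_measurable iF; have mG := integrable_measurable iG.
have iFG : m.-integrable setT (EFin \o (fun x => F x - G x)).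
  by have := integrableB measurableT iF iG; apply: eq_integrable.
have mFG := integrable_measurable iFG.
have mc H : measurable_fun setT H -> measurable_fun setT (kconv K k H) by exact: measurable_conv.
rewrite (_ : (fun x => kconv K k F x - F x) = (fun x => (kconv K k G x - G x) +
   (kconv K k (fun x => F x - G x) x - (F x - G x)))); last first.
  by apply/funext => x; rewrite convB//; ring.
apply: le_trans (norm1D m _ _) _.
- by apply: measurable_funB => //; exact: mc.
- by apply: measurable_funB => //; exact: mc.
apply: leeD => //; apply: le_trans (norm1B m (mc _ mFG) mFG) _.
rewrite mule_natl mule2n.
by apply: leeD => //; exact: norm1_conv.
Qed.

(** Contractivity makes approximation uniform, hence a closed property in L1. *)
Lemma approximates_closed F : m.-integrable setT (EFin \o F) ->
  (forall e, 0 < e -> exists G, [/\ m.-integrable setT (EFin \o G),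
     (norm1 m (fun x => F x - G x)%R < e%:E)%E & approximates K G]) ->
  approximates K F.
Proof.
move=> iF FG; apply/cvge0P => [k|e e0]; first exact: norm1_ge0.
have e4 : 0 < e / 4 by rewrite divr_gt0.
have [G [iG FGe /cvge0P Ge]] := FG _ e4.
have {}Ge := Ge (fun k => norm1_ge0 _ _) _ e4.
near=> k.
have Gk : (norm1 m (fun x => kconv K k G x - G x)%R <= (e / 4)%:E)%E by near: k.
apply: le_trans (norm1_convB k iF iG) _.
apply: (@le_trans _ _ ((e / 4)%:E + 2%:E * (e / 4)%:E)%E).
  by apply: leeD => //; rewrite lee_pmul2l//; exact: ltW.
by rewrite -EFinM -EFinD lee_fin; lra.
Unshelve. all: by end_near. Qed.

(** Scheffe's argument. The integral of [K u] does not exceed that of [u], so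
[|K u - u| = 2 (u - K u)^+ + (K u - u)] integrates to at most twice the integral
of the positive part, which is dominated by [u]. *)
Lemma approximates_ge0 u : m.-integrable setT (EFin \o u) -> (forall x, 0 <= u x) ->
  {ae m, forall x, kconv K k u x @[k --> \oo] --> u x} -> approximates K u.
Proof.
move=> iu u0 cu; have mu := integrable_measurable iu.
have mc k : measurable_fun setT (kconv K k u) by exact: measurable_conv.
have c0 k x : 0 <= kconv K k u x.
  by apply: Rintegral_ge0 => y _; have [_ K0 _ _] := mK k; rewrite mulr_ge0.
pose v k x := Num.max (u x - kconv K k u x) 0.
have v0 k x : 0 <= v k x by rewrite /v le_max lexx orbT.
have mv k : measurable_fun setT (v k).
  apply: measurable_maxr; last exact: measurable_cst.
  exact: measurable_funB.
have int_conv k : (\int[m]_x (kconv K k u x)%:E <= \int[m]_x (u x)%:E)%E.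
  have := norm1_conv k mu; rewrite /norm1.
  under eq_integral do rewrite ger0_norm//.
  by under [X in (_ <= X)%E -> _]eq_integral do rewrite ger0_norm//.
have ufin : (\int[m]_x (u x)%:E)%E \is a fin_num by exact: integrable_fin_num iu.
have bnd k : (norm1 m (fun x => kconv K k u x - u x)%R <= 2%:E * \int[m]_x (v k x)%:E)%E.
  rewrite -(leeD2rE _ _ ufin).
  apply: (@le_trans _ _ (2%:E * \int[m]_x (v k x)%:E + \int[m]_x (kconv K k u x)%:E)%E); last first.
    by rewrite leeD2l.
  rewrite -ge0_integralZl//; [|exact/measurable_EFinP|by move=> x _; rewrite lee_fin].
  have h1 : measurable_fun setT (fun x => `|kconv K k u x - u x|%:E).
    by apply: measurable_normE; exact: measurable_funB.
  have h2 : measurable_fun setT (fun x => (2%:E * (v k x)%:E)%E).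
    by apply/measurable_EFinP; apply: measurable_funM => //; exact: measurable_cst.
  have h3 : measurable_fun setT (EFin \o u) by exact/measurable_EFinP.
  have h4 : measurable_fun setT (EFin \o kconv K k u) by exact/measurable_EFinP.
  rewrite -ge0_integralD//; [|by move=> x _; rewrite lee_fin..].
  rewrite -ge0_integralD//; [|by move=> x _; rewrite -?EFinM lee_fin ?mulr_ge0..].
  rewrite le_eqVlt; apply/orP; left; apply/eqP; apply: eq_integral => x _.
  rewrite -EFinM -!EFinD; congr (_%:E); rewrite /v.
  have [h|h] := leP (u x - kconv K k u x) 0.
    by rewrite ger0_norm ?mulr0 ?add0r ?subrK// -oppr_le0 opprB.
  by rewrite ltr0_norm; [ring|rewrite -oppr_gt0 opprB].
have cv0 : {ae m, forall x, setT x -> (v k x)%:E @[k --> \oo] --> (0 : \bar R)%E}.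
  move: cu; apply: filterS => x cx _; apply: cvg_EFin; first exact: nearW.
  rewrite (_ : _ \o _ = fun k => v k x)//.
  apply: (@squeeze_cvgr _ _ _ _ (fun _ => 0) (fun k => `|u x - kconv K k u x|)).
  - by apply: nearW => k; rewrite v0 /= /v ge_max ler_norm normr_ge0.
  - exact: cvg_cst.
  - rewrite -(normr0 R) -(subrr (u x)); apply: cvg_norm.
    by apply: cvgB => //; exact: cvg_cst.
have vu : {ae m, forall x k, setT x -> `|(v k x)%:E| <= (u x)%:E}%E.
  apply: aeW => x k _; rewrite lee_fin ger0_norm// /v ge_max u0 andbT.
  by rewrite lerBlDr lerDl.
have [_ _ cv] := @dominated_convergence _ _ _ m setT measurableT
  (fun k x => (v k x)%:E) (cst (0 : \bar R)%E) (EFin \o u)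
  (fun k => (measurable_EFinP _ _).2 (mv k)) (measurable_cst _) cv0 iu vu.
apply: (@squeeze_cvge _ _ _ _ (cst (0 : \bar R)%E) _ (fun k => 2%:E * \int[m]_x (v k x)%:E)%E).
- by apply: nearW => k; rewrite norm1_ge0/=; exact: bnd.
- exact: cvg_cst.
- rewrite -[X in _ --> X](mule0 2%:E); apply: cvgeZl => //.
  by move: cv; rewrite integral0.
Qed.

Lemma approximatesB F G : m.-integrable setT (EFin \o F) ->
  m.-integrable setT (EFin \o G) -> approximates K F -> approximates K G ->
  approximates K (fun x => F x - G x).
Proof.
move=> iF iG AF AG.
have mF := integrable_measurable iF; have mG := integrable_measurable iG.
apply: (@squeeze_cvge _ _ _ _ (cst (0 : \bar R)%E) _ (fun k =>
  norm1 m (fun x => kconv K k F x - F x)%R + norm1 m (fun x => kconv K k G x - G x)%R)%E).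
- apply: nearW => k; rewrite norm1_ge0/=.
  rewrite (_ : (fun x => kconv K k (fun x => F x - G x) x - (F x - G x)) =
     (fun x => (kconv K k F x - F x) - (kconv K k G x - G x))); last first.
    by apply/funext => x; rewrite convB//; ring.
  by apply: norm1B; apply: measurable_funB => //; exact: measurable_conv.
- exact: cvg_cst.
- by rewrite -[X in _ --> X](adde0 0%E); apply: cvgeD.
Qed.

End approximate_identity.

(** * Products of approximate identities *)

Ltac mpair := apply/measurable_fun_pairP; split; rewrite /comp/=;
  first [exact: measurable_fst | exact: measurable_snd
  | exact: (measurableT_comp measurable_fst measurable_fst)
  | exact: (measurableT_comp measurable_snd measurable_fst)
  | exact: (measurableT_comp measurable_fst measurable_snd)
  | exact: (measurableT_comp measurable_snd measurable_snd)].

Section fiberwise.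
Context d d' (S : measurableType d) (T : measurableType d') (R : realType).
Variable n : {sigma_finite_measure set S -> \bar R}.
Variable m : {sigma_finite_measure set T -> \bar R}.
Variable K : nat -> T -> T -> R.
Hypothesis mK : markov_kernel m K.

Lemma measurable_fiber_conv k (F : S * T -> R) : measurable_fun setT F ->
  measurable_fun setT (fun z : S * T => kconv m K k (fun y => F (z.1, y)) z.2).
Proof.
move=> mF; have [mk _ _ _] := mK k.
apply: (measurable_Rintegral1 m (F := fun w : (S * T) * T => K k w.1.2 w.2 * F (w.1.1, w.2))).
apply: measurable_funM.
  apply: (measurableT_comp (f := fun z : T * T => K k z.1 z.2) mk (g := fun w : (S * T) * T => (w.1.2, w.2))).
  mpair.
apply: (measurableT_comp (f := F) mF (g := fun w : (S * T) * T => (w.1.1, w.2))).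
mpair.
Qed.

(** Dominated convergence on the space of fibers: each fiber converges, and its
error is at most twice its norm, which is integrable. *)
Lemma cvg_fiber_approximates (F : S * T -> R) :
  (forall G, m.-integrable setT (EFin \o G) -> approximates m K G) ->
  (prod_measure n m).-integrable setT (EFin \o F) ->
  (\int[n]_s norm1 m (fun x => kconv m K k (fun y => F (s, y)) x - F (s, x))%R)%E
    @[k --> \oo] --> (0 : \bar R)%E.
Proof.
move=> AK iF; have mF := integrable_measurable iF.
have mFs s : measurable_fun setT (fun y => F (s, y)).
  exact: measurableT_comp mF (measurable_pair1 s).
pose a k s := norm1 m (fun x => kconv m K k (fun y => F (s, y)) x - F (s, x)).
have ma k : measurable_fun setT (a k).
  apply: (measurable_fun_fubini_tonelli_F
    (fun z : S * T => `|kconv m K k (fun y => F (z.1, y)) z.2 - F (z.1, z.2)|%:E)) => //.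
  apply: (measurable_normE (f := fun z : S * T => kconv m K k (fun y => F (z.1, y)) z.2 - F (z.1, z.2))).
  apply: measurable_funB; first exact: measurable_fiber_conv.
  by rewrite (_ : (fun x => F _) = F)//; apply/funext => -[].
pose g s := (2%:E * norm1 m (fun y => F (s, y)))%E.
have mg0 : measurable_fun setT (fun s => norm1 m (fun y => F (s, y))).
  apply: (measurable_fun_fubini_tonelli_F (fun z : S * T => `|F z|%:E)) => //.
  exact: measurable_normE.
have ig : n.-integrable setT g.
  apply: integrableZl => //.
  apply/integrableP; split => //.
  have /integrableP[_] := iF; rewrite [in X in X -> _]fubini_tonelli1//.
    apply: le_lt_trans; rewrite le_eqVlt; apply/orP; left; apply/eqP.
    by apply: eq_integral => s _; rewrite gee0_abs// norm1_ge0.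
  exact: measurable_normE.
have a0 : {ae n, forall s, setT s -> a k s @[k --> \oo] --> (0 : \bar R)%E}.
  have := ae_integrable1 iF; apply: filterS => s sF _.
  exact: AK.
have ag : {ae n, forall s k, setT s -> (`|a k s| <= g s)%E}.
  apply: aeW => s k _; rewrite gee0_abs ?norm1_ge0//.
  apply: le_trans (norm1B m (measurable_conv mK k (mFs s)) (mFs s)) _.
  by rewrite /g mule_natl mule2n leeD2r//; exact: norm1_conv.
have [_ _] := @dominated_convergence _ _ _ n setT measurableT a (cst (0 : \bar R)%E) g ma
  (measurable_cst _) a0 ig ag.
by rewrite integral0.
Qed.

End fiberwise.

Section product_kernel.
Context d1 d2 (T1 : measurableType d1) (T2 : measurableType d2) (R : realType).
Variable m1 : {sigma_finite_measure set T1 -> \bar R}.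
Variable m2 : {sigma_finite_measure set T2 -> \bar R}.
Variables (K1 : nat -> T1 -> T1 -> R) (K2 : nat -> T2 -> T2 -> R).
Hypotheses (mK1 : markov_kernel m1 K1) (mK2 : markov_kernel m2 K2).

Definition prod_kernel k (x y : T1 * T2) : R := K1 k x.1 y.1 * K2 k x.2 y.2.

Let m := prod_measure m1 m2.

Lemma markov_prod_kernel : markov_kernel m prod_kernel.
Proof.
move=> k; have [mk1 p1 [B1 b1] i1] := mK1 k; have [mk2 p2 [B2 b2] i2] := mK2 k.
have mk : measurable_fun setT (fun z : (T1 * T2) * (T1 * T2) => prod_kernel k z.1 z.2).
  apply: measurable_funM.
    apply: (measurableT_comp (f := fun z : T1 * T1 => K1 k z.1 z.2) mk1 (g := fun z : (T1 * T2) * (T1 * T2) => (z.1.1, z.2.1))).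
    mpair.
  apply: (measurableT_comp (f := fun z : T2 * T2 => K2 k z.1 z.2) mk2 (g := fun z : (T1 * T2) * (T1 * T2) => (z.1.2, z.2.2))).
  mpair.
split => //.
- by move=> x y; rewrite mulr_ge0.
- by exists (B1 * B2) => x y; rewrite ler_pM.
- move=> y; rewrite [LHS]fubini_tonelli1.
  + rewrite -(i1 y.1); apply: eq_integral => x1 _; rewrite /fubini_F /prod_kernel/=.
    under eq_integral do rewrite EFinM.
    rewrite ge0_integralZl// ?lee_fin// ?i2 ?mule1//.
      apply/measurable_EFinP; exact: (measurableT_comp mk2 (measurable_pair2 y.2)).
    by move=> x2 _; rewrite lee_fin.
  + apply/measurable_EFinP; exact: (measurableT_comp mk (measurable_pair2 y)).
  + by move=> x; rewrite lee_fin mulr_ge0.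
Qed.

Hypothesis AK1 : forall G, m1.-integrable setT (EFin \o G) -> approximates m1 K1 G.
Hypothesis AK2 : forall G, m2.-integrable setT (EFin \o G) -> approximates m2 K2 G.

Lemma measurable_swapped (F : T1 * T2 -> R) : measurable_fun setT F ->
  measurable_fun setT (fun z : T2 * T1 => F (z.2, z.1)).
Proof.
move=> mF; apply: (measurableT_comp (f := F) mF (g := fun z : T2 * T1 => (z.2, z.1))).
mpair.
Qed.

Lemma integrable_swapped (F : T1 * T2 -> R) : m.-integrable setT (EFin \o F) ->
  (prod_measure m2 m1).-integrable setT (EFin \o (fun z : T2 * T1 => F (z.2, z.1))).
Proof.
move=> iF; have mF := integrable_measurable iF.
apply/(integrable12ltyP m2 m1).
  by apply/measurable_EFinP; exact: measurable_swapped.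
by apply/(integrable21ltyP m1 m2 (f := EFin \o F)) => //; exact/measurable_EFinP.
Qed.

Lemma norm1_prod (F : T1 * T2 -> R) : measurable_fun setT F ->
  (norm1 m F = \int[m1]_x norm1 m2 (fun y => F (x, y)))%E.
Proof.
move=> mF; rewrite /norm1 [LHS]fubini_tonelli1//.
exact: measurable_normE.
Qed.

Lemma norm1_prod2 (F : T1 * T2 -> R) : measurable_fun setT F ->
  (norm1 m F = \int[m2]_y norm1 m1 (fun x => F (x, y)))%E.
Proof.
move=> mF; rewrite /norm1 [LHS]fubini_tonelli2//.
exact: measurable_normE.
Qed.

(** Write [K1 K2 F - F = K1 (K2 F - F) + (K1 F - F)] and use that [K1] is a
contraction of L1. *)
Lemma norm1_prod_conv_le k (F : T1 * T2 -> R) : m.-integrable setT (EFin \o F) ->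
  (norm1 m (fun x => kconv m prod_kernel k F x - F x)%R <=
   \int[m1]_y norm1 m2 (fun x => kconv m2 K2 k (fun z => F (y, z)) x - F (y, x))%R +
   \int[m2]_y norm1 m1 (fun x => kconv m1 K1 k (fun z => F (z, y)) x - F (x, y))%R)%E.
Proof.
move=> iF; have mF := integrable_measurable iF.
have [mk1 p1 [B1 b1] i1] := mK1 k; have [mk2 p2 [B2 b2] i2] := mK2 k.
pose C1 (x : T1 * T2) := kconv m1 K1 k (fun z => F (z, x.2)) x.1.
pose C2 (x : T1 * T2) := kconv m2 K2 k (fun z => F (x.1, z)) x.2.
have mC2 : measurable_fun setT C2 by exact: (measurable_fiber_conv mK2 k mF).
have mC1 : measurable_fun setT C1.
  have := measurable_fiber_conv mK1 k (measurable_swapped mF).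
  move=> H; apply: (measurableT_comp H (g := fun x : T1 * T2 => (x.2, x.1))).
  mpair.
have mC : measurable_fun setT (kconv m prod_kernel k F).
  exact: (measurable_conv markov_prod_kernel).
pose P x := kconv m prod_kernel k F x - C1 x.
have mP : measurable_fun setT P by exact: measurable_funB.
pose Q x := C1 x - F x.
have mQ : measurable_fun setT Q by exact: measurable_funB.
pose W x := C2 x - F x.
have mW : measurable_fun setT W by exact: measurable_funB.
(* [P = K1 (K2 F - F)] almost everywhere and [Q = K1 F - F]. *)
rewrite (_ : (fun x => kconv m prod_kernel k F x - F x) = (fun x => P x + Q x)); last first.
  by apply/funext => x; rewrite /P /Q; ring.
apply: le_trans (norm1D m mP mQ) _; apply: leeD; last first.
  by rewrite norm1_prod2.
rewrite -[leRHS](norm1_prod mW) norm1_prod2// [leRHS]norm1_prod2//.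
apply: ae_ge0_le_integral => //.
- by move=> y _; exact: norm1_ge0.
- apply: (measurable_fun_fubini_tonelli_G (fun z => `|P z|%:E)) => //.
  exact: measurable_normE.
- by move=> y _; exact: norm1_ge0.
- apply: (measurable_fun_fubini_tonelli_G (fun z => `|W z|%:E)) => //.
  exact: measurable_normE.
have := ae_integrable2 iF; apply: filterS => x2 iFx2 _.
rewrite (_ : (fun x1 => P (x1, x2)) = kconv m1 K1 k (fun y1 => W (y1, x2))).
  by apply: norm1_conv => //; exact: (measurableT_comp mW (measurable_pair2 x2)).
apply/funext => x1.
have iK2F : m.-integrable setT (EFin \o (fun y : T1 * T2 => K2 k x2 y.2 * F y)).
  have := integrableZl measurableT B2 iF; apply: le_integrable => //.
    apply/measurable_EFinP; apply: measurable_funM => //.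
    apply: (measurableT_comp (f := K2 k x2)) => //.
    exact: (measurableT_comp mk2 (measurable_pair1 x2)).
  move=> y _ /=; rewrite lee_fin !normrM ler_wpM2r//.
  by rewrite (ger0_norm (p2 _ _)) (le_trans (b2 _ _))// ler_norm.
have iC2 : m1.-integrable setT (EFin \o (fun y1 => C2 (y1, x2))).
  exact: (integrable_Rintegral1 iK2F).
have iKF : m.-integrable setT (EFin \o (fun y => prod_kernel k (x1, x2) y * F y)).
  exact: (integrable_kernelM markov_prod_kernel).
rewrite /P /W convB//= -/(C1 (x1, x2)); congr (_ - _).
rewrite /kconv Rintegral_prod1// /Rintegral; congr fine.
apply: ae_eq_integral => //.
- apply/measurable_EFinP; exact: (measurable_Rintegral1 m2 (integrable_measurable iKF)).
- apply/measurable_EFinP; apply: measurable_funM.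
    exact: (measurableT_comp mk1 (measurable_pair1 x1)).
  exact: integrable_measurable iC2.
have := ae_integrable1 iF; apply: filterS => y1 iFy1 _.
congr (_%:E); rewrite /C2 /kconv -RintegralZl//; last exact: (integrable_kernelM mK2).
by apply: eq_Rintegral => y2 _; rewrite /prod_kernel/= mulrA.
Qed.

Lemma approximates_prod (F : T1 * T2 -> R) :
  m.-integrable setT (EFin \o F) -> approximates m prod_kernel F.
Proof.
move=> iF.
have c1 := cvg_fiber_approximates mK2 AK2 iF.
have c2 := cvg_fiber_approximates mK1 AK1 (integrable_swapped iF).
apply: (@squeeze_cvge _ _ _ _ (cst (0 : \bar R)%E) _ (fun k =>
   \int[m1]_y norm1 m2 (fun x => kconv m2 K2 k (fun z => F (y, z)) x - F (y, x))%R +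
   \int[m2]_y norm1 m1 (fun x => kconv m1 K1 k (fun z => F (z, y)) x - F (x, y))%R)%E).
- by apply: nearW => k; rewrite norm1_ge0/=; exact: norm1_prod_conv_le.
- exact: cvg_cst.
- by rewrite -[X in _ --> X](adde0 0%E); apply: cvgeD.
Qed.

End product_kernel.

(** * The Gaussian approximate identity on the line *)

Section gauss_approximates.
Context (R : realType).
Local Notation leb1 := (@lebR R).
Local Notation mu := (@lebesgue_measure R).

Definition bandwidth (k : nat) : R := k.+1%:R^-1.

Lemma bandwidth_gt0 k : 0 < bandwidth k.
Proof. by rewrite invr_gt0. Qed.

Definition gauss1 (h x y : R) : R := gauss h (x - y).

Lemma measurable_gauss1 h : measurable_fun setT (fun z : R * R => gauss1 h z.1 z.2).
Proof.
apply: (measurableT_comp (measurable_gauss h)).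
by apply: measurable_funB.
Qed.

Lemma gauss1C h x y : gauss1 h x y = gauss1 h y x.
Proof. by rewrite /gauss1 -opprB gaussN. Qed.

Lemma markov_gauss1 (hs : nat -> R) : (forall k, 0 < hs k) ->
  markov_kernel leb1 (fun k => gauss1 (hs k)).
Proof.
move=> h0 k; split.
- exact: measurable_gauss1.
- by move=> x y; rewrite ltW// gauss_gt0.
- by exists (Num.sqrt (2 * pi) * hs k)^-1 => x y; exact: gauss_ub.
- by move=> y; exact: integral_gauss.
Qed.

Lemma integral_gauss1 h x : 0 < h -> (\int[leb1]_y (gauss1 h x y)%:E = 1)%E.
Proof.
move=> h0; rewrite -[RHS](integral_gauss x h0); apply: eq_integral => y _.
by rewrite gauss1C.
Qed.

Lemma Rintegral_gauss1 h x : 0 < h -> \int[leb1]_y gauss1 h x y = 1.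
Proof. by move=> h0; rewrite /Rintegral integral_gauss1. Qed.

Lemma integrable_gauss1 h x : 0 < h -> leb1.-integrable setT (EFin \o gauss1 h x).
Proof.
move=> h0; apply: integrable_EFin_lty.
  exact: (measurableT_comp (measurable_gauss1 h) (measurable_pair1 x)).
under eq_integral do rewrite ger0_norm ?(ltW (gauss_gt0 _ h0))//.
by rewrite [ltLHS](integral_gauss1 x h0) ltry.
Qed.

(** Continuity at [x] and boundedness give
[|u x - u y| <= e / 2 + c |x - y|], and the first absolute moment of the Gaussian
is of the order of the bandwidth. *)
Lemma kconv_gauss_cvg (u : R -> R) (B x : R) : measurable_fun setT u ->
  (forall y, `|u y| <= B) -> {for x, continuous u} ->
  kconv leb1 (fun k => gauss1 (bandwidth k)) k u x @[k --> \oo] --> u x.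
Proof.
move=> mu_ uB cu; have B0 : 0 <= B by apply: le_trans (uB 0).
apply/cvgrPdist_le => e e0.
have e2 : 0 < e / 2 by rewrite divr_gt0.
have /cvgrPdist_le/(_ _ e2) := cu.
rewrite -filter_from_ballE => -[eta /= eta0 etaP].
have bnd y : `|u x - u y| <= e / 2 + 2 * B / eta * `|x - y|.
  have [xy|xy] := ltP `|x - y| eta.
    apply: (le_trans (etaP y xy)); rewrite lerDl.
    by rewrite mulr_ge0// divr_ge0// ?mulr_ge0// ltW.
  apply: (@le_trans _ _ (2 * B)).
    apply: le_trans (ler_normB _ _) _.
    by have := uB x; have := uB y; lra.
  apply: ler_wpDl; first exact: ltW.
  rewrite -mulrA ler_peMr ?mulr_ge0//.
  by rewrite mulrC ler_pdivlMr// mul1r.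
have s2 : 0 < Num.sqrt 2 :> R by rewrite sqrtr_gt0.
have bndk k : `|u x - kconv leb1 (fun k => gauss1 (bandwidth k)) k u x| <=
    e / 2 + 2 * B / eta * Num.sqrt 2 * bandwidth k.
  have h0 := bandwidth_gt0 k; have hs : 0 < Num.sqrt 2 * bandwidth k by rewrite mulr_gt0.
  set h := bandwidth k in h0 hs *.
  have mg : measurable_fun setT (gauss1 h x).
    exact: (measurableT_comp (measurable_gauss1 h) (measurable_pair1 x)).
  have ig := integrable_gauss1 x h0.
  have ig2 := integrable_gauss1 x hs.
  have iw (w : R -> R) : measurable_fun setT w -> (forall y, `|w y| <= B) ->
      leb1.-integrable setT (EFin \o (fun y => gauss1 h x y * w y)).
    move=> mw wB; have := integrableZl measurableT B ig; apply: le_integrable => //.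
      by apply/measurable_EFinP; apply: measurable_funM.
    move=> y _ /=; rewrite lee_fin !normrM [leRHS]mulrC ler_wpM2l//.
    by rewrite (le_trans (wB y))// ler_norm.
  have ix : leb1.-integrable setT (EFin \o (fun y => gauss1 h x y * u x)).
    by apply: iw => //; exact: measurable_cst.
  have -> : u x = \int[leb1]_y (gauss1 h x y * u x).
    by rewrite RintegralZr// /Rintegral (integral_gauss1 x h0)/= mul1r.
  rewrite /kconv -RintegralB//; last exact: iw.
  have iD : leb1.-integrable setT (EFin \o (fun y => gauss1 h x y * u x - gauss1 h x y * u y)).
    by have := integrableB measurableT ix (iw _ mu_ uB); apply: eq_integrable.
  apply: le_trans (le_normr_Rintegral measurableT iD) _.
  set c := 2 * B / eta.
  have c0 : 0 <= c by rewrite divr_ge0// ?mulr_ge0// ltW.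
  have iR : leb1.-integrable setT (EFin \o (fun y => e / 2 * gauss1 h x y +
      c * h * Num.sqrt 2 * gauss1 (Num.sqrt 2 * h) x y)).
    have := integrableD measurableT (integrableZl measurableT (e / 2) ig)
      (integrableZl measurableT (c * h * Num.sqrt 2) ig2).
    by apply: eq_integrable.
  apply: le_trans (le_Rintegral measurableT _ iR _) _.
  - by have := integrable_norm iD; apply: eq_integrable.
  - move=> y _; rewrite -mulrBr normrM (ger0_norm (ltW (gauss_gt0 _ h0))).
    apply: (@le_trans _ _ (gauss1 h x y * (e / 2 + c * `|x - y|))).
      by apply: ler_wpM2l; [rewrite ltW// gauss_gt0|exact: bnd].
    have := norm_id_gauss_le h0 (x - y); rewrite -/(gauss1 h x y) -/(gauss1 _ x y) => H.
    rewrite mulrDr [_ * (e / 2)]mulrC lerD2l.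
    rewrite (_ : gauss1 h x y * _ = c * (`|x - y| * gauss1 h x y)); last by ring.
    rewrite [leRHS](_ : _ = c * (h * Num.sqrt 2 * gauss1 (Num.sqrt 2 * h) x y)).
      by apply: ler_wpM2l.
    by ring.
  - rewrite RintegralD//; last 2 first.
    + by have := integrableZl measurableT (e / 2) ig; apply: eq_integrable.
    + by have := integrableZl measurableT (c * h * Num.sqrt 2) ig2; apply: eq_integrable.
    rewrite (RintegralZl (e / 2) measurableT ig) (RintegralZl _ measurableT ig2).
    rewrite !Rintegral_gauss1// !mulr1.
    by rewrite lerD2l -!mulrA [h * _]mulrC.
have H : \forall k \near \oo, `|0 - 2 * B / eta * Num.sqrt 2 * bandwidth k| <= e / 2.
  have : 2 * B / eta * Num.sqrt 2 * bandwidth k @[k --> \oo] --> (0 : R).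
    rewrite -[X in _ --> X](mulr0 (2 * B / eta * Num.sqrt 2)).
    by apply: cvgM; [exact: cvg_cst|exact: cvg_harmonic].
  by move=> /cvgrPdist_le/(_ _ e2).
near=> k.
apply: le_trans (bndk k) _.
rewrite [leRHS](splitr e) lerD2l.
apply: le_trans (ler_norm _) _; rewrite -normrN -sub0r.
by near: k; exact: H.
Unshelve. all: by end_near. Qed.

Let I (N : nat) := `[- N%:R, N%:R]%classic : set R.

Let measurable_I N : measurable (I N).
Proof. exact: measurable_itv. Qed.

Let continuous_patch (g : R -> R) N x : continuous g -> x != N%:R -> x != - N%:R ->
  {for x, continuous (g \_ (I N))}.
Proof.
move=> cg xN xN'.
have [x_lt|x_gt] := ltP `|x| N%:R.
  have nI : \forall y \near x, y \in I N.
    have : \forall y \near x, y \in `]- N%:R, N%:R[.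
      by apply: near_in_itvoo; rewrite in_itv/= -ltr_norml.
    apply: filterS => y; rewrite inE /I/= !in_itv/= => /andP[? ?].
    by rewrite !ltW.
  rewrite /prop_for /continuous_at patchE (nbhs_singleton nI).
  apply: cvg_trans (cg x); apply: near_eq_cvg.
  by apply: filterS nI => y yI; rewrite patchE yI.
have {}x_gt : N%:R < `|x|.
  rewrite lt_neqAle x_gt andbT eq_sym; apply/negP; rewrite eqr_norml => /andP[].
  by rewrite (negbTE xN) (negbTE xN').
have nI : \forall y \near x, y \notin I N.
  have : \forall y \near x, N%:R < `|y|.
    have := @norm_continuous _ _ x; rewrite /continuous_at => /cvgr_gt.
    exact.
  apply: filterS => y Ny; apply/negP; rewrite inE /I/= in_itv/= -ler_norml.
  by rewrite leNgt Ny.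
rewrite /prop_for /continuous_at patchE (negbTE (nbhs_singleton nI)).
apply: cvg_near_cst; apply: filterS nI => y yI.
by rewrite patchE (negbTE yI).
Qed.

Let K k := gauss1 (bandwidth k).

Let approximates_patch (g : R -> R) N : continuous g -> (forall x, 0 <= g x) ->
  leb1.-integrable setT (EFin \o (g \_ (I N))) -> approximates leb1 K (g \_ (I N)).
Proof.
move=> cg g0 ig.
have p0 x : 0 <= (g \_ (I N)) x by rewrite patchE; case: ifP.
apply: approximates_ge0 => //; first exact: (markov_gauss1 bandwidth_gt0).
have [c _ cmax] : exists2 c, c \in `[- N%:R, N%:R] & forall t, t \in `[- N%:R, N%:R] -> g t <= g c.
  apply: EVT_max; first by rewrite -subr_ge0 opprK addr_ge0.
  exact: continuous_subspaceT.
have pB x : `|(g \_ (I N)) x| <= g c.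
  by rewrite ger0_norm// patchE; case: ifPn => // /set_mem /cmax.
have mN : leb1.-negligible ([set N%:R] `|` [set - N%:R]).
  apply: negligibleU; apply/negligibleP => //.
    by rewrite /lebR [LHS]lebesgue_measure_set1.
  by rewrite /lebR [LHS]lebesgue_measure_set1.
apply: negligibleS mN => x /= nc; apply: contra_notP nc => /not_orP[xN xN'].
apply: (kconv_gauss_cvg (B := g c)) => //; first exact: integrable_measurable ig.
by apply: continuous_patch => //; exact/eqP.
Qed.

(** By density it suffices to treat a continuous function cut off to a segment,
and by linearity one that is nonnegative. The smoothed functions then converge
pointwise except at the two ends of the segment. *)
Lemma approximates_gauss1 F : leb1.-integrable setT (EFin \o F) -> approximates leb1 K F.
Proof.
move=> iF; have mF := integrable_measurable iF.
apply: (approximates_closed (markov_gauss1 bandwidth_gt0) iF) => e e0.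
have e2 : 0 < e / 2 by rewrite divr_gt0.
have e4 : 0 < e / 4 by rewrite divr_gt0.
have mp N (f : R -> R) : measurable_fun setT f -> measurable_fun setT (f \_ (I N)).
  by move=> mf; apply/(measurable_restrictT f (measurable_I N)); exact: (measurable_funS measurableT _ mf).
have ip N : leb1.-integrable setT (EFin \o (F \_ (I N))).
  apply: le_integrable iF => //; first by apply/measurable_EFinP; exact: mp.
  by move=> x _ /=; rewrite lee_fin patchE; case: ifP => //; rewrite normr0.
(* The cut-off to a large segment is close to [F]. *)
have [N FN] : exists N, (norm1 leb1 (fun x => F x - (F \_ (I N)) x)%R < (e / 2)%:E)%E.
  have f_f : {ae leb1, forall x, setT x ->
      `|F x - (F \_ (I N)) x|%:E @[N --> \oo] --> (0 : \bar R)%E}.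
    apply: aeW => x _; apply: cvg_near_cst.
    exists (Num.trunc `|x|).+1 => //= N /= xN.
    have xI : x \in I N.
      rewrite inE /I/= in_itv/= -ler_norml; apply: ltW.
      by apply: lt_le_trans (truncnS_gt _) _; rewrite ler_nat.
    by rewrite patchE xI subrr normr0.
  have f_g : {ae leb1, forall x N, setT x -> (abse (`|F x - (F \_ (I N)) x|%R)%:E <= `|F x|%:E)%E}.
    apply: aeW => x N _; rewrite lee_fin normr_id patchE.
    by case: ifP => _; rewrite ?subrr ?normr0 ?subr0.
  have [_ _] := @dominated_convergence _ _ _ leb1 setT measurableT
    (fun N x => `|F x - (F \_ (I N)) x|%:E) (cst (0 : \bar R)%E) (fun x => `|F x|%:E)
    (fun N => measurable_normE (measurable_funB mF (mp N _ mF))) (measurable_cst _) f_f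
    (integrable_norm iF) f_g.
  rewrite integral0 => /cvge0P H.
  have [N _ HN] := H (fun N => norm1_ge0 _ _) _ e4.
  exists N; apply: le_lt_trans (HN N (leqnn N)) _.
  by rewrite lte_fin; lra.
(* On that segment, a continuous function [g] is close to [F]. *)
have iFN : mu.-integrable (I N) (EFin \o F).
  have /integrable_lebR := ip N; rewrite (_ : EFin \o _ = (EFin \o F) \_ (I N)).
    by move=> H; apply/(@integrable_mkcond _ (measurableTypeR R) R mu (I N) _ (measurable_I N)).
  by apply/funext => x; rewrite /= !patchE; case: ifP.
have muI : (mu (I N) < +oo)%E.
  by rewrite /I lebesgue_measure_itv/=; case: ifP => // _; rewrite -EFinB ltry.
have [g_ [cg_ ig_ /cvge0P Hg]] := approximation_continuous_integrable (measurable_I N) muI iFN.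
have [n _ Hn] := Hg (fun k => integral_ge0 _ (fun x _ => abse_ge0 _)) _ e4.
set g := g_ n; have cg := cg_ n.
have {}Hn := Hn n (leqnn n).
have mg : measurable_fun setT g by exact: continuous_measurable_fun.
have igp : leb1.-integrable setT (EFin \o (g \_ (I N))).
  apply/integrable_lebR; rewrite (_ : EFin \o _ = (EFin \o g) \_ (I N)).
    by apply/(@integrable_mkcond _ (measurableTypeR R) R mu (I N) _ (measurable_I N)); exact: ig_.
  by apply/funext => x; rewrite /= !patchE; case: ifP.
exists (g \_ (I N)); split => //.
  apply: (@le_lt_trans _ _ (norm1 leb1 (fun x => F x - (F \_ (I N)) x)%R +
     norm1 leb1 (fun x => (F \_ (I N)) x - (g \_ (I N)) x)%R)%E).
    rewrite (_ : (fun x => F x - (g \_ (I N)) x) =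
      (fun x => (F x - (F \_ (I N)) x) + ((F \_ (I N)) x - (g \_ (I N)) x))); last first.
      by apply/funext => x; ring.
    by apply: norm1D; apply: measurable_funB => //; exact: mp.
  rewrite [in ltRHS](splitr e) EFinD; apply: lteD => //.
  apply: (@le_lt_trans _ _ (e / 4)%:E); last by rewrite lte_fin; lra.
  apply: le_trans Hn; rewrite /norm1 integral_lebR; last first.
    by apply: measurable_normE; apply: measurable_funB; exact: mp.
  rewrite [leRHS]integral_mkcond le_eqVlt; apply/orP; left; apply/eqP.
  apply: eq_integral => x _; rewrite !patchE; case: ifP => // _.
  by rewrite subrr normr0.
pose gp x := Num.max (g x) 0; pose gn x := Num.max (- g x) 0.
have gE x : g x = gp x - gn x.
  by rewrite /gp /gn; case: (leP (g x) 0) => h; rewrite ?(max_l _ _)//; case: leP => h'; lra.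
have cgp : continuous gp.
  by move=> x; apply: (@continuous_max _ _ g (cst 0)); [exact: cg|exact: cvg_cst].
have cgn : continuous gn.
  by move=> x; apply: (@continuous_max _ _ (fun x => - g x) (cst 0)); [apply: cvgN; exact: cg|exact: cvg_cst].
have igp' (w : R -> R) : continuous w -> (forall x, `|w x| <= `|g x|) ->
   leb1.-integrable setT (EFin \o (w \_ (I N))).
  move=> cw wg; apply: le_integrable igp => //.
    by apply/measurable_EFinP; apply: mp; exact: continuous_measurable_fun.
  by move=> x _ /=; rewrite lee_fin !patchE; case: ifP.
have gp0 x : 0 <= gp x by rewrite /gp le_max lexx orbT.
have gn0 x : 0 <= gn x by rewrite /gn le_max lexx orbT.
have igP : leb1.-integrable setT (EFin \o (gp \_ (I N))).
  by apply: igp' => // x; rewrite ger0_norm// /gp ge_max ler_norm normr_ge0.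
have igN : leb1.-integrable setT (EFin \o (gn \_ (I N))).
  by apply: igp' => // x; rewrite ger0_norm// /gn ge_max -normrN ler_norm normr_ge0.
rewrite (_ : g \_ (I N) = (fun x => (gp \_ (I N)) x - (gn \_ (I N)) x)).
  by apply: (approximatesB (markov_gauss1 bandwidth_gt0)) => //; exact: approximates_patch.
by apply/funext => x; rewrite !patchE; case: ifP => // _; rewrite subrr.
Qed.

End gauss_approximates.

(** * Gaussian kernels on tuples *)

Section odd_integral.
Context (R : realType).
Local Notation leb1 := (@lebR R).
Local Notation mu := (@lebesgue_measure R).

Lemma lebR_opp (A : set R) : measurable A -> leb1 (-%R @^-1` A) = leb1 A.
Proof. by move=> mA; exact: (@lebesgue_measureN R A mA). Qed.

Lemma Rintegral_odd (f : R -> R) : leb1.-integrable setT (EFin \o f) ->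
  (forall x, f (- x) = - f x) -> \int[leb1]_x f x = 0.
Proof.
move=> intf fN; have mf := integrable_measurable intf.
pose o (x : R) : R := - x.
have mo : measurable_fun setT o by exact: oppr_measurable.
pose opp : {mfun R >-> R} := HB.pack o (isMeasurableFun.Build _ _ R R o mo).
have intfN : leb1.-integrable (o @^-1` setT) ((EFin \o f) \o o).
  rewrite preimage_setT; have := integrableN intf.
  by apply: eq_integrable => // x _ /=; rewrite fN.
have mfE : measurable_fun setT (EFin \o f) by exact/measurable_EFinP.
have H : (\int[leb1]_x (f x)%:E = \int[leb1]_x (f (- x))%:E)%E.
  rewrite -(integral_pushforward mo mfE intfN measurableT).
  apply: (@eq_measure_integral _ _ _ _ (pushforward leb1 opp) leb1) => A mA _.
  by rewrite [RHS]lebR_opp.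
have : \int[leb1]_x f x = \int[leb1]_x f (- x) by rewrite /Rintegral H.
under [X in _ = X -> _]eq_Rintegral do rewrite fN -mulN1r.
rewrite RintegralZl// mulN1r => /eqP.
by rewrite -subr_eq0 opprK -mulr2n mulrn_eq0/= => /eqP.
Qed.

End odd_integral.

Lemma ge0_integral_tupleS d (T : measurableType d) (R : realType)
    (m : {sigma_finite_measure set T -> \bar R}) n (F : n.+1.-tuple T -> \bar R) :
  measurable_fun setT F -> (forall t, 0 <= F t)%E ->
  (\int[tuple_measure m n.+1]_t F t =
   \int[m]_x \int[tuple_measure m n]_t F (tuple_cons (x, t)))%E.
Proof.
move=> mF F0; rewrite ge0_integral_tuple_step// [LHS]fubini_tonelli1//.
by apply: measurableT_comp => //; exact: measurable_tuple_cons.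
Qed.

Section tuple_gauss.
Context (R : realType).
Local Notation leb1 := (@lebR R).
Local Notation leb := (@leb R).

Definition gk d (h : R) (x y : d.-tuple R) : R := gauss_kernel (fun=> h) x y.

Lemma gkE d h (x y : d.-tuple R) : gk h x y = \prod_(i < d) gauss1 h (tnth x i) (tnth y i).
Proof. by []. Qed.

Lemma gk_cons d h x y (t u : d.-tuple R) :
  gk h (tuple_cons (x, t)) (tuple_cons (y, u)) = gauss1 h x y * gk h t u.
Proof.
rewrite !gkE big_ord_recl; congr (_ * _).
by apply: eq_bigr => i _; rewrite !tnthS.
Qed.

Lemma gk_gt0 d h (x y : d.-tuple R) : 0 < h -> 0 < gk h x y.
Proof. by move=> h0; rewrite gkE; apply: prodr_gt0 => i _; exact: gauss_gt0. Qed.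

Lemma gk_le d h (x y : d.-tuple R) : 0 < h -> gk h x y <= (Num.sqrt (2 * pi) * h)^-1 ^+ d.
Proof.
move=> h0; rewrite gkE -[d in leRHS]card_ord -prodr_const.
by apply: ler_prod => i _; rewrite ltW ?gauss_gt0//=; exact: gauss_ub.
Qed.

Lemma measurable_gk d h :
  measurable_fun setT (fun z : d.-tuple R * d.-tuple R => gk h z.1 z.2).
Proof.
under eq_fun do rewrite gkE.
apply: measurable_prod => i _.
apply: (measurableT_comp (f := fun z : R * R => gauss1 h z.1 z.2) (@measurable_gauss1 R h)
  (g := fun z : d.-tuple R * d.-tuple R => (tnth z.1 i, tnth z.2 i))).
apply/measurable_fun_pairP; split.
  exact: (measurableT_comp (measurable_tnth i) measurable_fst).
exact: (measurableT_comp (measurable_tnth i) measurable_snd).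
Qed.

Lemma measurable_gk1 d h x : measurable_fun setT (@gk d h x).
Proof. exact: (measurableT_comp (@measurable_gk d h) (measurable_pair1 x)). Qed.

Lemma gkC d h (x y : d.-tuple R) : gk h x y = gk h y x.
Proof. exact: gauss_kernelC. Qed.

Lemma tuple_consP d (t : d.+1.-tuple R) : exists x u, t = tuple_cons (x, u).
Proof. by exists (thead t), [tuple of behead t]; rewrite {1}(tuple_eta t). Qed.

(** Completing the square: the product of the two Gaussians is a Gaussian in [w]
centred at the midpoint. *)
Lemma gk_semigroup1 h x y : 0 < h ->
  (\int[leb1]_w (gauss1 h x w * gauss1 h w y)%:E = (gauss1 (Num.sqrt 2 * h) x y)%:E)%E.
Proof.
move=> h0; have s2 : 0 < Num.sqrt 2 :> R by rewrite sqrtr_gt0.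
have ss : Num.sqrt 2 ^+ 2 = 2 :> R by rewrite sqr_sqrtr.
have p0 := sqrt2pi_gt0 R.
have h' : 0 < h / Num.sqrt 2 by rewrite divr_gt0.
rewrite (eq_integral (fun w => ((gauss1 (Num.sqrt 2 * h) x y)%:E * (gauss1 (h / Num.sqrt 2) ((x + y) / 2) w)%:E)%E)); last first.
  move=> w _; rewrite -EFinM; congr (_%:E).
  rewrite /gauss1 /gauss.
  rewrite mulrACA -expRD [RHS]mulrACA -expRD; congr (_ * expR _).
    by field; rewrite !gt_eqF.
  rewrite !exprMn exprVn ss; field.
  by rewrite gt_eqF.
rewrite ge0_integralZl ?(integral_gauss1 _ h') ?mule1//.
- apply/measurable_EFinP.
  exact: (measurableT_comp (measurable_gauss1 _) (measurable_pair1 _)).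
- by move=> w _; rewrite lee_fin ltW// gauss_gt0.
- by rewrite lee_fin ltW// gauss_gt0// mulr_gt0.
Qed.

Lemma gk_semigroup d h (x y : d.-tuple R) : 0 < h ->
  (\int[leb d]_w (gk h x w * gk h w y)%:E = (gk (Num.sqrt 2 * h) x y)%:E)%E.
Proof.
move=> h0; elim: d x y => [|d ih] x y.
  rewrite /leb /= integral_dirac//.
    by rewrite diracT mul1e !gkE !big_ord0 mulr1.
  apply/measurable_EFinP; apply: measurable_funM; first exact: measurable_gk1.
  by under eq_fun do rewrite gkC; exact: measurable_gk1.
have [x0 [t ->]] := tuple_consP x; have [y0 [u ->]] := tuple_consP y.
rewrite /leb ge0_integral_tupleS; last 2 first.
- apply/measurable_EFinP; apply: measurable_funM; first exact: measurable_gk1.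
  by under eq_fun do rewrite gkC; exact: measurable_gk1.
- by move=> w; rewrite lee_fin mulr_ge0// ltW// gk_gt0.
rewrite gk_cons EFinM -(gk_semigroup1 x0 y0 h0) -ge0_integralZr//; last 3 first.
- apply/measurable_EFinP; apply: measurable_funM.
    exact: (measurableT_comp (measurable_gauss1 _) (measurable_pair1 _)).
  exact: (measurableT_comp (measurable_gauss1 _) (measurable_pair2 _)).
- by move=> w _; rewrite lee_fin mulr_ge0// ltW// gauss_gt0.
- by rewrite lee_fin ltW// gk_gt0// mulr_gt0// sqrtr_gt0.
apply: eq_integral => w0 _; rewrite -ih.
under eq_integral => w _ do rewrite !gk_cons mulrACA EFinM.
rewrite ge0_integralZl//.
- apply/measurable_EFinP; apply: measurable_funM; first exact: measurable_gk1.
  by under eq_fun do rewrite gkC; exact: measurable_gk1.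
- by move=> w _; rewrite lee_fin mulr_ge0// ltW// gk_gt0.
- by rewrite lee_fin mulr_ge0// ltW// gauss_gt0.
Qed.

End tuple_gauss.

Section tuple_approximates.
Context d (T : measurableType d) (R : realType).
Variable m : {sigma_finite_measure set T -> \bar R}.
Variable n : nat.
Variable K1 : nat -> T -> T -> R.
Variable K2 : nat -> n.-tuple T -> n.-tuple T -> R.
Variable K : nat -> n.+1.-tuple T -> n.+1.-tuple T -> R.
Hypothesis KE : forall k x y t u,
  K k (tuple_cons (x, t)) (tuple_cons (y, u)) = K1 k x y * K2 k t u.
Hypothesis mK1 : markov_kernel m K1.
Hypothesis mK2 : markov_kernel (tuple_measure m n) K2.

Let uncons (t : n.+1.-tuple T) : T * n.-tuple T := (thead t, [tuple of behead t]).

Let unconsK t : tuple_cons (uncons t) = t.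
Proof. by rewrite [RHS]tuple_eta; exact: val_inj. Qed.

Let measurable_uncons : measurable_fun setT uncons.
Proof. exact: measurable_tuple_uncons. Qed.

Let KE' k x y : K k x y = prod_kernel K1 K2 k (uncons x) (uncons y).
Proof. by rewrite -{1}(unconsK x) -{1}(unconsK y) KE. Qed.

Lemma markov_tuple_kernel : markov_kernel (tuple_measure m n.+1) K.
Proof.
move=> k; have [mk p0 [B kB] i1] := markov_prod_kernel mK1 mK2 k.
have mk' : measurable_fun setT (fun z : n.+1.-tuple T * n.+1.-tuple T => K k z.1 z.2).
  under eq_fun do rewrite KE'.
  apply: (measurableT_comp (f := fun z => prod_kernel K1 K2 k z.1 z.2) mk
     (g := fun z : n.+1.-tuple T * n.+1.-tuple T => (uncons z.1, uncons z.2))).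
  apply/measurable_fun_pairP; split.
    exact: (measurableT_comp measurable_uncons measurable_fst).
  exact: (measurableT_comp measurable_uncons measurable_snd).
split => //.
- by move=> x y; rewrite KE'.
- by exists B => x y; rewrite KE'.
- move=> y; rewrite ge0_integral_tuple_step; last 2 first.
  + by apply/measurable_EFinP; exact: (measurableT_comp mk' (measurable_pair2 y)).
  + by move=> x; rewrite lee_fin KE'.
  rewrite -[RHS](i1 (uncons y)); apply: eq_integral => -[x t] _.
  by rewrite -{1}(unconsK y) KE.
Qed.

Hypothesis AK1 : forall G, m.-integrable setT (EFin \o G) -> approximates m K1 G.
Hypothesis AK2 : forall G, (tuple_measure m n).-integrable setT (EFin \o G) ->
  approximates (tuple_measure m n) K2 G.

(** The transfer of [approximates_prod] along the identification of
[n.+1.-tuple T] with [T * n.-tuple T]. *)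
Lemma approximates_tuple F : (tuple_measure m n.+1).-integrable setT (EFin \o F) ->
  approximates (tuple_measure m n.+1) K F.
Proof.
move=> iF; have mF := integrable_measurable iF.
have := approximates_prod mK1 mK2 AK1 AK2 (F := F \o @tuple_cons _ T n) (integrable_tuple_cons iF).
move=> H; rewrite /approximates; apply: cvg_trans H; apply: near_eq_cvg; apply: nearW => k.
rewrite /norm1 [RHS]ge0_integral_tuple_step//; last first.
  apply: measurable_normE; apply: measurable_funB => //.
  exact: (measurable_conv markov_tuple_kernel k mF).
apply: eq_integral => z _; congr (`|_ - _|%:E); congr fine.
rewrite integral_tuple_step; last first.
  apply/measurable_EFinP; apply: measurable_funM => //.
  exact: (measurable_kernel1 markov_tuple_kernel).
by apply: eq_integral => -[y u] _; case: z => x t; rewrite KE.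
Qed.

End tuple_approximates.

(** * Characteristic function of the Gaussian on tuples *)

Section tuple_gauss_kernels.
Context (R : realType).
Local Notation leb1 := (@lebR R).
Local Notation leb := (@leb R).

Lemma markov_gk d (hs : nat -> R) : (forall k, 0 < hs k) ->
  markov_kernel (leb d) (fun k => @gk R d (hs k)).
Proof.
move=> h0; elim: d => [|d ih].
  move=> k; split.
  - exact: measurable_gk.
  - by move=> x y; rewrite ltW// gk_gt0.
  - by exists ((Num.sqrt (2 * pi) * hs k)^-1 ^+ 0) => x y; exact: gk_le.
  - move=> y; rewrite /leb/= integral_dirac//.
      by rewrite diracT mul1e gkE big_ord0.
    by apply/measurable_EFinP; under eq_fun do rewrite gkC; exact: measurable_gk1.
apply: (markov_tuple_kernel (K1 := fun k => gauss1 (hs k)) (K2 := fun k => @gk R d (hs k))) => //.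
- by move=> k x y t u; exact: gk_cons.
- exact: markov_gauss1.
Qed.

Lemma approximates_gk d F : (leb d).-integrable setT (EFin \o F) ->
  approximates (leb d) (fun k => @gk R d (bandwidth R k)) F.
Proof.
have h0 := bandwidth_gt0 R.
elim: d F => [|d ih] F iF.
  have mF := integrable_measurable iF.
  rewrite /approximates (_ : (fun k => _) = cst (0 : \bar R)%E); first exact: cvg_cst.
  apply/funext => k; rewrite /norm1 /leb /= integral_dirac//; last first.
    apply: measurable_normE; apply: measurable_funB => //.
    exact: (measurable_conv (markov_gk 0 h0) k mF).
  rewrite diracT mul1e /kconv (Rintegral_tuple0 leb1).
    by rewrite gkE big_ord0 mul1r subrr normr0.
  by apply: measurable_funM => //; exact: measurable_gk1.
apply: (approximates_tuple (K1 := fun k => gauss1 (bandwidth R k)) (K2 := fun k => @gk R d (bandwidth R k))) => //.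
- by move=> k x y t u; exact: gk_cons.
- exact: (markov_gauss1 h0).
- exact: markov_gk.
- exact: approximates_gauss1.
Qed.

Definition dot d (t u : d.-tuple R) : R := \sum_(i < d) tnth t i * tnth u i.

Lemma dot_cons d x y (t u : d.-tuple R) :
  dot (tuple_cons (x, t)) (tuple_cons (y, u)) = x * y + dot t u.
Proof.
rewrite /dot big_ord_recl; congr (_ + _).
by apply: eq_bigr => i _; rewrite !tnthS.
Qed.

Lemma measurable_dot d : measurable_fun setT (fun z : d.-tuple R * d.-tuple R => dot z.1 z.2).
Proof.
apply: measurable_sum => i; apply: measurable_funM.
  exact: (measurableT_comp (measurable_tnth i) measurable_fst).
exact: (measurableT_comp (measurable_tnth i) measurable_snd).
Qed.

Lemma measurable_dot1 d (t : d.-tuple R) : measurable_fun setT (dot t).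
Proof. exact: (measurableT_comp (@measurable_dot d) (measurable_pair1 t)). Qed.

Lemma measurable_cos : measurable_fun setT (@cos R).
Proof. exact: continuous_measurable_fun (@continuous_cos R). Qed.

Lemma measurable_sin : measurable_fun setT (@sin R).
Proof. exact: continuous_measurable_fun (@continuous_sin R). Qed.

(** The density of the centred Gaussian vector with independent components of
standard deviation [s]. *)
Definition weight d (s : R) (u : d.-tuple R) : R := \prod_(i < d) gauss s (tnth u i).

Lemma weight_cons d s x (u : d.-tuple R) : weight s (tuple_cons (x, u)) = gauss s x * weight s u.
Proof.
rewrite /weight big_ord_recl; congr (_ * _).
by apply: eq_bigr => i _; rewrite tnthS.
Qed.

Lemma weight_gk d s (u : d.-tuple R) : weight s u = gk s u [tuple of nseq d 0].
Proof.
rewrite /weight gkE; apply: eq_bigr => i _.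
by rewrite /gauss1 (tnth_nth 0 (nseq_tuple d 0)) nth_nseq ltn_ord subr0.
Qed.

Lemma measurable_weight d s : measurable_fun setT (@weight d s).
Proof.
rewrite (_ : @weight d s = @gk R d s [tuple of nseq d 0]); first exact: measurable_gk1.
by apply/funext => u; rewrite weight_gk gkC.
Qed.

Lemma weight_ge0 d s (u : d.-tuple R) : 0 < s -> 0 <= weight s u.
Proof. by move=> s0; rewrite weight_gk ltW// gk_gt0. Qed.

Lemma integrable_weight d s : 0 < s -> (leb d).-integrable setT (EFin \o @weight d s).
Proof.
move=> s0; apply: integrable_EFin_lty; first exact: measurable_weight.
under eq_integral do rewrite ger0_norm ?weight_ge0// weight_gk.
have [_ _ _ ->] := @markov_gk d (fun=> s) (fun=> s0) 0.
by rewrite ltry.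
Qed.

Lemma integrable_weightM d s (w : d.-tuple R -> R) : 0 < s -> measurable_fun setT w ->
  (forall u, `|w u| <= 1) -> (leb d).-integrable setT (EFin \o (fun u => weight s u * w u)).
Proof.
move=> s0 mw w1; apply: le_integrable (integrable_weight d s0) => //.
  by apply/measurable_EFinP; apply: measurable_funM => //; exact: measurable_weight.
move=> u _; rewrite /= lee_fin normrM.
by rewrite ler_piMr.
Qed.

Lemma charfun_gauss1 s t : 0 < s ->
  \int[leb1]_u (gauss s u * cos (t * u)) = expR (- (s ^+ 2 * t ^+ 2 / 2)).
Proof.
move=> s0; rewrite Rintegral_lebR ?charfun_gauss//.
by apply: measurable_funM; [exact: measurable_gauss|exact: measurable_cosM].
Qed.

Lemma sinfun_gauss1 s t : 0 < s -> \int[leb1]_u (gauss s u * sin (t * u)) = 0.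
Proof.
move=> s0; apply: Rintegral_odd.
  apply/integrable_lebR; apply: integrable_gaussM => //; first exact: measurable_sinM.
  by move=> u; exact: sin_max.
by move=> u; rewrite gaussN mulrN sinN mulrN.
Qed.

(** The cosine and sine transforms are treated together because the addition
formulas mix them in the induction on the dimension. *)
Lemma charfun_weight d s (t : d.-tuple R) : 0 < s ->
  \int[leb d]_u (weight s u * cos (dot t u)) = expR (- (s ^+ 2 * dot t t / 2)) /\
  \int[leb d]_u (weight s u * sin (dot t u)) = 0.
Proof.
move=> s0.
have icos k (v : k.-tuple R) : (leb k).-integrable setT (EFin \o (fun u => weight s u * cos (dot v u))).
  apply: integrable_weightM => //; last by move=> u; exact: cos_max.
  exact: (measurableT_comp measurable_cos (measurable_dot1 v)).
have isin k (v : k.-tuple R) : (leb k).-integrable setT (EFin \o (fun u => weight s u * sin (dot v u))).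
  apply: integrable_weightM => //; last by move=> u; exact: sin_max.
  exact: (measurableT_comp measurable_sin (measurable_dot1 v)).
have i1c x : leb1.-integrable setT (EFin \o (fun u => gauss s u * cos (x * u))).
  apply/integrable_lebR; apply: integrable_gaussM => //; first exact: measurable_cosM.
  by move=> u; exact: cos_max.
have i1s x : leb1.-integrable setT (EFin \o (fun u => gauss s u * sin (x * u))).
  apply/integrable_lebR; apply: integrable_gaussM => //; first exact: measurable_sinM.
  by move=> u; exact: sin_max.
elim: d t => [|d ih] t.
  split; rewrite /leb Rintegral_tuple0.
  - by rewrite /weight /dot !big_ord0 mulr0 mul0r oppr0 cos0 expR0 mul1r.
  - exact: integrable_measurable (icos _ _).
  - by rewrite /weight /dot !big_ord0 sin0 mulr0.
  - exact: integrable_measurable (isin _ _).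
have [x [v ->]] := tuple_consP t.
have [Cv Sv] := ih v.
split.
- rewrite /leb (Rintegral_tupleS (icos _ _)).
  transitivity (\int[leb1]_y (gauss s y * cos (x * y) * expR (- (s ^+ 2 * dot v v / 2)))).
    apply: eq_Rintegral => y _.
    transitivity (\int[leb d]_u (gauss s y * cos (x * y) * (weight s u * cos (dot v u)) -
         gauss s y * sin (x * y) * (weight s u * sin (dot v u)))).
      by apply: eq_Rintegral => u _; rewrite weight_cons dot_cons cosD; ring.
    rewrite RintegralB//; last 2 first.
    + by have := integrableZl measurableT (gauss s y * cos (x * y)) (icos _ v); apply: eq_integrable.
    + by have := integrableZl measurableT (gauss s y * sin (x * y)) (isin _ v); apply: eq_integrable.
    rewrite (RintegralZl _ measurableT (icos _ v)) (RintegralZl _ measurableT (isin _ v)).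
    by rewrite Cv Sv mulr0 subr0.
  rewrite (RintegralZr _ measurableT (i1c x)) charfun_gauss1// -expRD dot_cons.
  by congr expR; field.
- rewrite /leb (Rintegral_tupleS (isin _ _)).
  transitivity (\int[leb1]_y (gauss s y * sin (x * y) * expR (- (s ^+ 2 * dot v v / 2)))).
    apply: eq_Rintegral => y _.
    transitivity (\int[leb d]_u (gauss s y * sin (x * y) * (weight s u * cos (dot v u)) +
         gauss s y * cos (x * y) * (weight s u * sin (dot v u)))).
      by apply: eq_Rintegral => u _; rewrite weight_cons dot_cons sinD; ring.
    rewrite RintegralD//; last 2 first.
    + by have := integrableZl measurableT (gauss s y * sin (x * y)) (icos _ v); apply: eq_integrable.
    + by have := integrableZl measurableT (gauss s y * cos (x * y)) (isin _ v); apply: eq_integrable.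
    rewrite (RintegralZl _ measurableT (icos _ v)) (RintegralZl _ measurableT (isin _ v)).
    by rewrite Cv Sv mulr0 addr0.
  by rewrite (RintegralZr _ measurableT (i1s x)) sinfun_gauss1// mul0r.
Qed.

End tuple_gauss_kernels.

(** * The Gaussian kernel on R^p x R^q *)

(** The form in which Fubini's theorem is applied to Fourier integrals and to
bounded kernels. *)
Lemma integrable_prod_bounded d1 d2 (T1 : measurableType d1) (T2 : measurableType d2)
    (R : realType) (m1 : {sigma_finite_measure set T1 -> \bar R})
    (m2 : {sigma_finite_measure set T2 -> \bar R})
    (f : T1 -> R) (g : T2 -> R) (b : T1 * T2 -> R) (B : R) :
  m1.-integrable setT (EFin \o f) -> m2.-integrable setT (EFin \o g) ->
  measurable_fun setT b -> (forall z, `|b z| <= B) ->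
  (prod_measure m1 m2).-integrable setT (EFin \o (fun z => f z.1 * g z.2 * b z)).
Proof.
move=> iF iG mb bB.
have mf := integrable_measurable iF; have mg := integrable_measurable iG.
have mfg : measurable_fun setT (fun z : T1 * T2 => f z.1 * g z.2).
  apply: measurable_funM; first exact: (measurableT_comp mf measurable_fst).
  exact: (measurableT_comp mg measurable_snd).
have iFG : (prod_measure m1 m2).-integrable setT (EFin \o (fun z => f z.1 * g z.2)).
  apply/(integrable12ltyP m1 m2); first exact/measurable_EFinP.
  rewrite (_ : (\int[m1]_x \int[m2]_y _)%E = (\int[m1]_x (`|f x|%:E * \int[m2]_y `|g y|%:E))%E); last first.
    apply: eq_integral => x _; rewrite -ge0_integralZl//; last exact: measurable_normE.
    by apply: eq_integral => y _ /=; rewrite normrM EFinM.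
  have gfin : (\int[m2]_y `|g y|%:E)%E \is a fin_num.
    by have := integrable_norm iG; exact: integrable_fin_num.
  rewrite -(fineK gfin) ge0_integralZr//; last 2 first.
  - exact: measurable_normE.
  - by rewrite lee_fin fine_ge0// integral_ge0// => y _; rewrite lee_fin.
  rewrite lte_mul_pinfty//.
  - by apply: integral_ge0 => x _; rewrite lee_fin.
  - by have := integrable_norm iF; exact: integrable_fin_num.
  - by rewrite ltry.
have := integrableZl measurableT B iFG; apply: le_integrable => //.
  by apply/measurable_EFinP; exact: measurable_funM.
move=> z _ /=; rewrite lee_fin normrM [leRHS]normrM mulrC ler_wpM2r//.
by rewrite (le_trans (bB z))// ler_norm.
Qed.

Section space.
Context (R : realType) (p q : nat).
Notation E := (p.-tuple R * q.-tuple R)%type.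
Local Notation m := (leb2 R p q).

Definition GE (h : R) (z z' : E) : R := gk h z.1 z'.1 * gk h z.2 z'.2.

Lemma markov_GE h : 0 < h -> markov_kernel m (fun=> GE h).
Proof.
move=> h0; exact: (markov_prod_kernel (K1 := fun=> @gk R p h) (K2 := fun=> @gk R q h)
  (markov_gk p (fun=> h0)) (markov_gk q (fun=> h0))).
Qed.

Lemma GE_gt0 h z z' : 0 < h -> 0 < GE h z z'.
Proof. by move=> h0; rewrite mulr_gt0 ?gk_gt0. Qed.

Lemma GEC h z z' : GE h z z' = GE h z' z.
Proof. by rewrite /GE gkC [gk h z.2 _]gkC. Qed.

Lemma measurable_GE h : measurable_fun setT (fun z : E * E => GE h z.1 z.2).
Proof.
apply: measurable_funM.
  apply: (measurableT_comp (f := fun z => gk h z.1 z.2) (@measurable_gk R p h)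
    (g := fun z : E * E => (z.1.1, z.2.1))); mpair.
apply: (measurableT_comp (f := fun z => gk h z.1 z.2) (@measurable_gk R q h)
  (g := fun z : E * E => (z.1.2, z.2.2))); mpair.
Qed.

Lemma measurable_GE1 h z : measurable_fun setT (GE h z).
Proof. exact: (measurableT_comp (measurable_GE h) (measurable_pair1 z)). Qed.

Lemma integral_GE h z : 0 < h -> (\int[m]_z' (GE h z z')%:E = 1)%E.
Proof.
move=> h0; have [_ _ _ i1] := markov_GE h0 0%N.
by rewrite -[RHS](i1 z); apply: eq_integral => z' _; rewrite GEC.
Qed.

Lemma integrable_GE h z : 0 < h -> m.-integrable setT (EFin \o GE h z).
Proof.
move=> h0; apply: integrable_EFin_lty; first exact: measurable_GE1.
under eq_integral do rewrite ger0_norm ?(ltW (GE_gt0 _ _ h0))//.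
by rewrite [ltLHS](integral_GE z h0) ltry.
Qed.

(** The peak of the Gaussian density in dimension [d]. *)
Definition kap d (h : R) := (Num.sqrt (2 * pi) * h)^-1 ^+ d.

Lemma kap_gt0 d h : 0 < h -> 0 < kap d h.
Proof. by move=> h0; rewrite exprn_gt0// invr_gt0 mulr_gt0// sqrt2pi_gt0. Qed.

Lemma GE_le h z z' : 0 < h -> GE h z z' <= kap p h * kap q h.
Proof. by move=> h0; rewrite ler_pM ?gk_le// ltW// gk_gt0. Qed.

Lemma GE_semigroup h z z' : 0 < h ->
  \int[m]_w (GE h z w * GE h w z') = GE (Num.sqrt 2 * h) z z'.
Proof.
move=> h0; rewrite /Rintegral; have s2 : 0 < Num.sqrt 2 :> R by rewrite sqrtr_gt0.
have g0 d (x y : d.-tuple R) : 0 <= gk h x y by rewrite ltW// gk_gt0.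
have mgg d (x y : d.-tuple R) : measurable_fun setT (fun w => (gk h x w * gk h w y)%:E).
  apply/measurable_EFinP; apply: measurable_funM; first exact: measurable_gk1.
  by under eq_fun do rewrite gkC; exact: measurable_gk1.
rewrite -[RHS]/(fine (GE (Num.sqrt 2 * h) z z')%:E); congr fine.
rewrite [LHS]fubini_tonelli1; last 2 first.
- apply/measurable_EFinP; apply: measurable_funM; first exact: measurable_GE1.
  by under eq_fun do rewrite GEC; exact: measurable_GE1.
- by move=> w; rewrite lee_fin mulr_ge0// ltW// GE_gt0.
rewrite /GE EFinM -!gk_semigroup// -ge0_integralZr//; first last.
- by apply: integral_ge0 => w _; rewrite lee_fin mulr_ge0.
- by move=> w _; rewrite lee_fin mulr_ge0.
- exact: mgg.
apply: eq_integral => w1 _; rewrite /fubini_F /=.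
under eq_integral => w _ do rewrite mulrACA EFinM.
rewrite ge0_integralZl//.
- exact: mgg.
- by move=> w _; rewrite lee_fin mulr_ge0.
- by rewrite lee_fin mulr_ge0.
Qed.

Definition tuple_diff d (x y : d.-tuple R) : d.-tuple R := [tuple tnth x i - tnth y i | i < d].

Lemma dot_tuple_diff d (x y u : d.-tuple R) : dot (tuple_diff x y) u = dot x u - dot y u.
Proof.
rewrite /dot -sumrB; apply: eq_bigr => i _.
by rewrite tnth_mktuple mulrBl.
Qed.

Lemma gk_expR d h (x y : d.-tuple R) : 0 < h ->
  gk h x y = kap d h * expR (- (h^-1 ^+ 2 * dot (tuple_diff x y) (tuple_diff x y) / 2)).
Proof.
move=> h0; rewrite gkE /gauss1 /gauss big_split/= prodr_const card_ord; congr (_ * _).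
rewrite -expR_sum; congr expR; rewrite /dot mulr_sumr mulr_suml -sumrN.
by apply: eq_bigr => i _; rewrite tnth_mktuple; field; rewrite gt_eqF.
Qed.

Lemma weight_expR d h (u : d.-tuple R) : 0 < h ->
  weight h^-1 u = kap d h^-1 * expR (- (h ^+ 2 * dot u u / 2)).
Proof.
move=> h0; rewrite /weight /gauss big_split/= prodr_const card_ord; congr (_ * _).
rewrite -expR_sum; congr expR; rewrite /dot mulr_sumr mulr_suml -sumrN.
by apply: eq_bigr => i _; field; rewrite gt_eqF.
Qed.

Lemma innerE (x u : E) : inner x u = dot x.1 u.1 + dot x.2 u.2.
Proof. by []. Qed.

Lemma inner_ge0 (u : E) : 0 <= inner u u.
Proof. by rewrite addr_ge0//; apply: sumr_ge0 => i _; rewrite -expr2 sqr_ge0. Qed.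

Lemma measurable_inner : measurable_fun setT (fun z : E * E => inner z.1 z.2).
Proof.
apply: measurable_funD.
  apply: (measurableT_comp (f := fun z => dot z.1 z.2) (@measurable_dot R p)
    (g := fun z : E * E => (z.1.1, z.2.1))); mpair.
apply: (measurableT_comp (f := fun z => dot z.1 z.2) (@measurable_dot R q)
  (g := fun z : E * E => (z.1.2, z.2.2))); mpair.
Qed.

Lemma measurable_inner1 x : measurable_fun setT (inner x : E -> R).
Proof. exact: (measurableT_comp measurable_inner (measurable_pair1 x)). Qed.

(** Up to normalisation, the Gaussian density of standard deviation [h^-1]. *)
Definition damp (h : R) (u : E) : R := expR (- (h ^+ 2 * inner u u / 2)).

Let wE (s : R) (u : E) : R := weight s u.1 * weight s u.2.

Let wE_damp h u : 0 < h -> wE h^-1 u = kap p h^-1 * kap q h^-1 * damp h u.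
Proof.
move=> h0; rewrite /wE !weight_expR// mulrACA -expRD; congr (_ * expR _).
by rewrite innerE; field.
Qed.

Let integrable_wE s : 0 < s -> m.-integrable setT (EFin \o wE s).
Proof.
move=> s0; have norm1_le1 (z : E) : `|1 : R| <= 1 by rewrite normr1.
have := @integrable_prod_bounded _ _ _ _ _ (@leb R p) (@leb R q) (@weight R p s) (@weight R q s)
  (fun=> 1) 1 (integrable_weight p s0) (integrable_weight q s0) (measurable_cst _).
move=> /(_ norm1_le1) H.
by apply: eq_integrable H => // u _ /=; rewrite mulr1.
Qed.

Lemma measurable_damp h : measurable_fun setT (damp h).
Proof.
apply: measurableT_comp; first exact: measurable_expR.
apply: measurableT_comp => //; apply: measurable_funM => //.
apply: measurable_funM => //.
apply: (measurableT_comp (f := fun z : E * E => inner z.1 z.2) measurable_inner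
  (g := fun u => (u, u))).
by apply/measurable_fun_pairP; split; exact: measurable_id.
Qed.

Lemma damp_gt0 h u : 0 < damp h u. Proof. exact: expR_gt0. Qed.

Lemma integrable_damp h : 0 < h -> m.-integrable setT (EFin \o damp h).
Proof.
move=> h0; have hV : 0 < h^-1 by rewrite invr_gt0.
have c0 : 0 < kap p h^-1 * kap q h^-1 by rewrite mulr_gt0// kap_gt0.
have := integrableZl measurableT (kap p h^-1 * kap q h^-1)^-1 (integrable_wE hV).
apply: eq_integrable => // u _ /=; rewrite -EFinM; congr (_%:E).
by rewrite wE_damp// mulKf// gt_eqF.
Qed.

(** The Gaussian kernel of bandwidth [h] is, up to normalisation, the
characteristic function of a Gaussian of standard deviation [h^-1] evaluated at
[z - z']. *)
Lemma GE_fourier h (z z' : E) : 0 < h ->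
  GE h z z' = (2 * pi)^-1 ^+ (p + q) *
    \int[m]_u (damp h u * cos (inner z u - inner z' u)).
Proof.
move=> h0; have hV : 0 < h^-1 by rewrite invr_gt0.
have p0 := sqrt2pi_gt0 R.
have c0 d : 0 < kap d h^-1 by rewrite kap_gt0.
have kk d : kap d h = (2 * pi)^-1 ^+ d * (kap d h^-1)^-1.
  rewrite /kap -exprVn -exprMn; congr (_ ^+ _).
  have -> : (2 * pi)^-1 = (Num.sqrt (2 * pi))^-1 * (Num.sqrt (2 * pi))^-1 :> R.
    by rewrite -invfM -expr2 sqr_sqrtr// mulr_ge0// pi_ge0.
  by field; rewrite !gt_eqF.
set dz1 := tuple_diff z.1 z'.1; set dz2 := tuple_diff z.2 z'.2.
have [C1 S1] := charfun_weight dz1 hV.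
have [C2 S2] := charfun_weight dz2 hV.
have icos d (v : d.-tuple R) : (@leb R d).-integrable setT (EFin \o (fun u => weight h^-1 u * cos (dot v u))).
  apply: integrable_weightM => //; last by move=> u; exact: cos_max.
  exact: (measurableT_comp (@measurable_cos R) (measurable_dot1 v)).
have isin d (v : d.-tuple R) : (@leb R d).-integrable setT (EFin \o (fun u => weight h^-1 u * sin (dot v u))).
  apply: integrable_weightM => //; last by move=> u; exact: sin_max.
  exact: (measurableT_comp (@measurable_sin R) (measurable_dot1 v)).
have mc : measurable_fun setT (fun u : E => cos (inner z u - inner z' u)).
  apply: (measurableT_comp (@measurable_cos R)).
  by apply: measurable_funB; exact: measurable_inner1.
have H : \int[m]_u (wE h^-1 u * cos (inner z u - inner z' u)) =
    expR (- (h^-1 ^+ 2 * dot dz1 dz1 / 2)) * expR (- (h^-1 ^+ 2 * dot dz2 dz2 / 2)).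
  rewrite Rintegral_prod1; last first.
    apply: (@integrable_prod_bounded _ _ _ _ _ (@leb R p) (@leb R q) _ _ _ 1 (integrable_weight p hV) (integrable_weight q hV) mc).
    by move=> u; exact: cos_max.
  transitivity (\int[leb R p]_u (weight h^-1 u * cos (dot dz1 u) * expR (- (h^-1 ^+ 2 * dot dz2 dz2 / 2)))).
    apply: eq_Rintegral => u _.
    transitivity (\int[leb R q]_v (weight h^-1 u * cos (dot dz1 u) * (weight h^-1 v * cos (dot dz2 v))
       - weight h^-1 u * sin (dot dz1 u) * (weight h^-1 v * sin (dot dz2 v)))).
      apply: eq_Rintegral => v _; rewrite !innerE/= /wE/=.
      rewrite [dot z.1 u + _ - _](_ : _ = dot dz1 u + dot dz2 v); last first.
        by rewrite !dot_tuple_diff; ring.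
      by rewrite cosD; ring.
    rewrite RintegralB//; last 2 first.
    + by have := integrableZl measurableT (weight h^-1 u * cos (dot dz1 u)) (icos _ dz2); apply: eq_integrable.
    + by have := integrableZl measurableT (weight h^-1 u * sin (dot dz1 u)) (isin _ dz2); apply: eq_integrable.
    rewrite (RintegralZl _ measurableT (icos _ dz2)) (RintegralZl _ measurableT (isin _ dz2)).
    by rewrite C2 S2 mulr0 subr0.
  by rewrite (RintegralZr _ measurableT (icos _ dz1)) C1.
rewrite /GE !gk_expR// mulrACA -/dz1 -/dz2 -H.
have iD : m.-integrable setT (EFin \o (fun u => damp h u * cos (inner z u - inner z' u))).
  apply: le_integrable (integrable_damp h0) => //.
    by apply/measurable_EFinP; apply: measurable_funM => //; exact: measurable_damp.
  move=> u _; rewrite /= lee_fin normrM ler_piMr//; exact: cos_max.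
rewrite (_ : \int[m]_u _ = \int[m]_u (kap p h^-1 * kap q h^-1 * (damp h u * cos (inner z u - inner z' u)))).
  rewrite (RintegralZl _ measurableT iD) mulrA; congr (_ * _).
  by rewrite !kk exprD; field; rewrite !gt_eqF.
by apply: eq_Rintegral => u _; rewrite wE_damp// mulrA.
Qed.

End space.

(** * The smoothed L2 norm in Fourier variables *)

Section quadratic_form.
Context (R : realType) (p q : nat).
Notation E := (p.-tuple R * q.-tuple R)%type.
Local Notation m := (leb2 R p q).
Variable psi : E -> R.
Hypothesis ipsi : m.-integrable setT (EFin \o psi).

Let mpsi : measurable_fun setT psi. Proof. exact: integrable_measurable ipsi. Qed.

Definition smooth (h : R) (z : E) : R := \int[m]_z' (GE h z z' * psi z').
(** The mean of HSIC when [psi] is the dependence function. *)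
Definition quad (h : R) : R := \int[m]_z (psi z * smooth h z).
Definition fcos (u : E) : R := \int[m]_x (psi x * cos (inner x u)).
Definition fsin (u : E) : R := \int[m]_x (psi x * sin (inner x u)).
(** The squared modulus of the Fourier transform of [psi]. *)
Definition fpow (u : E) : R := fcos u ^+ 2 + fsin u ^+ 2.

Let c : R := (2 * pi)^-1 ^+ (p + q).

Let mcos : measurable_fun setT (fun z : E * E => cos (inner z.1 z.2)).
Proof. exact: (measurableT_comp (@measurable_cos R) (@measurable_inner R p q)). Qed.
Let msin : measurable_fun setT (fun z : E * E => sin (inner z.1 z.2)).
Proof. exact: (measurableT_comp (@measurable_sin R) (@measurable_inner R p q)). Qed.

Let mpsi1 : measurable_fun setT (fun z : E * E => psi z.1).
Proof. exact: (measurableT_comp mpsi measurable_fst). Qed.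
Lemma measurable_fcos : measurable_fun setT fcos.
Proof.
apply: (measurable_Rintegral2 m (F := fun z : E * E => psi z.1 * cos (inner z.1 z.2))).
exact: measurable_funM.
Qed.

Lemma measurable_fsin : measurable_fun setT fsin.
Proof.
apply: (measurable_Rintegral2 m (F := fun z : E * E => psi z.1 * sin (inner z.1 z.2))).
exact: measurable_funM.
Qed.

Lemma measurable_fpow : measurable_fun setT fpow.
Proof.
by apply: measurable_funD; apply: measurable_funX;
  [exact: measurable_fcos|exact: measurable_fsin].
Qed.

Lemma fpow_ge0 u : 0 <= fpow u. Proof. by rewrite addr_ge0// sqr_ge0. Qed.

Let B1 : R := \int[m]_x `|psi x|.

Let integrable_bounded (w : E -> R) : measurable_fun setT w -> (forall u, `|w u| <= 1) ->
  m.-integrable setT (EFin \o (fun x => psi x * w x)).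
Proof.
move=> mw w1; apply: le_integrable ipsi => //.
  by apply/measurable_EFinP; exact: measurable_funM.
by move=> x _ /=; rewrite lee_fin normrM ler_piMr.
Qed.

Let bound_trig (w : E -> R) : measurable_fun setT w -> (forall u, `|w u| <= 1) ->
  `|\int[m]_x (psi x * w x)| <= B1.
Proof.
move=> mw w1; have iw := integrable_bounded mw w1.
apply: le_trans (le_normr_Rintegral measurableT iw) _.
apply: le_Rintegral => //.
- by have := integrable_norm iw; apply: eq_integrable.
- by have := integrable_norm ipsi; apply: eq_integrable.
- by move=> x _; rewrite normrM ler_piMr.
Qed.

Let mcos2 u : measurable_fun setT (fun x : E => cos (inner x u)).
Proof. exact: (measurableT_comp mcos (measurable_pair2 u)). Qed.
Let msin2 u : measurable_fun setT (fun x : E => sin (inner x u)).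
Proof. exact: (measurableT_comp msin (measurable_pair2 u)). Qed.

Lemma fcos_le u : `|fcos u| <= B1.
Proof. by apply: bound_trig => // x; exact: cos_max. Qed.
Lemma fsin_le u : `|fsin u| <= B1.
Proof. by apply: bound_trig => // x; exact: sin_max. Qed.

Let B1_ge0 : 0 <= B1. Proof. exact: Rintegral_ge0. Qed.

Lemma smooth_fourier h z : 0 < h ->
  smooth h z = c * \int[m]_u (damp h u * (cos (inner z u) * fcos u + sin (inner z u) * fsin u)).
Proof.
move=> h0.
have mb : measurable_fun setT (fun w : E * E => cos (inner z w.2 - inner w.1 w.2)).
  apply: (measurableT_comp (@measurable_cos R)); apply: measurable_funB.
    exact: (measurableT_comp (measurable_inner1 z) measurable_snd).
  exact: measurable_inner.
have iF := integrable_prod_bounded ipsi (integrable_damp p q h0) mb (fun w => cos_max _).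
have iFs u : m.-integrable setT (EFin \o (fun z' => psi z' * damp h u * cos (inner z u - inner z' u))).
  apply: le_integrable (integrableZl measurableT (damp h u) ipsi) => //.
    apply/measurable_EFinP; apply: measurable_funM.
      by apply: measurable_funM => //; exact: measurable_cst.
    exact: (measurableT_comp mb (measurable_pair2 u)).
  by move=> x _ /=; rewrite lee_fin [damp h u * _]mulrC normrM ler_piMr ?cos_max.
transitivity (c * \int[m]_z' \int[m]_u (psi z' * damp h u * cos (inner z u - inner z' u))).
  rewrite /smooth -RintegralZl//; last first.
    have := integrable_Rintegral1 iF; exact.
  apply: eq_Rintegral => z' _; rewrite GE_fourier// -/c -mulrA; congr (_ * _).
  rewrite -RintegralZr//.
    by apply: eq_Rintegral => u _; ring.
  apply: le_integrable (integrable_damp p q h0) => //.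
    apply/measurable_EFinP; apply: measurable_funM; first exact: measurable_damp.
    exact: (measurableT_comp mb (measurable_pair1 z')).
  by move=> u _; rewrite /= lee_fin normrM ler_piMr//; exact: cos_max.
congr (_ * _); rewrite (Rintegral_swap iF); apply: eq_Rintegral => u _ /=.
rewrite (_ : \int[m]_x _ = \int[m]_x (damp h u * cos (inner z u) * (psi x * cos (inner x u)) +
   damp h u * sin (inner z u) * (psi x * sin (inner x u)))); last first.
  by apply: eq_Rintegral => x _; rewrite cosB; ring.
have ic : m.-integrable setT (EFin \o (fun x => psi x * cos (inner x u))).
  by apply: integrable_bounded => // x; exact: cos_max.
have is_ : m.-integrable setT (EFin \o (fun x => psi x * sin (inner x u))).
  by apply: integrable_bounded => // x; exact: sin_max.
rewrite RintegralD//; last 2 first.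
- by have := integrableZl measurableT (damp h u * cos (inner z u)) ic; apply: eq_integrable.
- by have := integrableZl measurableT (damp h u * sin (inner z u)) is_; apply: eq_integrable.
rewrite (RintegralZl _ measurableT ic) (RintegralZl _ measurableT is_).
by rewrite -/(fcos u) -/(fsin u); ring.
Qed.

Lemma integrable_damp_fpow h : 0 < h -> m.-integrable setT (EFin \o (fun u => damp h u * fpow u)).
Proof.
move=> h0; apply: le_integrable (integrableZl measurableT (B1 ^+ 2 + B1 ^+ 2) (integrable_damp p q h0)) => //.
  apply/measurable_EFinP; apply: measurable_funM; first exact: measurable_damp.
  exact: measurable_fpow.
move=> u _ /=; rewrite lee_fin !ger0_norm ?mulr_ge0 ?fpow_ge0 ?addr_ge0 ?sqr_ge0 ?(ltW (damp_gt0 _ _))//.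
rewrite mulrC ler_wpM2r ?(ltW (damp_gt0 _ _))// /fpow.
by apply: lerD; rewrite -[leLHS]real_normK ?num_real// lerXn2r ?nnegrE// ?fcos_le ?fsin_le.
Qed.

(** The addition formula for the cosine turns [GE_fourier] into
[psi(z) psi(z') cos(z.u - z'.u) = Re (psi^ conj psi^)] after integration in [z]
and [z']. *)
Lemma quad_fourier h : 0 < h -> quad h = c * \int[m]_u (damp h u * fpow u).
Proof.
move=> h0.
pose b (w : E * E) := cos (inner w.1 w.2) * fcos w.2 + sin (inner w.1 w.2) * fsin w.2.
have mb : measurable_fun setT b.
  apply: measurable_funD; apply: measurable_funM => //.
    exact: (measurableT_comp measurable_fcos measurable_snd).
  exact: (measurableT_comp measurable_fsin measurable_snd).
have bB w : `|b w| <= B1 + B1.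
  apply: le_trans (ler_normD _ _) _; apply: lerD.
    by rewrite normrM -[leRHS]mul1r ler_pM// ?cos_max ?fcos_le.
  by rewrite normrM -[leRHS]mul1r ler_pM// ?sin_max ?fsin_le.
have iF := integrable_prod_bounded ipsi (integrable_damp p q h0) mb bB.
transitivity (c * \int[m]_z \int[m]_u (psi z * damp h u * b (z, u))).
  rewrite /quad -(RintegralZl c measurableT (integrable_Rintegral1 iF)).
  apply: eq_Rintegral => z _; rewrite smooth_fourier// mulrCA; congr (_ * _).
  rewrite -RintegralZl//.
    by apply: eq_Rintegral => u _; rewrite /b/= mulrA.
  apply: le_integrable (integrableZl measurableT (B1 + B1) (integrable_damp p q h0)) => //.
    apply/measurable_EFinP; apply: measurable_funM; first exact: measurable_damp.
    exact: (measurableT_comp mb (measurable_pair1 z)).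
  move=> u _ /=; rewrite lee_fin normrM [leRHS]normrM mulrC ler_wpM2r//.
  by rewrite (le_trans (bB (z, u)))// ler_norm.
congr (_ * _); rewrite (Rintegral_swap iF); apply: eq_Rintegral => u _ /=.
rewrite (_ : \int[m]_x _ = \int[m]_x (damp h u * fcos u * (psi x * cos (inner x u)) +
   damp h u * fsin u * (psi x * sin (inner x u)))); last first.
  by apply: eq_Rintegral => x _; rewrite /b/=; ring.
have ic : m.-integrable setT (EFin \o (fun x => psi x * cos (inner x u))).
  by apply: integrable_bounded => // x; exact: cos_max.
have is_ : m.-integrable setT (EFin \o (fun x => psi x * sin (inner x u))).
  by apply: integrable_bounded => // x; exact: sin_max.
rewrite RintegralD//; last 2 first.
- by have := integrableZl measurableT (damp h u * fcos u) ic; apply: eq_integrable.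
- by have := integrableZl measurableT (damp h u * fsin u) is_; apply: eq_integrable.
rewrite (RintegralZl _ measurableT ic) (RintegralZl _ measurableT is_).
by rewrite -/(fcos u) -/(fsin u) /fpow; ring.
Qed.

Let c_gt0 : 0 < c.
Proof. by rewrite exprn_gt0// invr_gt0 mulr_gt0// pi_gt0. Qed.

Lemma quad_ge0 h : 0 < h -> 0 <= quad h.
Proof.
move=> h0; rewrite quad_fourier// mulr_ge0 ?(ltW c_gt0)//.
by apply: Rintegral_ge0 => u _; rewrite mulr_ge0 ?fpow_ge0// ltW// damp_gt0.
Qed.

(** The damping factor decreases with the bandwidth. *)
Lemma quad_le h k : 0 < h -> h <= k -> quad k <= quad h.
Proof.
move=> h0 hk; have k0 : 0 < k by exact: lt_le_trans hk.
rewrite (quad_fourier h0) (quad_fourier k0) (ler_pM2l c_gt0); apply: le_Rintegral => //.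
- exact: integrable_damp_fpow.
- exact: integrable_damp_fpow.
move=> u _; rewrite ler_wpM2r ?fpow_ge0// ler_expR lerN2 ler_wpM2r//.
by rewrite ler_wpM2r ?inner_ge0// lerXn2r// nnegrE ltW.
Qed.

Lemma measurable_smooth h : 0 < h -> measurable_fun setT (smooth h).
Proof. by move=> h0; exact: (measurable_conv (markov_GE p q h0) 0%N mpsi). Qed.

Lemma integrable_smooth h : 0 < h -> m.-integrable setT (EFin \o smooth h).
Proof.
move=> h0; apply: integrable_EFin_lty; first exact: measurable_smooth.
apply: le_lt_trans (norm1_conv (markov_GE p q h0) 0%N mpsi) _.
exact/integrable_norm1.
Qed.

Lemma integrable_GEpsi h z : 0 < h -> m.-integrable setT (EFin \o (fun z' => GE h z z' * psi z')).
Proof. by move=> h0; exact: (integrable_kernelM (markov_GE p q h0) 0%N). Qed.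

Lemma smooth_bounded h z : 0 < h -> `|smooth h z| <= kap p h * kap q h * B1.
Proof.
move=> h0; have iG := integrable_GEpsi z h0.
apply: le_trans (le_normr_Rintegral measurableT iG) _.
rewrite /B1 -RintegralZl//; last by have := integrable_norm ipsi; apply: eq_integrable.
apply: le_Rintegral => //.
- by have := integrable_norm iG; apply: eq_integrable.
- by have := integrableZl measurableT (kap p h * kap q h) (integrable_norm ipsi); apply: eq_integrable.
move=> z' _; rewrite normrM ler_wpM2r// ger0_norm ?(ltW (GE_gt0 _ _ h0))//.
exact: GE_le.
Qed.

(** The square of the operator of kernel [GE h] has kernel
[GE (sqrt 2 * h)], by the semigroup property. *)
Lemma norm2_smooth h : 0 < h -> \int[m]_z (smooth h z ^+ 2) = quad (Num.sqrt 2 * h).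
Proof.
move=> h0; have h2 : 0 < Num.sqrt 2 * h by rewrite mulr_gt0// sqrtr_gt0.
have mG := @measurable_GE R p q h.
have GB (w : E * E) : `|GE h w.1 w.2| <= kap p h * kap q h.
  by rewrite ger0_norm ?GE_le// ltW// GE_gt0.
have i1 := integrable_prod_bounded (integrable_smooth h0) ipsi mG GB.
transitivity (\int[m]_z \int[m]_w (smooth h z * psi w * GE h z w)).
  apply: eq_Rintegral => z _; rewrite expr2 -RintegralZl//; last exact: integrable_GEpsi.
  by apply: eq_Rintegral => w _; ring.
rewrite (Rintegral_swap i1); apply: eq_Rintegral => w _ /=.
have iGs : m.-integrable setT (EFin \o (fun z => GE h w z * smooth h z)).
  exact: (integrable_kernelM (markov_GE p q h0) 0%N w (integrable_smooth h0)).
rewrite (_ : \int[m]_x _ = psi w * \int[m]_z (GE h w z * smooth h z)); last first.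
  rewrite -RintegralZl//; apply: eq_Rintegral => z _.
  by rewrite [GE h z w]GEC; ring.
congr (_ * _).
have i2 := integrable_prod_bounded (integrable_GE w h0) ipsi mG GB.
transitivity (\int[m]_z \int[m]_v (GE h w z * psi v * GE h z v)).
  apply: eq_Rintegral => z _; rewrite -RintegralZl//; last exact: integrable_GEpsi.
  by apply: eq_Rintegral => v _; ring.
rewrite (Rintegral_swap i2); apply: eq_Rintegral => v _ /=.
rewrite -GE_semigroup// -RintegralZr//.
  by apply: eq_Rintegral => z _; ring.
have iGv : m.-integrable setT (EFin \o (fun z => GE h z v)).
  by apply: eq_integrable (integrable_GE v h0) => // z _ /=; rewrite GEC.
exact: (integrable_kernelM (markov_GE p q h0) 0%N w iGv).
Qed.

Lemma norm2_smooth_le h : 0 < h -> \int[m]_z (smooth h z ^+ 2) <= quad h.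
Proof.
move=> h0; rewrite (norm2_smooth h0).
apply: (quad_le h0).
have s1 : 1 <= Num.sqrt 2 :> R by rewrite -{1}(sqrtr1 R) ler_wsqrtr// ler1n.
by rewrite (ler_peMl (ltW h0) s1).
Qed.

Lemma integrable_smooth2 h : 0 < h -> m.-integrable setT (EFin \o (fun z => smooth h z ^+ 2)).
Proof.
move=> h0; apply: le_integrable (integrableZl measurableT (kap p h * kap q h * B1) (integrable_smooth h0)) => //.
  by apply/measurable_EFinP; apply: measurable_funX; exact: measurable_smooth.
move=> z _ /=; rewrite lee_fin expr2 !normrM ler_wpM2r//.
by rewrite -!normrM (le_trans (smooth_bounded z h0))// ler_norm.
Qed.

Variable M : R.
Hypothesis M0 : 0 <= M.
Hypothesis psiM : {ae m, forall z, `|psi z| <= M}.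

Lemma integrable_psi2 : m.-integrable setT (EFin \o (fun z => psi z ^+ 2)).
Proof.
apply/integrableP; split; first by apply/measurable_EFinP; exact: measurable_funX.
have iM := integrableZl measurableT M (integrable_norm ipsi).
have /integrableP[_] := iM; apply: le_lt_trans.
apply: ae_ge0_le_integral => //.
- by apply: measurableT_comp => //; apply/measurable_EFinP; exact: measurable_funX.
- by apply: measurableT_comp => //; exact: measurable_int iM.
- move: psiM; apply: filterS => z zM _ /=; rewrite lee_fin.
  rewrite expr2 !normrM normr_id ler_wpM2r//.
  by rewrite (le_trans zM)// ler_norm.
Qed.

(** The difference is at most the supremum of [|psi|] times the L1 distance
between [psi] and its smoothing. *)
Lemma quad_cvg : quad (bandwidth R k) @[k --> \oo] --> \int[m]_z (psi z ^+ 2).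
Proof.
have AK : approximates m (fun k => GE (bandwidth R k)) psi.
  apply: (approximates_prod (K1 := fun k => @gk R p (bandwidth R k)) (K2 := fun k => @gk R q (bandwidth R k))) => //.
  - exact: markov_gk (bandwidth_gt0 R).
  - exact: markov_gk (bandwidth_gt0 R).
  - exact: approximates_gk.
  - exact: approximates_gk.
have b0 := bandwidth_gt0 R.
apply/cvgrPdist_le => e e0.
have e1 : 0 < e / (M + 1) by rewrite divr_gt0// ltr_pwDr.
move/cvge0P : AK => AK.
have {}AK := AK (fun k => norm1_ge0 _ _) _ e1.
near=> k.
have Ak : (norm1 m (fun z => smooth (bandwidth R k) z - psi z)%R <= (e / (M + 1))%:E)%E.
  by near: k; exact: AK.
set h := bandwidth R k in Ak *; have h0 : 0 < h by exact: b0.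
have is_ := integrable_smooth h0.
have ips : m.-integrable setT (EFin \o (fun z => psi z * smooth h z)).
  have := integrableZl measurableT (kap p h * kap q h * B1) ipsi; apply: le_integrable => //.
    by apply/measurable_EFinP; apply: measurable_funM => //; exact: measurable_smooth.
  move=> z _ /=; rewrite lee_fin [leRHS]normrM normrM mulrC ler_wpM2r//.
  by rewrite (le_trans (smooth_bounded z h0))// ler_norm.
have i2 := integrable_psi2.
rewrite distrC /quad -RintegralB//.
have iD : m.-integrable setT (EFin \o (fun z => psi z * smooth h z - psi z ^+ 2)).
  by have := integrableB measurableT ips i2; apply: eq_integrable.
apply: le_trans (le_normr_Rintegral measurableT iD) _.
have isp : m.-integrable setT (EFin \o (fun z => smooth h z - psi z)).
  by have := integrableB measurableT is_ ipsi; apply: eq_integrable.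
rewrite -lee_fin /Rintegral fineK; last first.
  by have := integrable_norm iD; exact: integrable_fin_num.
apply: (@le_trans _ _ (M%:E * norm1 m (fun z => smooth h z - psi z)%R)%E).
  rewrite /norm1 -ge0_integralZl//; last first.
    by apply: measurable_normE; exact: integrable_measurable isp.
  have misp : measurable_fun setT (fun z => `|smooth h z - psi z|%:E).
    by apply: measurable_normE; exact: integrable_measurable isp.
  apply: ae_ge0_le_integral.
  - by [].
  - by move=> z _; rewrite lee_fin.
  - by apply: measurable_normE; exact: integrable_measurable iD.
  - by move=> z _; rewrite mule_ge0 ?lee_fin.
  - exact: measurable_funeM.
  - move: psiM; apply: filterS => z zM _; rewrite -EFinM lee_fin expr2 -mulrBr normrM.
    by rewrite ler_wpM2r.
apply: (@le_trans _ _ (M%:E * (e / (M + 1))%:E)%E); first by rewrite lee_wpmul2l.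
rewrite -EFinM lee_fin mulrCA ler_piMr ?(ltW e0)//.
by rewrite ler_pdivrMr ?mul1r ?lerDl// ltr_pwDr.
Unshelve. all: by end_near. Qed.

(** For every [k], [quad (bandwidth k)] is bounded by the right-hand side:
in Fourier variables its damping factor is at most 1, and
[1 <= e^(1/2) damp h u + (h |u|)^(2 delta)], because the first term is at least 1
when [h |u| <= 1] and the second otherwise. Let [k] tend to infinity. *)
Lemma norm2_le_quad (delta A h : R) : 0 < delta -> 0 < h ->
  (\int[m]_u (enorm u `^ (2 * delta) * fpow u)%:E <= A%:E)%E ->
  \int[m]_z (psi z ^+ 2) <= expR (1 / 2) * quad h + h `^ (2 * delta) * (c * A).
Proof.
move=> d0 h0 HA.
have b0 := bandwidth_gt0 R.
rewrite -(cvg_lim (@Rhausdorff R) quad_cvg).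
apply: limr_le; first by apply/cvg_ex; eexists; exact: quad_cvg.
apply: nearW => k.
set hk := bandwidth R k; have hk0 : 0 < hk by exact: b0.
have me : measurable_fun setT (fun u : E => enorm u `^ (2 * delta) * fpow u).
  apply: measurable_funM; last exact: measurable_fpow.
  have men : measurable_fun setT (fun u : E => enorm u).
    apply: (measurableT_comp (f := @Num.sqrt R) (continuous_measurable_fun (@sqrt_continuous R))).
    apply: (measurableT_comp (f := fun z : E * E => inner z.1 z.2) (@measurable_inner R p q)
      (g := fun u => (u, u))).
    by apply/measurable_fun_pairP; split; exact: measurable_id.
  exact: (measurableT_comp (f := fun x : R => x `^ (2 * delta)) (measurable_powR _) men).
have iS : m.-integrable setT (EFin \o (fun u : E => enorm u `^ (2 * delta) * fpow u)).
  apply: integrable_EFin_lty => //.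
  under eq_integral do rewrite ger0_norm ?mulr_ge0 ?powR_ge0 ?fpow_ge0//.
  by apply: le_lt_trans HA _; rewrite ltry.
have SA : \int[m]_u (enorm u `^ (2 * delta) * fpow u) <= A.
  rewrite -lee_fin /Rintegral fineK//; exact: integrable_fin_num iS.
have id := integrable_damp_fpow h0.
apply: (@le_trans _ _ (c * \int[m]_u (expR (1 / 2) * (damp h u * fpow u) +
    h `^ (2 * delta) * (enorm u `^ (2 * delta) * fpow u)))).
  rewrite quad_fourier// ler_pM2l//; apply: le_Rintegral => //.
  - exact: integrable_damp_fpow.
  - have := integrableD measurableT (integrableZl measurableT (expR (1/2)) id)
      (integrableZl measurableT (h `^ (2 * delta)) iS).
    by apply: eq_integrable.
  - move=> u _; rewrite !mulrA -mulrDl ler_wpM2r ?fpow_ge0//.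
    apply: (@le_trans _ _ 1).
      rewrite /damp -[leRHS]expR0 ler_expR oppr_le0 divr_ge0// mulr_ge0 ?sqr_ge0 ?inner_ge0//.
    rewrite -powRM ?(ltW h0) ?sqrtr_ge0//.
    have [hu|hu] := leP (h * enorm u) 1.
      apply: ler_wpDr; first exact: powR_ge0.
      rewrite /damp -expRD -[leLHS]expR0 ler_expR subr_ge0 ler_pM2r//.
      rewrite -[inner u u]sqr_sqrtr ?inner_ge0// -exprMn -/(enorm u).
      by rewrite expr_le1// mulr_ge0 ?sqrtr_ge0// ltW.
    apply: ler_wpDl; first by rewrite mulr_ge0 ?expR_ge0// ltW// damp_gt0.
    apply: (@le_trans _ _ (1 `^ (2 * delta))); first by rewrite powR1.
    apply: ge0_ler_powR; rewrite ?nnegrE.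
    - by rewrite mulr_ge0// ltW.
    - by [].
    - by rewrite mulr_ge0 ?sqrtr_ge0// ltW.
    - exact: ltW.
rewrite RintegralD//; last 2 first.
- by have := integrableZl measurableT (expR (1/2)) id; apply: eq_integrable.
- by have := integrableZl measurableT (h `^ (2 * delta)) iS; apply: eq_integrable.
rewrite (RintegralZl _ measurableT id) (RintegralZl _ measurableT iS).
rewrite quad_fourier// mulrDr mulrCA lerD2l mulrCA ler_wpM2l ?powR_ge0//.
by rewrite ler_pM2l.
Qed.

End quadratic_form.

(** * Laws with a density and their marginals *)

Section law_integral.
Context d (T : measurableType d) (R : realType).
Variables (m : {sigma_finite_measure set T -> \bar R}) (f : density m).

Lemma integrable_pdf : m.-integrable setT (EFin \o f).
Proof.
apply: integrable_EFin_lty; first exact: pdf_measurable.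
under eq_integral do rewrite ger0_norm ?pdf_ge0//.
by rewrite pdf_int1 ltry.
Qed.

(** The density is a Radon-Nikodym derivative of the law. *)
Lemma integral_law (w : T -> \bar R) : (law f).-integrable setT w ->
  (\int[law f]_x w x = \int[m]_x (w x * (f x)%:E))%E.
Proof.
move=> iw.
have mf : measurable_fun setT (EFin \o f) by apply/measurable_EFinP; exact: pdf_measurable.
have numu : law f `<< m.
  apply/null_content_dominatesP => A mA A0.
  by rewrite /law; apply: null_set_integral => //; exact: measurable_funTS.
rewrite -(Radon_Nikodym_change_of_variables numu measurableT iw).
apply: ae_eq_integral => //.
- apply: emeasurable_funM; first exact: measurable_int iw.
  apply: measurable_int (Radon_Nikodym_integrable _); exact: numu.
- by apply: emeasurable_funM => //; exact: measurable_int iw.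
have : ae_eq m setT (Radon_Nikodym (charge_of_finite_measure (law f)) m) (EFin \o f).
  apply: integral_ae_eq => //; first exact: Radon_Nikodym_integrable.
  by move=> A _ mA; rewrite -Radon_Nikodym_integral.
by apply: filterS => x /= E xT; rewrite E.
Qed.

Lemma Rintegral_law (w : T -> R) : bmeas w ->
  \int[law f]_x w x = \int[m]_x (w x * f x).
Proof.
move=> bw; rewrite /Rintegral integral_law//.
by apply: bmeas_integrable bw; exact: pdf_int1.
Qed.

Lemma integrable_bmeas_pdf (w : T -> R) : bmeas w ->
  m.-integrable setT (EFin \o (fun x => w x * f x)).
Proof.
move=> [mw [B wB]].
have := integrableZl measurableT B integrable_pdf; apply: le_integrable => //.
  by apply/measurable_EFinP; apply: measurable_funM => //; exact: pdf_measurable.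
move=> x _ /=; rewrite lee_fin !normrM ler_wpM2r//.
by rewrite (le_trans (wB x))// ler_norm.
Qed.

End law_integral.

Section ae_product.
Context d1 d2 (T1 : measurableType d1) (T2 : measurableType d2) (R : realType).
Variables (m1 : {sigma_finite_measure set T1 -> \bar R}).
Variables (m2 : {sigma_finite_measure set T2 -> \bar R}).

Lemma ae_fst (Q : T1 -> Prop) : {ae m1, forall x, Q x} ->
  {ae prod_measure m1 m2, forall z, Q z.1}.
Proof.
move=> [N [mN N0 QN]]; exists (N `*` setT); split.
- exact: measurableX.
- by rewrite /prod_measure product_measure1E// [X in (X * _)%E]N0 mul0e.
- by move=> z Qz; split => //; exact: QN.
Qed.

Lemma ae_snd (Q : T2 -> Prop) : {ae m2, forall y, Q y} ->
  {ae prod_measure m1 m2, forall z, Q z.2}.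
Proof.
move=> [N [mN N0 QN]]; exists (setT `*` N); split.
- exact: measurableX.
- by rewrite /prod_measure product_measure1E// [X in (_ * X)%E]N0 mule0.
- by move=> z Qz; split => //; exact: QN.
Qed.

End ae_product.

Section product_laws.
Context d1 d2 (T1 : measurableType d1) (T2 : measurableType d2) (R : realType).
Variables (m1 : {sigma_finite_measure set T1 -> \bar R}).
Variables (m2 : {sigma_finite_measure set T2 -> \bar R}).
Variable f : density (prod_measure m1 m2).

Let f0 : density (prod_measure m1 m2) := tensor (marg1 f) (marg2 f).
Let P1 : law f setT = 1%E := pdf_int1 f.
Let P01 : law f0 setT = 1%E := pdf_int1 f0.

Lemma Rintegral_law1 (w : T1 -> R) : bmeas w ->
  \int[law f]_z w z.1 = \int[m1]_x (w x * marg1 f x).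
Proof.
move=> bw; have bw1 : bmeas (fun z : T1 * T2 => w z.1).
  exact: bmeas_comp measurable_fst bw.
have iwf := integrable_bmeas_pdf f bw1.
rewrite Rintegral_law// Rintegral_prod1// /Rintegral; congr fine.
apply: ae_eq_integral => //.
- apply/measurable_EFinP; apply: (measurable_Rintegral1 m2 (F := fun z => w z.1 * f z)).
  exact: integrable_measurable iwf.
- by apply/measurable_EFinP; apply: measurable_funM; [case: bw|exact: pdf_measurable].
have := ae_integrable1 (integrable_pdf f); apply: filterS => x ix _; congr EFin.
exact: (RintegralZl (w x) measurableT ix).
Qed.

Lemma Rintegral_law2 (w : T2 -> R) : bmeas w ->
  \int[law f]_z w z.2 = \int[m2]_y (w y * marg2 f y).
Proof.
move=> bw; have bw1 : bmeas (fun z : T1 * T2 => w z.2).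
  exact: bmeas_comp measurable_snd bw.
have iwf := integrable_bmeas_pdf f bw1.
rewrite Rintegral_law// Rintegral_prod2// /Rintegral; congr fine.
apply: ae_eq_integral => //.
- apply/measurable_EFinP; apply: (measurable_Rintegral2 m1 (F := fun z => w z.2 * f z)).
  exact: integrable_measurable iwf.
- by apply/measurable_EFinP; apply: measurable_funM; [case: bw|exact: pdf_measurable].
have := ae_integrable2 (integrable_pdf f); apply: filterS => x ix _; congr EFin.
exact: (RintegralZl (w x) measurableT ix).
Qed.

Let bmeas_mix (F : T1 * T2 -> R) : bmeas F ->
  bmeas (fun s : (T1 * T2) * (T1 * T2) => F (s.1.1, s.2.2)).
Proof.
apply: (bmeas_comp (u := fun s : (T1 * T2) * (T1 * T2) => (s.1.1, s.2.2))).
apply/measurable_fun_pairP; split.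
  exact: (measurableT_comp measurable_fst measurable_fst).
exact: (measurableT_comp measurable_snd measurable_snd).
Qed.

(** The law of [(X, Y')] when [(X, Y)] and [(X', Y')] are independent
observations. *)
Lemma Rintegral_tensor (F : T1 * T2 -> R) : bmeas F ->
  \int[law f0]_z F z = \int[law f]_z \int[law f]_v F (z.1, v.2).
Proof.
move=> bF; have iF := integrable_bmeas_pdf f0 bF.
rewrite Rintegral_law// Rintegral_prod1//.
have bF1 : bmeas (fun s : T1 * (T1 * T2) => F (s.1, s.2.2)).
  apply: (bmeas_comp (u := fun s : T1 * (T1 * T2) => (s.1, s.2.2))) => //.
  apply/measurable_fun_pairP; split; first exact: measurable_fst.
  exact: (measurableT_comp measurable_snd measurable_snd).
rewrite (Rintegral_law1 (bmeas_Rintegral1 P1 bF1)).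
apply: eq_Rintegral => x _.
have bFx : bmeas (fun y => F (x, y)).
  exact: (bmeas_comp (u := fun y => (x, y)) (measurable_pair1 x) bF).
rewrite (Rintegral_law2 bFx) -RintegralZr//; last exact: integrable_bmeas_pdf.
by apply: eq_Rintegral => y _; rewrite /f0/= /tensor_fun/=; ring.
Qed.

Variables (k1 : T1 -> T1 -> R) (l1 : T2 -> T2 -> R).
Hypotheses (kC : forall x y, k1 x y = k1 y x) (lC : forall x y, l1 x y = l1 y x).
Hypotheses (bk : bmeas (fun z : T1 * T1 => k1 z.1 z.2)).
Hypotheses (bl : bmeas (fun z : T2 * T2 => l1 z.1 z.2)).
Let k (z z' : T1 * T2) := k1 z.1 z'.1.
Let l (z z' : T1 * T2) := l1 z.2 z'.2.

Lemma bmeas_kernel_fst : bmeas (fun s : (T1 * T2) * (T1 * T2) => k s.1 s.2).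
Proof.
apply: (bmeas_kernel bk (u := fun s : (T1 * T2) * (T1 * T2) => s.1.1) (v := fun s => s.2.1)).
  exact: (measurableT_comp measurable_fst measurable_fst).
exact: (measurableT_comp measurable_fst measurable_snd).
Qed.

Lemma bmeas_kernel_snd : bmeas (fun s : (T1 * T2) * (T1 * T2) => l s.1 s.2).
Proof.
apply: (bmeas_kernel bl (u := fun s : (T1 * T2) * (T1 * T2) => s.1.2) (v := fun s => s.2.2)).
  exact: (measurableT_comp measurable_snd measurable_fst).
exact: (measurableT_comp measurable_snd measurable_snd).
Qed.

Let bK := bmeas_kernel_fst.
Let bL := bmeas_kernel_snd.
Let G z z' := k z z' * l z z'.
Let bG : bmeas (fun s : (T1 * T2) * (T1 * T2) => G s.1 s.2).
Proof. exact: bmeasM. Qed.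
Let bG1 z : bmeas (G z).
Proof. exact: (bmeas_comp (u := fun v => (z, v)) (measurable_pair1 z) bG). Qed.
Let bK1 z : bmeas (k z).
Proof. exact: (bmeas_comp (u := fun v => (z, v)) (measurable_pair1 z) bK). Qed.
Let bL1 z : bmeas (l z).
Proof. exact: (bmeas_comp (u := fun v => (z, v)) (measurable_pair1 z) bL). Qed.
Let a := mean_kernel (law f) k.
Let b := mean_kernel (law f) l.
Let c := mean_kernel (law f) G.
Let g := cross_kernel (law f) k l.
Let ba : bmeas a. Proof. exact: bmeas_mean_kernel. Qed.
Let bb : bmeas b. Proof. exact: bmeas_mean_kernel. Qed.
Let bc : bmeas c. Proof. exact: bmeas_mean_kernel. Qed.
Let bg : bmeas g. Proof. by apply: bmeasB => //; exact: bmeasM. Qed.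

Lemma mean_kernel_tensor z : \int[law f0]_v G z v = a z * b z.
Proof.
rewrite Rintegral_tensor//.
transitivity (\int[law f]_u (k z u * b z)).
  apply: eq_Rintegral => u _.
  by rewrite -[RHS]/(k z u * \int[law f]_v l z v) -bRintegralZl.
by rewrite bRintegralZr.
Qed.

Lemma cross_kernelE z : g z = \int[law f]_v G z v - \int[law f0]_v G z v.
Proof. by rewrite mean_kernel_tensor. Qed.

(** Both sides average over the observation whose second component enters
[l]; Fubini's theorem takes this average out of the other one. *)
Lemma cross_kernel1E z : cross_kernel1 (law f) k l z = \int[law f]_v g (z.1, v.2).
Proof.
have bcz : bmeas (fun v : T1 * T2 => c (z.1, v.2)).
  exact: (bmeas_comp (u := fun v => (z, v)) (measurable_pair1 z) (bmeas_mix bc)).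
have bab : bmeas (fun v : T1 * T2 => a z * b v).
  by apply: bmeasM => //; exact: bmeas_cst.
have -> : \int[law f]_v g (z.1, v.2) = \int[law f]_v c (z.1, v.2) - a z * \int[law f]_v b v.
  by rewrite -(bRintegralZl P1 (a z) bb) -(bRintegralB P1 bcz bab).
congr (_ - _).
have bkl : bmeas (fun s : (T1 * T2) * (T1 * T2) => k z s.1 * l s.1 s.2).
  by apply: bmeasM => //; exact: (bmeas_comp measurable_fst (bK1 z)).
transitivity (\int[law f]_u \int[law f]_v (k z u * l u v)).
  apply: eq_Rintegral => u _; rewrite bRintegralZl//.
rewrite (bRintegral_swap P1 P1 bkl).
by apply: eq_Rintegral => v _; apply: eq_Rintegral => u _; rewrite /l/= lC.
Qed.

Lemma cross_kernel2E z : cross_kernel2 (law f) k l z = \int[law f]_v g (v.1, z.2).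
Proof.
have bcz : bmeas (fun v : T1 * T2 => c (v.1, z.2)).
  exact: (bmeas_comp (u := fun v => (v, z)) (measurable_pair2 z) (bmeas_mix bc)).
have bab : bmeas (fun v : T1 * T2 => a v * b z).
  by apply: bmeasM => //; exact: bmeas_cst.
have -> : \int[law f]_v g (v.1, z.2) = \int[law f]_v c (v.1, z.2) - (\int[law f]_v a v) * b z.
  by rewrite -(bRintegralZr P1 (b z) ba) -(bRintegralB P1 bcz bab).
congr (_ - _).
have bkl : bmeas (fun s : (T1 * T2) * (T1 * T2) => l z s.1 * k s.1 s.2).
  by apply: bmeasM => //; exact: (bmeas_comp measurable_fst (bL1 z)).
transitivity (\int[law f]_u \int[law f]_v (l z u * k u v)).
  apply: eq_Rintegral => u _; rewrite bRintegralZl//.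
rewrite (bRintegral_swap P1 P1 bkl).
by apply: eq_Rintegral => v _; apply: eq_Rintegral => u _; rewrite /k/= kC mulrC.
Qed.

(** Jensen's inequality bounds the square of an average by the average of the
square, and [Rintegral_tensor] identifies the latter. *)
Lemma cross_kernels_le :
  \int[law f]_z (g z ^+ 2) + \int[law f]_z (cross_kernel1 (law f) k l z ^+ 2)
  + \int[law f]_z (cross_kernel2 (law f) k l z ^+ 2)
  <= \int[law f]_z (g z ^+ 2) + 2 * \int[law f0]_z (g z ^+ 2).
Proof.
have bg2 := bmeasX 2 bg.
have bm := bmeas_mix bg; have bm2 := bmeas_mix bg2.
rewrite -addrA lerD2l mulr_natl mulr2n Rintegral_tensor//; apply: lerD.
  apply: le_bRintegral => //.
  - rewrite (_ : cross_kernel1 _ _ _ = fun z => \int[law f]_v g (z.1, v.2)).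
      exact: (bmeasX 2 (bmeas_Rintegral1 P1 bm)).
    by apply/funext => z; exact: cross_kernel1E.
  - exact: (bmeas_Rintegral1 P1 bm2).
  - move=> z; rewrite cross_kernel1E; apply: sqr_bRintegral_le => //.
    exact: (bmeas_comp (u := fun v => (z, v)) (measurable_pair1 z) bm).
rewrite (bRintegral_swap P1 P1 bm2).
apply: le_bRintegral => //.
- rewrite (_ : cross_kernel2 _ _ _ = fun z => \int[law f]_v g (v.1, z.2)).
    exact: (bmeasX 2 (bmeas_Rintegral2 P1 bm)).
  by apply/funext => z; exact: cross_kernel2E.
- exact: (bmeas_Rintegral2 P1 bm2).
- move=> z; rewrite cross_kernel2E; apply: sqr_bRintegral_le => //.
  exact: (bmeas_comp (u := fun v => (v, z)) (measurable_pair2 z) bm).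
Qed.

Lemma mean_hsic_kernel_law :
  \int[tuple_measure (law f) 4]_t hsic_kernel k l t =
  \int[law f]_z g z - \int[law f0]_z g z.
Proof.
have kC' (x y : T1 * T2) : k x y = k y x by exact: kC.
have lC' (x y : T1 * T2) : l x y = l y x by exact: lC.
have bab : bmeas (fun z => a z * b z) by exact: bmeasM.
rewrite (mean_hsic_kernel P1 kC' lC' bK bL) /g /cross_kernel.
rewrite !bRintegralB//.
have -> : \int[law f0]_z (a z * b z) = (\int[law f]_z a z) * (\int[law f]_z b z).
  rewrite Rintegral_tensor// -bRintegralZr//; apply: eq_Rintegral => z _ /=.
  by rewrite -bRintegralZl.
have -> : \int[law f0]_z c z = \int[law f]_z (a z * b z).
  rewrite /c /mean_kernel (bRintegral_swap P01 P1 bG); apply: eq_Rintegral => z _.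
  rewrite -mean_kernel_tensor; apply: eq_Rintegral => v _.
  by rewrite /G /= kC' lC'.
have E (x y w : R) : x - 2 * y + w = (x - y) - (y - w) by ring.
exact: E.
Qed.

End product_laws.

(** * Mean and variance of HSIC *)

Lemma Rintegral_law_le d (T : measurableType d) (R : realType)
    (m : {sigma_finite_measure set T -> \bar R}) (f : density m) (w : T -> R) (M : R) :
  0 <= M -> {ae m, forall x, f x <= M} -> bmeas w -> (forall x, 0 <= w x) ->
  m.-integrable setT (EFin \o w) ->
  \int[law f]_x w x <= M * \int[m]_x w x.
Proof.
move=> M0 fM bw w0 iw.
have iwf := integrable_bmeas_pdf f bw.
have iMw := integrableZl measurableT M iw.
rewrite Rintegral_law// -(RintegralZl M measurableT iw) /Rintegral fine_le//.
- exact: integrable_fin_num iwf.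
- exact: integrable_fin_num iMw.
apply: ae_ge0_le_integral => //.
- by move=> x _; rewrite lee_fin mulr_ge0 ?pdf_ge0.
- exact: measurable_int iwf.
- by move=> x _; rewrite lee_fin mulr_ge0.
- exact: measurable_int iMw.
- by move: fM; apply: filterS => x fx _; rewrite lee_fin mulrC ler_wpM2r.
Qed.

Lemma chebyshev_le d (T : measurableType d) (R : realType) (m : {measure set T -> \bar R})
    (X : T -> R) (c V t : R) : m setT = 1%E -> bmeas X -> 0 < t ->
  \int[m]_x ((X x - c) ^+ 2) <= V ->
  (m [set x | (t <= `|X x - c|)%R] <= (V / t ^+ 2)%:E)%E.
Proof.
move=> mT bX t0 XV; have bXc : bmeas (fun x => X x - c) by apply: bmeasB => //; exact: bmeas_cst.
set A := [set x | _].
have mA : measurable A.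
  rewrite -[X in measurable X]setTI; apply: measurable_fun_le => //.
  by apply: measurableT_comp => //; case: bXc.
have bA : bmeas (\1_A : T -> R).
  split; first exact: measurable_indic.
  by exists 1 => x; rewrite indicE; case: (_ \in _); rewrite ?normr1 ?normr0.
have mAf : m A \is a fin_num.
  rewrite ge0_fin_numE//; apply: le_lt_trans (_ : 1 < _)%E; last exact: ltry.
  by rewrite -mT; apply: le_measure; rewrite ?inE.
rewrite -(fineK mAf) lee_fin ler_pdivlMr ?exprn_gt0//; apply: le_trans XV.
have -> : fine (m A) * t ^+ 2 = \int[m]_x (t ^+ 2 * \1_A x).
  by rewrite bRintegralZl// mulrC /Rintegral integral_indic// setIT.
apply: le_bRintegral => //; [by apply: bmeasM => //; exact: bmeas_cst|exact: bmeasX|].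
move=> x; rewrite indicE; have [|] := boolP (x \in A); last by rewrite mulr0 sqr_ge0.
rewrite inE /A/= mulr1 => tX; rewrite -[leRHS]real_normK ?num_real//.
by rewrite lerXn2r// nnegrE// ltW.
Qed.

Section hsic_moments.
Context (R : realType) (p q : nat).
Notation E := (p.-tuple R * q.-tuple R)%type.
Local Notation m := (leb2 R p q).
Variables (f : density m) (h M : R).
Hypotheses (h0 : 0 < h) (M0 : 0 <= M).
Hypotheses (fM : {ae m, forall z, f z <= M}) (iM : {ae m, forall z, indep f z <= M}).
Hypotheses (f1M : {ae leb R p, forall x, marg1 f x <= M}).
Hypotheses (f2M : {ae leb R q, forall y, marg2 f y <= M}).

Let psi := dependence f.
Let P1 : law f setT = 1%E := pdf_int1 f.
Let k : E -> E -> R := kern1 (fun=> h).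
Let l : E -> E -> R := kern2 (fun=> h).
Let Q := quad psi h.

Lemma integrable_dependence : m.-integrable setT (EFin \o psi).
Proof.
have := integrableB measurableT (integrable_pdf f) (integrable_pdf (indep f)).
exact: eq_integrable.
Qed.
Let ipsi := integrable_dependence.

(** The cross kernel of HSIC is thereby the smoothing of the dependence
function. *)
Lemma Rintegral_dependence (w : E -> R) : bmeas w ->
  \int[law f]_z w z - \int[law (indep f)]_z w z = \int[m]_z (w z * psi z).
Proof.
move=> bw; rewrite !Rintegral_law// -RintegralB//; try exact: integrable_bmeas_pdf.
by apply: eq_Rintegral => z _; rewrite mulrBr.
Qed.

Let bgk d : bmeas (fun z : d.-tuple R * d.-tuple R => gk h z.1 z.2).
Proof.
split; first exact: measurable_gk.
by exists (kap d h) => z; rewrite ger0_norm ?gk_le// ltW// gk_gt0.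
Qed.
Let gkC' d (x y : d.-tuple R) : gk h x y = gk h y x. Proof. exact: gkC. Qed.

Let bG (z : E) : bmeas (GE h z : E -> R).
Proof.
split; first exact: measurable_GE1.
by exists (kap p h * kap q h) => z'; rewrite ger0_norm ?GE_le// ltW// GE_gt0.
Qed.

Lemma cross_kernel_smooth z : cross_kernel (law f) k l z = smooth psi h z.
Proof.
exact: (etrans (cross_kernelE f (@bgk p) (@bgk q) z) (Rintegral_dependence (bG z))).
Qed.

Let bsmooth : bmeas (smooth psi h).
Proof.
split; first exact: measurable_smooth.
by eexists => z; exact: smooth_bounded.
Qed.

(** The integral of the cross kernel against the law minus the product of its
marginals, that is, the quadratic form of the dependence function. *)
Lemma mean_hsic : \int[tuple_measure (law f) 4]_t hsic_kernel k l t = Q.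
Proof.
apply: (etrans (mean_hsic_kernel_law f (@gkC' p) (@gkC' q) (@bgk p) (@bgk q))).
transitivity (\int[law f]_z smooth psi h z - \int[law (indep f)]_z smooth psi h z).
  by congr (_ - _); apply: eq_Rintegral => z _; exact: cross_kernel_smooth.
rewrite Rintegral_dependence//; apply: eq_Rintegral => z _; exact: mulrC.
Qed.

(** The three functions of [hajek_variance_le] have second moments bounded by
that of the smoothed dependence function under densities bounded by [M], hence by
[M] times its squared L2 norm. *)
Lemma hajek_variance_hsic :
  \int[law f]_z (hajek (law f) (hsic_kernel k l) z ^+ 2)
    - (\int[tuple_measure (law f) 4]_t hsic_kernel k l t) ^+ 2 <= 3 * M * Q.
Proof.
have bK := bmeas_kernel_fst (q.-tuple R) (@bgk p).
have bL := bmeas_kernel_snd (p.-tuple R) (@bgk q).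
have kC (x y : E) : k x y = k y x by exact: gkC'.
have lC (x y : E) : l x y = l y x by exact: gkC'.
apply: le_trans (hajek_variance_le P1 kC lC bK bL) _.
apply: le_trans (cross_kernels_le f (@gkC' p) (@gkC' q) (@bgk p) (@bgk q)) _.
have s2 := integrable_smooth2 ipsi h0.
have b2 := bmeasX 2 bsmooth.
have B (g : density m) : {ae m, forall z, g z <= M} ->
    \int[law g]_z (smooth psi h z ^+ 2) <= M * Q.
  move=> gM; apply: le_trans (Rintegral_law_le M0 gM b2 _ s2) _.
    by move=> z; exact: sqr_ge0.
  by apply: ler_wpM2l => //; exact: norm2_smooth_le.
apply: (@le_trans _ _ (M * Q + 2 * (M * Q))); last first.
  by rewrite le_eqVlt; apply/orP; left; apply/eqP; ring.
have Eg (g : density m) : \int[law g]_z (cross_kernel (law f) k l z ^+ 2) =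
    \int[law g]_z (smooth psi h z ^+ 2).
  by apply: eq_Rintegral => z _; rewrite cross_kernel_smooth.
by apply: lerD; [|apply: ler_wpM2l => //]; rewrite [leLHS]Eg; exact: B.
Qed.

Let gk1 d (x : d.-tuple R) : bmeas (gk h x).
Proof. exact: (bmeas_comp (u := fun y => (x, y)) (measurable_pair1 x) (@bgk d)). Qed.

Let gk_density d (g : density (leb R d)) (x : d.-tuple R) :
  {ae leb R d, forall y, g y <= M} -> \int[law g]_y gk h x y <= M.
Proof.
move=> gM; have [_ _ _ i1] := markov_gk d (fun _ : nat => h0) 0%N.
have i1x : (\int[leb R d]_y (gk h x y)%:E = 1)%E.
  by rewrite -(i1 x); apply: eq_integral => y _; rewrite gkC.
have ig : (leb R d).-integrable setT (EFin \o gk h x).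
  apply: integrable_EFin_lty; first exact: measurable_gk1.
  under eq_integral do rewrite ger0_norm ?(ltW (gk_gt0 _ _ h0))//.
  by rewrite [ltLHS]i1x ltry.
apply: le_trans (Rintegral_law_le M0 gM (gk1 x) _ ig) _.
  by move=> y; rewrite ltW// gk_gt0.
by rewrite /Rintegral i1x mulr1.
Qed.

Lemma second_moment_hsic :
  \int[tuple_measure (law f) 4]_t (hsic_kernel k l t ^+ 2)
    <= 4 * kap p h * kap q h * (M + 3 * M ^+ 2).
Proof.
have bK := bmeas_kernel_fst (q.-tuple R) (@bgk p).
have bL := bmeas_kernel_snd (p.-tuple R) (@bgk q).
have lC (x y : E) : l x y = l y x by exact: gkC'.
apply: (second_moment_hsic_kernel P1 lC bK bL) => //.
- by move=> x y; rewrite ltW ?gk_gt0//=; exact: gk_le.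
- by move=> x y; rewrite ltW ?gk_gt0//=; exact: gk_le.
- move=> x; rewrite /mean_kernel; apply: le_trans (gk_density x.1 f1M).
  by rewrite [leLHS](Rintegral_law1 f (gk1 x.1)) Rintegral_law.
- move=> x; rewrite /mean_kernel; apply: le_trans (gk_density x.2 f2M).
  by rewrite [leLHS](Rintegral_law2 f (gk1 x.2)) Rintegral_law.
- move=> x; apply: le_trans (Rintegral_law_le M0 fM (bG x) _ (integrable_GE x h0)) _.
    by move=> z; rewrite ltW// GE_gt0.
  by rewrite /Rintegral integral_GE// mulr1.
Qed.

Lemma bmeas_HSIC n : (4 <= n)%N ->
  bmeas (@HSIC R p q n (fun=> h) (fun=> h)).
Proof.
move=> n4; rewrite (_ : HSIC _ _ = fun z => usum (hsic_kernel k l) z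
    * (#|[pred s : 4.-tuple 'I_n | uniq s]|%:R)^-1); last first.
  by apply/funext => z; exact: HSIC_usum.
have bK := bmeas_kernel_fst (q.-tuple R) (@bgk p).
have bL := bmeas_kernel_snd (p.-tuple R) (@bgk q).
have bH : bmeas (hsic_kernel k l) by exact: bmeas_hsic_kernel.
by apply: bmeasM; [exact: bmeas_usum|exact: bmeas_cst].
Qed.

(** Combines [usum_variance] with the bounds on the kernel. For [n >= 4] the
number of injective 4-tuples is at least [3 / 32 * n^4], and [576 = 2^16 * 9 / 2^10]
exceeds both [3 * 16] and [4 * 96]. *)
Lemma HSIC_variance n : (4 <= n)%N ->
  \int[sample_law f n]_z ((HSIC (fun=> h) (fun=> h) z - Q) ^+ 2)
  <= 2 ^+ 16 * (M + 3 * M ^+ 2) * (Q / n%:R + kap p h * kap q h / n%:R ^+ 2).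
Proof.
move=> n4.
have bK := bmeas_kernel_fst (q.-tuple R) (@bgk p).
have bL := bmeas_kernel_snd (p.-tuple R) (@bgk q).
have bH : bmeas (hsic_kernel k l) by exact: bmeas_hsic_kernel.
have V := usum_variance P1 bH (@hsic_kernel_rot _ _ k l) n.
have V1 := hajek_variance_hsic; have V2 := second_moment_hsic.
set N : R := #|[pred s : 4.-tuple 'I_n | uniq s]|%:R in V.
rewrite mean_hsic in V V1.
have Ne : N = n%:R * (n%:R - 1) * (n%:R - 2) * (n%:R - 3) :> R by exact: card_uniq_tuple4.
have nR : 4 <= n%:R :> R by rewrite ler_nat.
set x : R := n%:R in Ne nR V *.
have N4 : 3 / 32 * x ^+ 4 <= N.
  rewrite Ne (_ : 3 / 32 * x ^+ 4 = x * (3 / 4 * x) * (2^-1 * x) * (4^-1 * x)); last by field.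
  have x0 : 0 <= x by lra.
  by do ?[apply: ler_pM; rewrite ?mulr_ge0//]; lra.
have Q0 : 0 <= Q by exact: quad_ge0.
have N0 : 0 < N by apply: lt_le_trans N4; rewrite mulr_gt0// exprn_gt0//; lra.
have bU : bmeas (@usum _ _ _ (hsic_kernel k l) n) by exact: bmeas_usum.
have -> : \int[sample_law f n]_z ((HSIC (fun=> h) (fun=> h) z - Q) ^+ 2) =
    N ^- 2 * \int[sample_law f n]_z ((usum (hsic_kernel k l) z - N * Q) ^+ 2).
  rewrite -bRintegralZl//; last 2 first.
  - exact: tuple_measureT.
  - by apply: bmeasX; apply: bmeasB => //; exact: bmeas_cst.
  apply: eq_Rintegral => z _; rewrite HSIC_usum// -/N -/k -/l.
  by field; rewrite gt_eqF.
rewrite mulrC ler_pdivrMr ?exprn_gt0//.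
apply: le_trans V _.
have x0 : 0 < x by lra.
set K := kap p h * kap q h; have K0 : 0 <= K by rewrite mulr_ge0// ltW// kap_gt0.
set A := M + 3 * M ^+ 2; have A0 : 0 <= A by rewrite addr_ge0// mulr_ge0// sqr_ge0.
have MA : M <= A by rewrite lerDl mulr_ge0// sqr_ge0.
apply: (@le_trans _ _ (16 * x ^+ 7 * (3 * A * Q) + 96 * x ^+ 6 * (4 * K * A))).
  apply: lerD; apply: ler_wpM2l; rewrite ?mulr_ge0 ?exprn_ge0 ?(ltW x0)//.
    by apply: le_trans V1 _; apply: ler_wpM2r => //; apply: ler_wpM2l.
  by apply: le_trans V2 _; rewrite /K mulrA.
apply: (@le_trans _ _ (2 ^+ 16 * A * (Q / x + K / x ^+ 2) * (3 / 32 * x ^+ 4) ^+ 2)); last first.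
  apply: ler_wpM2l.
    by rewrite !mulr_ge0// addr_ge0// divr_ge0// ?exprn_ge0// ltW.
  by rewrite lerXn2r// nnegrE ?mulr_ge0 ?exprn_ge0 ?(ltW x0) ?(ltW N0).
rewrite (_ : 2 ^+ 16 * A * _ * _ = 576 * (x ^+ 7 * (A * Q) + x ^+ 6 * (A * K))); last first.
  by field; rewrite gt_eqF.
have AQ : 0 <= x ^+ 7 * (A * Q) by rewrite mulr_ge0 ?exprn_ge0 ?(ltW x0)// mulr_ge0.
have AK : 0 <= x ^+ 6 * (A * K) by rewrite mulr_ge0 ?exprn_ge0 ?(ltW x0)//; exact: mulr_ge0.
rewrite (_ : 16 * _ * _ + _ = 48 * (x ^+ 7 * (A * Q)) + 384 * (x ^+ 6 * (A * K))); last by ring.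
by move: (x ^+ 7 * _) (x ^+ 6 * _) AQ AK => u v; lra.
Qed.

End hsic_moments.

(** * The two errors of the test *)

Lemma Lnorm_pinfty_ae d (T : measurableType d) (R : realType) (m : {measure set T -> \bar R})
    (f : T -> R) (r : R) : ('N[m]_+oo[EFin \o f] <= r%:E)%E ->
  {ae m, forall x, `|f x| <= r}.
Proof.
rewrite unlock /Lnorm; case: ifPn => [m0 /ess_supP|m0 _]; first exact: filterS.
have mT0 : m setT = 0 by apply/eqP; rewrite -measure_le0 leNgt.
by exists setT; split.
Qed.

Lemma lt_Lnorm2 d (T : measurableType d) (R : realType) (m : {measure set T -> \bar R})
    (f : T -> R) (r : R) : 0 <= r -> m.-integrable setT (EFin \o (fun x => f x ^+ 2)) ->
  (r%:E < 'N[m]_(2%:E)[EFin \o f])%E -> r ^+ 2 < \int[m]_x (f x ^+ 2).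
Proof.
move=> r0 if2; rewrite unlock /Lnorm.
have -> : (\int[m]_x (`|(EFin \o f) x| `^ 2%R) = \int[m]_x (f x ^+ 2)%:E)%E.
  apply: eq_integral => x _ /=; rewrite ?poweR_EFin; congr EFin.
  by rewrite powR_mulrn// real_normK ?num_real.
have fin := integrable_fin_num measurableT if2.
rewrite -(fineK fin) /= ?poweR_EFin lte_fin -/(Rintegral m setT _).
have I0 : 0 <= \int[m]_x (f x ^+ 2) by apply: Rintegral_ge0 => x _; exact: sqr_ge0.
rewrite powR12_sqrt// => rI.
by rewrite -[ltRHS]sqr_sqrtr// ltrXn2r// nnegrE ?sqrtr_ge0.
Qed.

(** Boundedness of [X] bounds from below the set whose infimum is the quantile. *)
Lemma quantile_le d (T : measurableType d) (R : realType) (m : {measure set T -> \bar R})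
    (X : T -> R) (u t : R) : 0 < u -> bmeas X ->
  (u%:E <= m [set x | (X x <= t)%R])%E -> quantile m X u <= t.
Proof.
move=> u0 [_ [B XB]] ut; apply: ge_inf => //; exists (- B) => s /= us.
rewrite leNgt; apply/negP => sB; move: us.
rewrite (_ : [set x | X x <= s] = set0) ?measure0 ?lee_fin ?leNgt ?u0//.
rewrite predeqE => x; split => //= Xs; have := XB x; rewrite ler_norml => /andP[BX _].
by have := lt_le_trans sB (le_trans BX Xs); rewrite ltxx.
Qed.

Section sobolev_quad.
Context (R : realType) (p q : nat).
Notation E := (p.-tuple R * q.-tuple R)%type.
Implicit Types (f : density (leb2 R p q)) (s : E -> R).

Lemma normc_fourier s u : ComplexField.Normc.normc (fourier s u) ^+ 2 = fpow s u.
Proof. by rewrite /= sqr_sqrtr// addr_ge0// sqr_ge0. Qed.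

Lemma marg1_indep f x : marg1 (indep f) x = marg1 f x.
Proof.
rewrite -[LHS]/(\int[leb R q]_y (marg1 f x * marg2 f y)).
rewrite (RintegralZl _ measurableT (integrable_pdf (marg2 f))).
by rewrite [X in _ * X](_ : _ = 1) ?mulr1// /Rintegral pdf_int1.
Qed.

Lemma marg2_indep f y : marg2 (indep f) y = marg2 f y.
Proof.
rewrite -[LHS]/(\int[leb R p]_x (marg1 f x * marg2 f y)).
rewrite (RintegralZr _ measurableT (integrable_pdf (marg1 f))).
by rewrite [X in X * _](_ : _ = 1) ?mul1r// /Rintegral pdf_int1.
Qed.

Lemma indep_idem f z : indep (indep f) z = indep f z.
Proof.
by rewrite -[LHS]/(marg1 (indep f) z.1 * marg2 (indep f) z.2) marg1_indep marg2_indep.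
Qed.

Lemma dependence_indep f z : dependence (indep f) z = 0.
Proof. by rewrite /dependence indep_idem subrr. Qed.

Lemma quad_dependence_indep f h : quad (dependence (indep f)) h = 0.
Proof.
transitivity (\int[leb2 R p q]_z (0 : R)); last by rewrite Rintegral_cst ?mul0r.
by apply: eq_Rintegral => z _; rewrite dependence_indep mul0r.
Qed.

End sobolev_quad.

Section test_errors.
Context (R : realType) (p q : nat).
Notation E := (p.-tuple R * q.-tuple R)%type.
Local Notation m := (leb2 R p q).
Variables (f : density m) (h M alpha S : R) (n : nat).
Hypotheses (h0 : 0 < h) (M0 : 0 <= M) (n4 : (4 <= n)%N).
Hypotheses (a0 : 0 < alpha) (a1 : alpha < 1) (S0 : 0 < S) (Sn : S <= n%:R).
Hypothesis kapS : kap p h * kap q h / n%:R ^+ 2 <= S ^- 2.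
Hypotheses (fM : {ae m, forall z, f z <= M}) (iM : {ae m, forall z, indep f z <= M}).
Hypotheses (f1M : {ae leb R p, forall x, marg1 f x <= M}).
Hypotheses (f2M : {ae leb R q, forall y, marg2 f y <= M}).

Let V := 2 ^+ 16 * (M + 3 * M ^+ 2).
Let t := Num.sqrt (V / alpha) / S.
Let V0 : 0 <= V. Proof. by rewrite mulr_ge0// addr_ge0// mulr_ge0// sqr_ge0. Qed.
Let bH := @bmeas_HSIC R p q h h0 n n4.
Let PT (g : density m) : sample_law g n setT = 1%E.
Proof. by apply: tuple_measureT; exact: pdf_int1. Qed.

(** Under [indep f] the mean of HSIC is zero and its variance is at most
[V / S^2], so that HSIC exceeds [t] with probability at most [alpha]. *)
Lemma quantile_HSIC_le : 0 < M ->
  quantile (sample_law (indep f) n) (@HSIC R p q n (fun=> h) (fun=> h)) (1 - alpha) <= t.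
Proof.
move=> Mgt0; have Vgt0 : 0 < V by rewrite mulr_gt0// ltr_wpDr// mulr_ge0// sqr_ge0.
have t0 : 0 < t by rewrite divr_gt0// sqrtr_gt0 divr_gt0.
apply: quantile_le => //; first by rewrite subr_gt0.
have iiM : {ae m, forall z, indep (indep f) z <= M}.
  by apply: filterS iM => z; rewrite indep_idem.
have i1M : {ae leb R p, forall x, marg1 (indep f) x <= M}.
  by apply: filterS f1M => x; rewrite marg1_indep.
have i2M : {ae leb R q, forall y, marg2 (indep f) y <= M}.
  by apply: filterS f2M => y; rewrite marg2_indep.
have := HSIC_variance h0 M0 iM iiM i1M i2M n4.
rewrite quad_dependence_indep mul0r add0r -/V => W.
have {}W : \int[sample_law (indep f) n]_z ((HSIC (fun=> h) (fun=> h) z - 0) ^+ 2) <= V / S ^+ 2.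
  by apply: le_trans W _; apply: ler_wpM2l.
have := chebyshev_le (PT (indep f)) bH t0 W.
have -> : V / S ^+ 2 / t ^+ 2 = alpha.
  rewrite expr_div_n sqr_sqrtr; last by rewrite divr_ge0// ltW.
  by field; rewrite !gt_eqF.
set A := [set _ | _]; set B := [set _ | _] => mA.
have [mH _] := bH.
have mB : measurable B by rewrite -[X in measurable X]setTI; exact: measurable_fun_le.
have mAA : measurable A.
  rewrite -[X in measurable X]setTI; apply: measurable_fun_le => //.
  by apply: measurableT_comp => //; exact: measurable_funB.
have : (1 <= sample_law (indep f) n A + sample_law (indep f) n B)%E.
  rewrite -(PT (indep f)); apply: le_trans (measureU2 _ mAA mB).
  apply: le_measure; rewrite ?inE//; first exact: measurableU.
  move=> z _; have [Bz|Bz] := leP (HSIC (fun=> h) (fun=> h) z) t; [by right|left].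
  by rewrite /A/= subr0 (le_trans (ltW Bz))// ler_norm.
move=> AB; rewrite EFinB leeBlDl//; apply: le_trans AB _.
exact: leeD2r.
Qed.

(** The lower bound on [Q] makes it at least twice the critical value, so that
an error forces a deviation of [Q / 2] from the mean; it also makes the variance
at most [2 V Q / S], which is at most [beta * (Q / 2)^2]. *)
Lemma type2_error_le (K beta : R) : 0 < M -> 0 < beta ->
  K = 1 + 8 * V / beta + 2 * Num.sqrt (V / alpha) ->
  K / S <= quad (dependence f) h ->
  (sample_law f n [set z | HSIC_test alpha (fun=> h) (fun=> h) f z = 0%N] <= beta%:E)%E.
Proof.
move=> Mgt0 b0 KE; set Q := quad _ _ => KQ.
have qt := quantile_HSIC_le Mgt0.
have W := HSIC_variance h0 M0 fM iM f1M f2M n4.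
rewrite -/Q -/V in W.
have s0 : 0 <= Num.sqrt (V / alpha) by exact: sqrtr_ge0.
have Vb0 : 0 <= V / beta by rewrite divr_ge0// ltW.
have Vb8 : 0 <= 8 * V / beta by rewrite -mulrA mulr_ge0.
have K1 : 1 <= K by rewrite KE -addrA lerDl addr_ge0// mulr_ge0.
have K0 : 0 < K by lra.
have Q0 : 0 < Q by apply: lt_le_trans KQ; rewrite divr_gt0.
have tQ : 2 * t <= Q.
  by apply: le_trans KQ; rewrite /t mulrA ler_pM2r ?invr_gt0//; lra.
have Q2 : 0 < Q / 2 by rewrite divr_gt0.
have := chebyshev_le (PT f) bH Q2 W.
set A := [set _ | _]; set B := [set _ | _] => mA.
have [mH _] := bH.
have BE : B = [set z | HSIC (fun=> h) (fun=> h) z <=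
    quantile (sample_law (indep f) n) (@HSIC R p q n (fun=> h) (fun=> h)) (1 - alpha)].
  rewrite predeqE => z; rewrite /B /HSIC_test /=; case: ltP => //=.
have mB : measurable B.
  by rewrite BE -[X in measurable X]setTI; exact: measurable_fun_le.
have mAA : measurable A.
  rewrite -[X in measurable X]setTI; apply: measurable_fun_le => //.
  by apply: measurableT_comp => //; exact: measurable_funB.
apply: (@le_trans _ _ (sample_law f n A)).
  apply: le_measure; rewrite ?inE//.
  rewrite BE => z /= Hz; rewrite /A /= distrC; apply: le_trans (ler_norm _).
  by have := le_trans Hz qt; lra.
apply: le_trans mA _; rewrite lee_fin.
have N0 : 0 < n%:R :> R by exact: lt_le_trans Sn.
rewrite ler_pdivrMr ?exprn_gt0//.
have QS : 1 <= Q * S by rewrite -ler_pdivrMr//; apply: le_trans KQ; rewrite ler_pM2r ?invr_gt0.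
have VK : 8 * V <= beta * K.
  rewrite KE !mulrDr [beta * (8 * V / beta)](_ : _ = 8 * V); last by field; rewrite gt_eqF.
  by rewrite mulr1 -addrA addrCA lerDl addr_ge0// ?mulr_ge0// ltW.
have KSQ : K <= Q * S by rewrite -ler_pdivrMr.
apply: (@le_trans _ _ (V * (2 * Q / S))).
  rewrite ler_wpM2l//.
  have -> : 2 * Q / S = Q / S + Q / S by rewrite -mulrA mulr_natl mulr2n.
  apply: lerD.
    by apply: ler_wpM2l; [exact: ltW|rewrite lef_pV2].
  apply: le_trans kapS _; rewrite expr2 invfM ler_wpM2r ?invr_ge0 ?(ltW S0)//.
  by rewrite -[leLHS]mul1r ler_pdivrMr.
apply: (@le_trans _ _ (beta * K / 8 * (2 * Q / S))).
  by apply: ler_wpM2r; [rewrite divr_ge0 ?mulr_ge0 ?(ltW Q0) ?(ltW S0)|lra].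
rewrite (_ : _ * _ = beta * (Q / 4) * (K / S)); last by field; rewrite gt_eqF.
rewrite [leRHS](_ : _ = beta * (Q / 4) * Q); last by field.
by apply: ler_wpM2l => //; rewrite !mulr_ge0 ?(ltW b0) ?(ltW Q0).
Qed.

End test_errors.

(** * Choice of the bandwidth *)

Section bandwidth_choice.
Context (R : realType) (p q : nat) (delta x : R).
Hypotheses (d0 : 0 < delta) (x1 : 1 < x).
Let D := 4 * delta + p%:R + q%:R.
Definition hstar := x `^ (- 2 / D).
(** The quantity [n * sqrt (h^(p + q))], see [sqrt_hstar]. *)
Definition sstar := x `^ (4 * delta / D).

Let x0 : 0 < x. Proof. exact: lt_trans x1. Qed.
Let l := ln x.
Let l0 : 0 < l. Proof. exact: ln_gt0. Qed.
Let powE a : x `^ a = expR (a * l). Proof. by rewrite /powR gt_eqF. Qed.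
Let D0 : 0 < D. Proof. by rewrite ltr_wpDr// ltr_wpDr// mulr_gt0. Qed.

Lemma hstar_gt0 : 0 < hstar. Proof. exact: powR_gt0. Qed.
Lemma sstar_gt0 : 0 < sstar. Proof. exact: powR_gt0. Qed.

Lemma hstar_lt1 : hstar < 1.
Proof.
rewrite /hstar powE -[ltRHS]expR0 ltr_expR nmulr_rlt0//.
by rewrite mulNr oppr_lt0 divr_gt0.
Qed.

Lemma hstar_pow : x ^+ 2 * (hstar ^+ p * hstar ^+ q) = sstar ^+ 2.
Proof.
rewrite -exprD /hstar /sstar !powE -!expRM_natl -[x in LHS]lnK ?posrE// -/l.
rewrite -expRM_natl -expRD; congr expR.
by rewrite natrD /D; field; rewrite -/D gt_eqF.
Qed.

Lemma sqrt_hstar : x * Num.sqrt (hstar ^+ p * hstar ^+ q) = sstar.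
Proof.
have h0 : 0 <= hstar ^+ p * hstar ^+ q by rewrite mulr_ge0// exprn_ge0// powR_ge0.
apply/eqP; rewrite -(@eqrXn2 _ 2)// ?(ltW sstar_gt0)//; last by rewrite mulr_ge0 ?sqrtr_ge0 ?(ltW x0).
by rewrite exprMn sqr_sqrtr// hstar_pow.
Qed.

Lemma sstar_le : sstar <= x.
Proof.
rewrite -sqrt_hstar ler_piMr ?(ltW x0)//.
rewrite -[leRHS]sqrtr1 ler_wsqrtr// mulr_ile1 ?exprn_ge0 ?powR_ge0//.
- by rewrite exprn_ile1 ?powR_ge0// ltW// hstar_lt1.
- by rewrite exprn_ile1 ?powR_ge0// ltW// hstar_lt1.
Qed.

(** The peak of the kernel is at most [h^(- p - q)] as [2 pi >= 1]. *)
Lemma kap_hstar : kap p hstar * kap q hstar / x ^+ 2 <= sstar ^- 2.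
Proof.
rewrite -hstar_pow [leRHS]invfM [leLHS]mulrC ler_wpM2l ?invr_ge0 ?exprn_ge0 ?(ltW x0)//.
have pi1 : 1 <= Num.sqrt (2 * pi) :> R.
  rewrite -[leLHS]sqrtr1 ler_wsqrtr//; have := @pi_ge2 R; lra.
have K d : kap d hstar <= (hstar ^+ d)^-1.
  rewrite /kap -exprVn lerXn2r ?nnegrE ?invr_ge0 ?mulr_ge0 ?(ltW hstar_gt0) ?sqrtr_ge0//.
  by rewrite lef_pV2 ?posrE ?mulr_gt0 ?hstar_gt0 ?sqrt2pi_gt0// ler_peMl// ltW// hstar_gt0.
by rewrite invfM ler_pM// ltW// kap_gt0// hstar_gt0.
Qed.

(** The equation that determines the bandwidth: both terms of [norm2_le_quad]
become of the order of [sstar^-1]. *)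
Lemma hstar_delta : hstar `^ (2 * delta) = sstar^-1.
Proof.
rewrite /hstar /sstar -powRrM !powE -expRN; congr expR.
by rewrite /D; field; rewrite -/D gt_eqF.
Qed.

Lemma rate_sqr : (x `^ (- (2 * delta) / D)) ^+ 2 = sstar^-1.
Proof.
rewrite /sstar !powE -expRN -expRM_natl; congr expR.
by rewrite /D; field; rewrite -/D gt_eqF.
Qed.

Lemma lt_sstar L : 0 < L -> L `^ (1 + (p%:R + q%:R) / (4 * delta)) < x -> L < sstar.
Proof.
move=> L0 Lx.
have e0 : 0 < 4 * delta / D by rewrite divr_gt0// mulr_gt0.
have := gt0_ltr_powR e0 _ _ Lx; rewrite !nnegrE powR_ge0 (ltW x0) => /(_ isT isT).
rewrite -powRrM (_ : _ * (4 * delta / D) = 1) ?powRr1 ?(ltW L0)//.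
by rewrite /D; field; rewrite -/D !gt_eqF.
Qed.

End bandwidth_choice.

Theorem corollary2 (R : realType) (p q : nat) (hp : (1 <= p)%N) (hq : (1 <= q)%N)
    (alpha beta delta r r' : R)
    (halpha0 : 0 < alpha) (halpha1 : alpha < 1 / expR 1)
    (hbeta0 : 0 < beta) (hbeta1 : beta < 1)
    (hdelta : 0 < delta) (hr : 0 < r) (hr' : 0 < r') :
  exists C : R, 0 < C /\
    forall (n : nat) (lam : 'I_p -> R) (mu : 'I_q -> R),
      (4 <= n)%N ->
      (forall i, lam i = n%:R `^ (- 2 / (4 * delta + p%:R + q%:R))) ->
      (forall j, mu j = n%:R `^ (- 2 / (4 * delta + p%:R + q%:R))) ->
      ln (1 / alpha) `^ (1 + (p%:R + q%:R) / (4 * delta)) < n%:R ->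
      [/\ Num.max (\prod_(i < p) lam i) (\prod_(j < q) mu j) < 1,
          ln (1 / alpha)
            < n%:R * Num.sqrt ((\prod_(i < p) lam i) * \prod_(j < q) mu j),
          1 < ln (1 / alpha) &
          (separation_rate (@HSIC_test R p q n alpha lam mu) delta r r' beta
           <= (C * n%:R `^ (- (2 * delta) / (4 * delta + p%:R + q%:R)))%:E)%E].
Proof.
(* [M] bounds the density, its marginals, their product and the dependence
function. The values of [K] and [C] are those of [type2_error_le] and of the
comparison of [rho ^+ 2 = C ^+ 2 / S] with [norm2_le_quad]. *)
pose M := 1 + r' + r' ^+ 2.
pose V := 2 ^+ 16 * (M + 3 * M ^+ 2).
pose K := 1 + 8 * V / beta + 2 * Num.sqrt (V / alpha).
have M0 : 0 < M by rewrite !addr_gt0// exprn_gt0.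
have V0 : 0 < V by rewrite mulr_gt0// addr_gt0// mulr_gt0// exprn_gt0.
have K0 : 0 < K.
  rewrite /K ltr_wpDr ?mulr_ge0 ?sqrtr_ge0// ltr_wpDr//.
  by rewrite divr_ge0 ?(ltW hbeta0)// mulr_ge0// ltW.
pose C := Num.sqrt (r ^+ 2 + expR (1 / 2) * K).
have C2 : 0 < r ^+ 2 + expR (1 / 2) * K by rewrite addr_gt0// ?exprn_gt0// mulr_gt0// expR_gt0.
exists C; split; first by rewrite sqrtr_gt0.
move=> n lam mu n4 lamE muE nL.
have n1 : 1 < n%:R :> R by rewrite ltr1n (leq_trans _ n4).
pose h := hstar p q delta n%:R; pose S := sstar p q delta n%:R.
have {lamE} -> : lam = fun=> h by apply/funext.
have {muE} -> : mu = fun=> h by apply/funext.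
have h0 : 0 < h by exact: hstar_gt0.
have S0 : 0 < S by exact: sstar_gt0.
have h1 : h < 1 by exact: hstar_lt1.
have L1 : 1 < ln (1 / alpha).
  have : expR 1 < 1 / alpha.
    by rewrite ltr_pdivlMr// mulrC -ltr_pdivlMr// expR_gt0.
  by rewrite -ltr_ln ?posrE ?expR_gt0 ?divr_gt0// expRK.
rewrite !prodr_const !card_ord; split => //.
- by rewrite gt_max !exprn_ilt1 ?(ltW h0)// -!lt0n hp hq.
- by rewrite sqrt_hstar// lt_sstar// (lt_trans _ L1).
have a1 : alpha < 1.
  apply: lt_le_trans halpha1 _; rewrite div1r invf_le1 ?expR_gt0//.
  by rewrite -expR0 ler_expR.
set rho := C * _; have rho0 : 0 < rho by rewrite mulr_gt0 ?sqrtr_gt0// powR_gt0// (lt_trans _ n1).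
have rho2 : rho ^+ 2 = (r ^+ 2 + expR (1 / 2) * K) / S.
  by rewrite exprMn sqr_sqrtr ?(ltW C2)// rate_sqr.
apply: ereal_inf_lbound; exists rho => //; split => //.
apply: ge_ereal_sup => _ [f [[_ _ fS] [fN f1N f2N] frho] <-].
have ipsi := integrable_dependence f.
have m1 : {ae leb2 R p q, forall z, `|f z| <= r'} by exact: Lnorm_pinfty_ae.
have f1M : {ae leb R p, forall x, `|marg1 f x| <= r'} by exact: Lnorm_pinfty_ae.
have f2M : {ae leb R q, forall y, `|marg2 f y| <= r'} by exact: Lnorm_pinfty_ae.
have m2 : {ae leb2 R p q, forall z, `|indep f z| <= r' ^+ 2}.
  apply: filterS2 (ae_fst (leb R q) f1M) (ae_snd (leb R p) f2M) => z z1 z2.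
  by rewrite -[indep f z]/(marg1 f z.1 * marg2 f z.2) normrM expr2 ler_pM.
have r2 : 0 <= r' ^+ 2 by exact: sqr_ge0.
have rM : r' <= M by rewrite /M; lra.
have r2M : r' ^+ 2 <= M by rewrite /M; lra.
have psiM : {ae leb2 R p q, forall z, `|dependence f z| <= M}.
  apply: filterS2 m1 m2 => z z1 z2; apply: le_trans (ler_normB _ _) _.
  by rewrite /M; lra.
have i2 := integrable_psi2 ipsi psiM.
have frho2 := lt_Lnorm2 (ltW rho0) i2 frho.
have low : \int[leb2 R p q]_z (dependence f z ^+ 2)
    <= expR (1 / 2) * quad (dependence f) h + r ^+ 2 / S.
  have fA : (\int[leb2 R p q]_u (enorm u `^ (2 * delta) * fpow (dependence f) u)%:E
      <= ((2 * pi) ^+ (p + q) * r ^+ 2)%:E)%E.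
    by under eq_integral do rewrite -normc_fourier.
  apply: le_trans (norm2_le_quad ipsi (ltW M0) psiM hdelta h0 fA) _.
  have pi2 : 2 * pi != 0 :> R by rewrite gt_eqF// mulr_gt0// pi_gt0.
  by rewrite lerD2l hstar_delta// [X in _ * X]mulrA -exprMn mulVf// expr1n mul1r mulrC.
apply: (@type2_error_le R p q f h M alpha S n _ _ _ _ _ _ _ _ _ _ _ _ K beta) => //.
- exact: ltW.
- exact: sstar_le.
- exact: kap_hstar.
- apply: filterS m1 => z le_r; exact: le_trans (ler_norm _) (le_trans le_r rM).
- apply: filterS m2 => z le_r; exact: le_trans (ler_norm _) (le_trans le_r r2M).
- apply: filterS f1M => x le_r; exact: le_trans (ler_norm _) (le_trans le_r rM).
- apply: filterS f2M => y le_r; exact: le_trans (ler_norm _) (le_trans le_r rM).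
rewrite -(ler_pM2l (expR_gt0 (1 / 2))).
by have := lt_le_trans frho2 low; rewrite rho2 mulrDl mulrA; lra.
Qed.
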